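(* Let $M^n$ be a Riemannian manifold with locally convex boundary. In the Riemannian cylinder $M\times\mathbb{R}$ consider a product weight $e^{\psi(p,t)}:=e^{h(p)}\,e^{v(t)}$, where $h\in C^\infty(M)$ and $v\in C^\infty(\mathbb{R})$. Suppose that $\mathrm{Ric}_v\leq c\leq\mathrm{Ric}_h$ for some constant $c\in\mathbb{R}$. If $\Sigma$ is a $\psi$-parabolic horizontal multigraph in $M\times\mathbb{R}$ with constant $\psi$-mean curvature and free boundary in $\partial M\times\mathbb{R}$, then the angle function of $\Sigma$ is constant, and one of the following holds: (i) $\Sigma$ is a cylinder, or (ii) $\Sigma$ is contained in some horizontal slice $M_s$, or (iii) $\Sigma$ is a totally geodesic hypersurface satisfying $\mathrm{Ric}_\psi(N,N)=\mathrm{Ric}_\psi(\xi,\xi)=c$ on $\Sigma$ and $\mathrm{II}(N,N)=0$ along $\partial\Sigma$.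
   Context: A Riemannian cylinder $M^n\times\mathbb{R}$ is the Riemannian product of a complete, connected, oriented $n$-dimensional Riemannian manifold $M$ (possibly with smooth boundary $\partial M$) with the standard line $\mathbb{R}$. The unit parallel vertical vector field is $\xi(p,t):=(0,1)$, and $M_s:=M\times\{s\}$ is the horizontal slice at height $s$. For a weight $e^\psi$ on a Riemannian manifold, the Bakry-Émery-Ricci tensor is $\mathrm{Ric}_\psi:=\mathrm{Ric}-\nabla^2\psi$. $\mathrm{Ric}_h$ is the corresponding tensor of $M$ with weight $e^h$, and $\mathrm{Ric}_v$ that of $\mathbb{R}$ with weight $e^v$. Thus $c\leq\mathrm{Ric}_h$ means $\mathrm{Ric}_p(w,w)-(\nabla^2h)_p(w,w)\geq c\,|w|^2$ for all $p\in M$, $w\in T_pM$, and $\mathrm{Ric}_v\leq c$ means $-v''(t)\leq c$ for all $t\in\mathbb{R}$. For a two-sided smooth hypersurface $\Sigma$ (possibly with smooth boundary $\partial\Sigma$) with unit normal (Gauss map) $N$, the $\psi$-mean curvature is $H_\psi:=-\operatorname{div}_\Sigma N-\langle\nabla\psi,N\rangle$, and the angle function is $\theta:=\langle\xi,N\rangle$. A horizontal multigraph is a two-sided connected hypersurface with a Gauss map $N$ such that $\theta\leq 0$ on $\Sigma$. $\Sigma$ is a cylinder if $\theta=0$ on $\Sigma$. On $\Sigma$ with the induced metric the $\psi$-Laplacian is $\Delta_{\Sigma,\psi}u:=\Delta_\Sigma u+\langle\nabla_\Sigma\psi,\nabla_\Sigma u\rangle$. $\Sigma$ is $\psi$-parabolic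 if every $u\in C^2(\Sigma)$ that is bounded from above, satisfies $\Delta_{\Sigma,\psi}u\geq 0$ on $\Sigma\setminus\partial\Sigma$ and $\partial u/\partial\nu\geq 0$ along $\partial\Sigma$ ($\nu$ the inner unit conormal) is constant. A hypersurface with $\partial\Sigma\neq\emptyset$ has free boundary in $\partial M\times\mathbb{R}$ if $\partial\Sigma=\Sigma\cap(\partial M\times\mathbb{R})$ and $\Sigma$ is orthogonal to $\partial M\times\mathbb{R}$ along $\partial\Sigma$ (so that $N$ is tangent to $\partial M\times\mathbb{R}$ there). $\mathrm{II}$ is the second fundamental form of $\partial M\times\mathbb{R}$ with respect to the inner unit normal $\eta$, $\mathrm{II}(X,Y)=\langle D_XY,\eta\rangle$ with $D$ the Levi-Civita connection. $\partial M$ is locally convex if its second fundamental form with respect to the inner unit normal is positive semidefinite. *)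

(* Defs.v *)
From HB Require Import structures.
From mathcomp Require Import all_boot all_order all_algebra.
From mathcomp Require Import all_classical all_reals all_analysis.

Set Implicit Arguments.
Unset Strict Implicit.
Unset Printing Implicit Defensive.

Import Order.TTheory GRing.Theory Num.Theory.
Import numFieldNormedType.Exports.

Local Open Scope classical_set_scope.
Local Open Scope ring_scope.

(* Riemannian manifolds with (possibly empty) boundary are given by an atlas
   with values in the half-space {x | 0 <= x_last} of R^(n+1), and every tensor
   is given by its components in each chart.  Tangent vectors are row vectors of
   components, so a change of chart acts by right multiplication by the
   Jacobian matrix J a b = d y_b / d x_a. *)

Section HalfSpaceCalculus.
Context {R : realType} {n : nat}.
Implicit Types (f : 'rV[R]_n.+1 -> R) (x : 'rV[R]_n.+1) (V : set 'rV[R]_n.+1).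

Definition halfspace : set 'rV[R]_n.+1 := [set x | 0 <= x ord0 ord_max].

(* Partial derivatives relative to the half-space: the usual ones at interior
   points; at boundary points the last one is one-sided. *)
Definition pquot (j : 'I_n.+1) f x (t : R) : R :=
  t^-1 * (f (x + t *: delta_mx ord0 j) - f x).

Definition psteps (j : 'I_n.+1) x : set R :=
  [set t | halfspace (x + t *: delta_mx ord0 j)].

Definition pderivable j f x : Prop :=
  cvg (pquot j f x t @[t --> within (psteps j x) (0 : R)^']).

Definition pderive j f x : R :=
  lim (pquot j f x t @[t --> within (psteps j x) (0 : R)^']).

(* C^k up to the boundary, on a relatively open subset V of the half-space. *)
Fixpoint Ck (k : nat) V f : Prop :=
  {within V, continuous f} /\
  (if k is k'.+1 then
     forall j, (forall x, V x -> pderivable j f x) /\ Ck k' V (pderive j f)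
   else True).

Definition Cinf V f : Prop := forall k, Ck k V f.

End HalfSpaceCalculus.

(* Data of an (n+1)-dimensional Riemannian manifold; the axioms are the
   predicate [riemannian_manifold] below.  [prm i] inverts [crd i], [met i p]
   is the Gram matrix of the coordinate frame of the chart i at p. *)
Record rman (R : realType) (n : nat) := RMan {
  pt : topologicalType ;
  cidx : Type ;
  dom : cidx -> set pt ;
  crd : cidx -> pt -> 'rV[R]_n.+1 ;
  prm : cidx -> 'rV[R]_n.+1 -> pt ;
  met : cidx -> pt -> 'M[R]_n.+1 }.

Arguments pt {R n} _.
Arguments cidx {R n} _.
Arguments dom {R n} _ _ _.
Arguments crd {R n} _ _ _.
Arguments prm {R n} _ _ _.
Arguments met {R n} _ _ _.

Section Manifold.
Context {R : realType} {n : nat} (M : rman R n).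
Implicit Types (i j : cidx M) (p q : pt M).

Definition img i : set 'rV[R]_n.+1 := crd M i @` dom M i.

Definition bchart i p : Prop := dom M i p /\ crd M i p ord0 ord_max = 0.

Definition boundary : set (pt M) := [set p | exists i, bchart i p].

(* The coordinate derivative d_a F in the chart i. *)
Definition ptl i (a : 'I_n.+1) (F : pt M -> R) p : R :=
  pderive a (F \o prm M i) (crd M i p).

Definition CkM (k : nat) (F : pt M -> R) : Prop :=
  forall i, Ck k (img i) (F \o prm M i).

Definition CinfM (F : pt M -> R) : Prop := forall k, CkM k F.

Definition trans_jac i j p : 'M[R]_n.+1 :=
  \matrix_(a, b) ptl i a (fun q => crd M j q ord0 b) p.

Definition smooth_manifold : Prop :=
  [/\ hausdorff_space (pt M), @second_countable (pt M),
      forall p, exists i, dom M i p,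
      forall i, [/\ open (dom M i),
        exists2 O, open O & img i = O `&` halfspace,
        forall p, dom M i p -> prm M i (crd M i p) = p,
        {within dom M i, continuous (crd M i)} &
        {within img i, continuous (prm M i)}] &
      forall i j b, Cinf (crd M i @` (dom M i `&` dom M j))
                         (fun x => crd M j (prm M i x) ord0 b)].

Definition riemannian_metric : Prop :=
  [/\ forall i p, dom M i p -> (met M i p)^T = met M i p,
      forall i p (w : 'rV[R]_n.+1), dom M i p -> w != 0 ->
        0 < (w *m met M i p *m w^T) ord0 ord0,
      forall i a b, Cinf (img i) (fun x => met M i (prm M i x) a b) &
      forall i j p, dom M i p -> dom M j p ->
        met M i p = trans_jac i j p *m met M j p *m (trans_jac i j p)^T].

Definition riemannian_manifold : Prop := smooth_manifold /\ riemannian_metric.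

(* o i p is the sign of the coordinate frame of the chart i at p.  (An atlas of
   half-space charts with positive transition Jacobians would be too
   restrictive in dimension 1.) *)
Definition orientable : Prop :=
  exists o : cidx M -> pt M -> R,
  [/\ forall i p, dom M i p -> o i p = 1 \/ o i p = -1,
      forall i, {within dom M i, continuous (o i)} &
      forall i j p, dom M i p -> dom M j p ->
        o i p = Num.sg (\det (trans_jac i j p)) * o j p].

Definition inner i p (X Y : 'rV[R]_n.+1) : R :=
  (X *m met M i p *m Y^T) ord0 ord0.

Definition velocity i (g : R -> pt M) (t : R) : 'rV[R]_n.+1 :=
  \row_k derive1 (fun s => crd M i (g s) ord0 k) t.

Definition C1_curve (g : R -> pt M) : Prop :=
  continuous g /\
  forall i k t, dom M i (g t) ->
    derivable (fun s => crd M i (g s) ord0 k) t 1 /\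
    {for t, continuous (derive1 (fun s => crd M i (g s) ord0 k))}.

Definition is_speed (g : R -> pt M) (s : R -> R) : Prop :=
  forall i t, dom M i (g t) ->
    s t = Num.sqrt (inner i (g t) (velocity i g t) (velocity i g t)).

(* Velocities may vanish, so piecewise C^1 curves add nothing to the infimum:
   they can be reparametrized to be C^1. *)
Definition rdist p q : \bar R :=
  ereal_inf [set L | exists g s,
    [/\ C1_curve g, is_speed g s, g 0 = p, g 1 = q &
        L = (\int[lebesgue_measure]_(t in `[0%R, 1%R]) (s t)%:E)%E]].

Definition complete_manifold : Prop :=
  forall u : nat -> pt M,
    (forall e : R, 0 < e -> exists N, forall k l, (N <= k)%N -> (N <= l)%N ->
       (rdist (u k) (u l) < e%:E)%E) ->
    exists p, u @ \oo --> p.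

Definition ginv i p : 'M[R]_n.+1 := invmx (met M i p).

(* christoffel i a b c is Gamma^c_(a b). *)
Definition christoffel i (a b c : 'I_n.+1) p : R :=
  2^-1 * \sum_d ginv i p c d *
    (ptl i a (fun q => met M i q b d) p + ptl i b (fun q => met M i q a d) p
     - ptl i d (fun q => met M i q a b) p).

(* The l-th component of
   R(d_a, d_b) d_c = D_(d_a) D_(d_b) d_c - D_(d_b) D_(d_a) d_c. *)
Definition riemann i (a b c l : 'I_n.+1) p : R :=
  ptl i a (christoffel i b c l) p - ptl i b (christoffel i a c l) p
  + \sum_m (christoffel i b c m p * christoffel i a m l p
            - christoffel i a c m p * christoffel i b m l p).

(* Ric(Y, Z) is the trace of X |-> R(X, Y) Z. *)
Definition ricci i p : 'M[R]_n.+1 := \matrix_(b, c) \sum_a riemann i a b c a p.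

Definition hessian i (F : pt M -> R) p : 'M[R]_n.+1 :=
  \matrix_(a, b) (ptl i a (ptl i b F) p
                  - \sum_c christoffel i a b c p * ptl i c F p).

(* Ric_psi(X, Y) for the weight e^psi. *)
Definition ric_w (psi : pt M -> R) i p (X Y : 'rV[R]_n.+1) : R :=
  (X *m (ricci i p - hessian i psi p) *m Y^T) ord0 ord0.

Definition laplacian_w (psi : pt M -> R) i (u : pt M -> R) p : R :=
  \tr (ginv i p *m hessian i u p)
  + \sum_a \sum_b ginv i p a b * ptl i a psi p * ptl i b u p.

(* In a chart around a boundary point the boundary is {x_last = 0}. *)
Definition inner_unit_normal i p (w : 'rV[R]_n.+1) : Prop :=
  [/\ inner i p w w = 1, 0 < w ord0 ord_max &
      forall X : 'rV[R]_n.+1, X ord0 ord_max = 0 -> inner i p X w = 0].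

(* <D_X Y, eta> for X, Y tangent to the boundary, where Y is extended with
   constant components, which keeps it tangent to the boundary. *)
Definition second_ff_boundary i p (eta X Y : 'rV[R]_n.+1) : R :=
  inner i p (\row_c \sum_a \sum_b christoffel i a b c p * X ord0 a * Y ord0 b)
        eta.

Definition locally_convex_boundary : Prop :=
  forall i p (eta X : 'rV[R]_n.+1), bchart i p -> inner_unit_normal i p eta ->
    X ord0 ord_max = 0 -> 0 <= second_ff_boundary i p eta X X.

Definition parabolic (psi : pt M -> R) : Prop :=
  forall u : pt M -> R,
    CkM 2 u ->
    (exists B, forall p, u p <= B) ->
    (forall i p, dom M i p -> ~ boundary p -> 0 <= laplacian_w psi i u p) ->
    (forall i p (nu : 'rV[R]_n.+1), bchart i p -> inner_unit_normal i p nu ->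
       0 <= \sum_a nu ord0 a * ptl i a u p) ->
    exists k, forall p, u p = k.

End Manifold.

(* The Riemannian product M x R.  The vertical coordinate comes first, so that
   the last coordinate is still the one defining the boundary. *)
Definition cylinder (R : realType) (n : nat) (M : rman R n) : rman R n.+1 :=
  @RMan R n.+1 (pt M * R)%type (cidx M)
    (fun i => dom M i `*` setT)
    (fun i q => row_mx (q.2)%:M (crd M i q.1) : 'rV[R]_(1 + n.+1))
    (fun i (y : 'rV[R]_(1 + n.+1)) =>
       (prm M i (rsubmx y), lsubmx y ord0 ord0))
    (fun i q => block_mx 1%:M 0 0 (met M i q.1) : 'M[R]_(1 + n.+1)).

(* The vertical field has the same components in every chart. *)
Definition xi {R : realType} {n : nat} : 'rV[R]_n.+2 := delta_mx ord0 ord0.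

(* A two-sided hypersurface of W is an isometric immersion f of a Riemannian
   manifold S, one dimension lower, with a unit normal field N along f; N i p
   is the row of components of N at p in the chart i of W. *)
Section Hypersurface.
Context {R : realType} {n : nat} (W : rman R n.+1) (S : rman R n).
Context (f : pt S -> pt W) (N : cidx W -> pt S -> 'rV[R]_n.+2).
Implicit Types (a : cidx S) (i j : cidx W) (p : pt S) (b c : 'I_n.+1).

Definition jac a i p : 'M[R]_(n.+1, n.+2) :=
  \matrix_(b, k) ptl a b (fun q => crd W i (f q) ord0 k) p.

Definition overlap a i : set 'rV[R]_n.+1 :=
  crd S a @` (dom S a `&` f @^-1` dom W i).

Definition isometric_immersion : Prop :=
  [/\ continuous f,
      forall a i k, Cinf (overlap a i)
        (fun x => crd W i (f (prm S a x)) ord0 k) &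
      forall a i p, dom S a p -> dom W i (f p) ->
        met S a p = jac a i p *m met W i (f p) *m (jac a i p)^T].

Definition gauss_map : Prop :=
  [/\ forall i j p, dom W i (f p) -> dom W j (f p) ->
        N j p = N i p *m trans_jac i j (f p),
      forall a i k, Cinf (overlap a i) (fun x => N i (prm S a x) ord0 k),
      forall i p, dom W i (f p) -> inner i (f p) (N i p) (N i p) = 1 &
      forall a i p b, dom S a p -> dom W i (f p) ->
        inner i (f p) (row b (jac a i p)) (N i p) = 0].

(* D_(d_b) N along f, in the charts a of S and i of W. *)
Definition cov_normal a i b p : 'rV[R]_n.+2 :=
  \row_k (ptl a b (fun q => N i q ord0 k) p
          + \sum_l \sum_m christoffel i l m k (f p)
                          * jac a i p b l * N i p ord0 m).

(* Components -<D_(d_b) N, d_c f> of the second fundamental form. *)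
Definition second_ff a i p : 'M[R]_n.+1 :=
  \matrix_(b, c) - inner i (f p) (cov_normal a i b p) (row c (jac a i p)).

Definition div_normal a i p : R :=
  \sum_b \sum_c ginv a p b c
    * inner i (f p) (cov_normal a i b p) (row c (jac a i p)).

Definition mean_curvature_w (psi : pt W -> R) a i p : R :=
  - div_normal a i p - \sum_k N i p ord0 k * ptl i k psi (f p).

Definition constant_mean_curvature_w (psi : pt W -> R) : Prop :=
  exists H, forall a i p, dom S a p -> dom W i (f p) ->
    mean_curvature_w psi a i p = H.

Definition totally_geodesic : Prop :=
  forall a i p, dom S a p -> dom W i (f p) -> second_ff a i p = 0.

Definition free_boundary : Prop :=
  boundary (M := S) = f @^-1` boundary (M := W) /\
  forall i p (eta : 'rV[R]_n.+2), boundary p -> bchart i (f p) ->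
    inner_unit_normal i (f p) eta -> inner i (f p) (N i p) eta = 0.

End Hypersurface.

Section CylinderHypersurface.
Context {R : realType} {n : nat} (M : rman R n) (S : rman R n).
Context (f : pt S -> pt (cylinder M)).
Context (N : cidx (cylinder M) -> pt S -> 'rV[R]_n.+2).

Definition angle (i : cidx (cylinder M)) (p : pt S) : R :=
  inner i (f p) xi (N i p).

Definition constant_angle : Prop :=
  exists k, forall i p, dom (cylinder M) i (f p) -> angle i p = k.

Definition horizontal_multigraph : Prop :=
  [/\ connected [set: pt S], riemannian_manifold S,
      isometric_immersion f, gauss_map f N &
      forall i p, dom (cylinder M) i (f p) -> angle i p <= 0].

Definition is_cylinder : Prop :=
  forall i p, dom (cylinder M) i (f p) -> angle i p = 0.

Definition in_slice : Prop := exists s : R, forall p, (f p).2 = s.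

End CylinderHypersurface.

(* Main.v *)
Require Import Defs.
From HB Require Import structures.
From mathcomp Require Import all_boot all_order all_algebra.
From mathcomp Require Import all_classical all_reals all_analysis.
From mathcomp Require Import ring lra.
Import Order.TTheory GRing.Theory Num.Theory.
Import numFieldNormedType.Exports.
Local Open Scope classical_set_scope.
Local Open Scope ring_scope.
Set Implicit Arguments.
Unset Strict Implicit.
Unset Printing Implicit Defensive.

(* The angle function theta = <xi, N> is the vertical component of N, and xi is
   parallel, so theta satisfies the Jacobi equation
     Lap_psi theta = - theta (|A|^2 + Ric_psi(N, N)) + Ric_psi(xi, N)
                   = - theta (|A|^2 + v'' + Ric_psi(N, N)),
   where v'' + Ric_psi(N, N) = (v'' + c)(1 - theta^2)
   + (Ric_h(N_h, N_h) - c |N_h|^2) for the horizontal part N_h of N.  Since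
   theta <= 0 this makes theta psi-subharmonic.  Along the boundary the inner conormal is
   the inner normal eta of the cylinder and d theta / d nu = - theta II(N, N) >= 0
   by local convexity.  Parabolicity forces theta to be constant, and then, unless
   theta = 0, every nonnegative term above vanishes.

   The Jacobi equation is derived in arbitrary charts: the rough Laplacian of N
   along the immersion is expanded in the frame (N, d_1 f, ..., d_n f), its
   tangential part being a Codazzi trace.  All the calculus is one-sided up to
   the boundary of the half-space, so that the equation also holds at boundary
   points and no density argument is needed. *)

(** * Calculus on the half-space *)

(** Constancy of the psi-mean curvature enters through its derivative along Sigma. Combined with
    Codazzi, it turns the tangential part of the rough Laplacian of N into a Ric_psi term plus a
    term in the gradient of psi, and the drift of the psi-Laplacian cancels the latter. The height
    differential is parallel, so the vertical component of this vector identity is a scalar equation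
    for theta. At the boundary the key identity is <D_nu N, xi> = <D_w N, eta>, with w the
    tangential part of xi; it rests on the symmetry of the shape operator. Since w is tangent to the
    boundary, the right side needs only the vanishing of the last component of N there. The charts
    of Sigma and of the cylinder are unrelated, and being a boundary point is asserted in some chart
    only, so it must be moved to a given one. The trichotomy is read off the constant k = theta: k =
    0 is a cylinder; k^2 = 1 makes N vertical, so the height is locally constant; otherwise 1 - k^2
    is nonzero and the product (v'' + c)(1 - k^2) can vanish only with v'' = -c. *)

Section PartialDerivatives.
Context {R : realType} {n : nat}.
Implicit Types (f g : 'rV[R]_n.+1 -> R) (x y : 'rV[R]_n.+1) (j : 'I_n.+1).
Local Notation H := (@halfspace R n).
Local Notation dir j := (delta_mx ord0 j : 'rV[R]_n.+1).

(** [pderive] is a [lim], which has a value even when no limit exists. The relational form carries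
    existence and value together; [is_pd_unique] transfers the rules to [pderive]. *)
Definition is_pd j f x (d : R) : Prop :=
  pquot j f x t @[t --> within (psteps j x) (0 : R)^'] --> d.

Lemma psteps_ge0 j x t : H x -> 0 <= t -> psteps j x t.
Proof.
rewrite /psteps /halfspace /= => Hx t0.
by rewrite !mxE addr_ge0 // mulr_ge0 //; case: (_ && _).
Qed.

Lemma near_psteps j x (P : R -> Prop) :
  (\forall t \near (0 : R), t != 0 -> psteps j x t -> P t) ->
  \forall t \near within (psteps j x) (0 : R)^', P t.
Proof. by []. Qed.

Lemma all_psteps j x (P : R -> Prop) :
  (forall t, t != 0 -> psteps j x t -> P t) ->
  \forall t \near within (psteps j x) (0 : R)^', P t.
Proof. by move=> h; apply: near_psteps; near=> t; exact: h. Unshelve. all: by end_near. Qed.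

(** Positive increments never leave the half-space. This makes the filter of admissible steps
    proper, hence limits unique, at boundary points too. *)
Lemma at_right_psteps j x : H x -> (0 : R)^'+ `=>` within (psteps j x) (0 : R)^'.
Proof.
move=> Hx A; rewrite /within /= => hA.
rewrite /at_right /within /=; apply: filterS (hA : \forall t \near (0:R), _) => t h t0.
apply: h; first by rewrite gt_eqF.
exact/psteps_ge0/ltW.
Qed.

Lemma psteps_proper j x : H x -> ProperFilter (within (psteps j x) (0 : R)^').
Proof.
move=> Hx; split; last exact: within_filter.
by move=> h0; have := @at_right_psteps j x Hx set0 h0; exact: filter_not_empty.
Qed.

Lemma is_pd_unique j f x d : H x -> is_pd j f x d -> pderive j f x = d.
Proof.
by move=> Hx hd; have ? := psteps_proper j Hx; exact: (cvg_lim (@Rhausdorff R) hd).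
Qed.

Lemma pderivableP j f x : pderivable j f x -> is_pd j f x (pderive j f x).
Proof. by []. Qed.

Lemma is_pd_pderivable j f x d : is_pd j f x d -> pderivable j f x.
Proof. by move=> hd; apply/cvg_ex; exists d. Qed.

Lemma step_cvg j x :
  x + t *: dir j @[t --> within (psteps j x) (0 : R)^'] --> within H (nbhs x).
Proof.
have c0 : x + t *: dir j @[t --> (0 : R)] --> x.
  rewrite -[X in _ --> X]addr0 -(scale0r (dir j)).
  apply: cvgD; first exact: cvg_cst.
  by apply: cvgZr_tmp; exact: cvg_id.
move=> A hA.
have h : \forall t \near (0 : R), H (x + t *: dir j) -> A (x + t *: dir j).
  exact: c0 _ hA.
by apply: near_psteps; apply: filterS h => t + _; exact.
Qed.

Lemma within_near j x (P : 'rV[R]_n.+1 -> Prop) :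
  (\forall y \near within H (nbhs x), P y) ->
  \forall t \near within (psteps j x) (0 : R)^', P (x + t *: dir j).
Proof. exact: step_cvg. Qed.

Lemma within_self x (P : 'rV[R]_n.+1 -> Prop) : H x ->
  (\forall y \near within H (nbhs x), P y) -> P x.
Proof. by move=> Hx hP; exact: (nbhs_singleton hP). Qed.

Lemma is_pd_near j f g x d : H x ->
  (\forall y \near within H (nbhs x), f y = g y) ->
  is_pd j f x d -> is_pd j g x d.
Proof.
move=> Hx fg; rewrite /is_pd => hd.
apply: cvg_trans hd; apply: near_eq_cvg.
have e0 := within_self Hx fg.
have := within_near j fg.
by apply: filterS => t e; rewrite /pquot e e0.
Qed.

Lemma pderive_near j f g x : H x ->
  (\forall y \near within H (nbhs x), f y = g y) ->
  pderive j f x = pderive j g x.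
Proof.
move=> Hx fg; have e0 := within_self Hx fg.
have e : \forall t \near within (psteps j x) (0 : R)^', pquot j f x t = pquot j g x t.
  by apply: filterS (within_near j fg) => t e; rewrite /pquot e e0.
rewrite /pderive; congr (lim _); apply/seteqP; split => A /=.
  by move=> hA; apply: filterS2 e hA => t et; rewrite /= et.
by move=> hA; apply: filterS2 e hA => t et; rewrite /= et.
Qed.

Lemma is_pd_cst j (c : R) x : is_pd j (fun=> c) x 0.
Proof.
rewrite /is_pd /pquot; under eq_fun do rewrite subrr mulr0; exact: cvg_cst.
Qed.

Lemma is_pdD j f g x a b : is_pd j f x a -> is_pd j g x b ->
  is_pd j (fun y => f y + g y) x (a + b).
Proof.
rewrite /is_pd => ha hb.
rewrite (_ : (fun t => _) = fun t => pquot j f x t + pquot j g x t).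
  exact: cvgD ha hb.
by apply/funext => t; rewrite /pquot; ring.
Qed.

(** A partial derivative gives continuity only along its coordinate line, which is all that the
    product and inverse rules use. *)
Lemma is_pd_incr_cvg j f x d : is_pd j f x d ->
  f (x + t *: dir j) @[t --> within (psteps j x) (0 : R)^'] --> f x.
Proof.
rewrite /is_pd => hd.
have ht : (fun t : R => t) @ within (psteps j x) (0 : R)^' --> (0:R).
  by apply: cvg_within_filter; apply: cvg_within_filter; exact: cvg_id.
have h : t * pquot j f x t + f x @[t --> within (psteps j x) (0 : R)^']
    --> 0 * d + f x.
  by apply: cvgD; [exact: cvgM | exact: cvg_cst].
rewrite mul0r add0r in h.
apply: cvg_trans h; apply: near_eq_cvg; apply: all_psteps.
by move=> t t0 _; rewrite /pquot mulrA divff // mul1r subrK.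
Qed.

Lemma is_pdM j f g x a b : is_pd j f x a -> is_pd j g x b ->
  is_pd j (fun y => f y * g y) x (a * g x + f x * b).
Proof.
move=> ha hb; have hg := is_pd_incr_cvg hb; rewrite /is_pd in ha hb *.
rewrite (_ : (fun t => _) = fun t =>
  pquot j f x t * g (x + t *: dir j) + f x * pquot j g x t).
  by apply: cvgD; [exact: cvgM | apply: cvgM => //; exact: cvg_cst].
by apply/funext => t; rewrite /pquot; ring.
Qed.

Lemma is_pdZ j (c : R) f x a : is_pd j f x a ->
  is_pd j (fun y => c * f y) x (c * a).
Proof.
by move=> /(is_pdM (is_pd_cst j c x)); rewrite mul0r add0r.
Qed.

Lemma is_pdN j f x a : is_pd j f x a -> is_pd j (fun y => - f y) x (- a).
Proof.
move=> /(is_pdZ (c := -1)); rewrite mulN1r; congr is_pd.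
by apply/funext => y; rewrite mulN1r.
Qed.

Lemma is_pdB j f g x a b : is_pd j f x a -> is_pd j g x b ->
  is_pd j (fun y => f y - g y) x (a - b).
Proof. by move=> ha hb; apply: is_pdD => //; exact: is_pdN. Qed.

Lemma is_pd_sum j (I : Type) (r : seq I) (F : I -> 'rV[R]_n.+1 -> R) x
    (d : I -> R) :
  (forall i, is_pd j (F i) x (d i)) ->
  is_pd j (fun y => \sum_(i <- r) F i y) x (\sum_(i <- r) d i).
Proof.
move=> hF; elim: r => [|i r IH].
  rewrite big_nil (_ : (fun y => _) = (fun=> 0)); first exact: is_pd_cst.
  by apply/funext => y; rewrite big_nil.
rewrite big_cons (_ : (fun y => _) = (fun y => F i y + \sum_(i <- r) F i y)).
  exact: is_pdD.
by apply/funext => y; rewrite big_cons.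
Qed.

Lemma is_pdV j f x a : H x -> f x != 0 -> is_pd j f x a ->
  is_pd j (fun y => (f y)^-1) x (- (a / f x ^+ 2)).
Proof.
move=> Hx fx0 ha; have hf := is_pd_incr_cvg ha.
rewrite /is_pd in ha *.
have hn : \forall t \near within (psteps j x) (0 : R)^', f (x + t *: dir j) != 0.
  have ? := psteps_proper j Hx.
  by apply: (cvgr_neq0 _ hf).
have h : - (pquot j f x t * ((f (x + t *: dir j))^-1 * (f x)^-1))
    @[t --> within (psteps j x) (0 : R)^'] --> - (a * ((f x)^-1 * (f x)^-1)).
  have ? := psteps_proper j Hx.
  apply: cvgN; apply: cvgM => //; apply: cvgM; last exact: cvg_cst.
  exact: cvgV.
rewrite -invfM -expr2 in h.
apply: cvg_trans h; apply: near_eq_cvg.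
move: hn; apply: filterS => t h0.
rewrite /pquot.
have -> : (f (x + t *: dir j))^-1 - (f x)^-1 =
  - (f (x + t *: dir j) - f x) * ((f (x + t *: dir j))^-1 * (f x)^-1).
  by rewrite opprB mulrBl mulrCA divff // mulr1 mulrA divff // mul1r.
by ring.
Qed.

End PartialDerivatives.

Lemma pderive_quot {R : realType} {m n : nat} (j : 'I_m.+1) (k : 'I_n.+1)
    (f : 'rV[R]_m.+1 -> R) (g : 'rV[R]_n.+1 -> R) x y :
  psteps j x = psteps k y -> (forall t, pquot j f x t = pquot k g y t) ->
  pderive j f x = pderive k g y.
Proof. by move=> e /funext h; rewrite /pderive e h. Qed.

(** * Mean value estimates, C^k classes and mixed partials up to the boundary *)

Section MeanValue.
Context {R : realType} {n : nat}.
Implicit Types (f g : 'rV[R]_n.+1 -> R) (x y : 'rV[R]_n.+1) (j : 'I_n.+1).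
Implicit Types (V : set 'rV[R]_n.+1).
Local Notation H := (@halfspace R n).
Local Notation dir j := (delta_mx ord0 j : 'rV[R]_n.+1).

Lemma near_boxP x (P : 'rV[R]_n.+1 -> Prop) :
  (\forall y \near within H (nbhs x), P y) <->
  exists2 e, 0 < e &
    forall y, H y -> (forall k, `|y ord0 k - x ord0 k| < e) -> P y.
Proof.
split.
  move=> /nbhs_ballP[e e0 he]; exists e => // y Hy hy.
  by apply: he => //; split => // i k; rewrite ord1 /ball /= distrC.
move=> [e e0 he]; apply/nbhs_ballP; exists e => // y hy Hy.
by apply: he => // k; rewrite distrC; case: hy => _; apply.
Qed.

Lemma segment_cvg f x j (s : R) (d : R -> R) : H x ->
  (forall t, 0 <= t <= s -> is_pd j f (x + t *: dir j) (d t)) ->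
  forall t, 0 <= t <= s ->
  f (x + u *: dir j) @[u --> within `[0, s] (nbhs t)] --> f (x + t *: dir j).
Proof.
move=> Hx hd t ts A hA.
have := is_pd_incr_cvg (hd t ts) hA.
rewrite /= /within /= => h.
have {}h : \forall u \near (0 : R), u != 0 -> psteps j (x + t *: dir j) u ->
  A (f (x + t *: dir j + u *: dir j)) by exact: h.
have /= hs : (fun u : R => u - t) @ t --> (t - t) by apply: cvgB; [exact: cvg_id|exact: cvg_cst].
rewrite subrr in hs.
have {}h : \forall u \near t, u - t != 0 -> psteps j (x + t *: dir j) (u - t) ->
  A (f (x + t *: dir j + (u - t) *: dir j)) by exact: hs _ h.
suff : \forall u \near t, u \in `[0, s] -> A (f (x + u *: dir j)) by [].
move: h; apply: filterS => u hu.
rewrite in_itv /= => /andP[u0 us].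
have [->|ut] := eqVneq u t; first exact: nbhs_singleton hA.
have -> : x + u *: dir j = x + t *: dir j + (u - t) *: dir j.
  by rewrite -addrA -scalerDl subrKC.
apply: hu; first by rewrite subr_eq0.
rewrite /psteps /= -addrA -scalerDl subrKC.
exact: psteps_ge0.
Qed.

(** The base point may lie on the boundary: the classical theorem asks for two-sided derivatives
    only inside the segment and for continuity at its ends ([segment_cvg]). *)
Lemma pd_mvt j f x (s : R) (d : R -> R) : H x -> 0 < s ->
  (forall t, 0 <= t <= s -> is_pd j f (x + t *: dir j) (d t)) ->
  exists2 t, 0 < t < s & f (x + s *: dir j) - f x = s * d t.
Proof.
move=> Hx s0 hd.
have [||t] := @MVT R (fun t => f (x + t *: dir j)) d 0 s s0.
- move=> t; rewrite in_itv /= => /andP[t0 ts].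
  have ht : 0 <= t <= s by rewrite !ltW.
  have h := hd t ht.
  have hF : (fun h : R => h^-1 *: (((fun u => f (x + u *: dir j)) \o shift t) (h *: 1)
      - f (x + t *: dir j))) @ (0 : R)^' --> d t.
    rewrite /is_pd in h => A hA.
    have {}h : \forall u \near (0 : R), u != 0 -> psteps j (x + t *: dir j) u ->
      A (pquot j f (x + t *: dir j) u) by exact: h _ hA.
    suff : \forall u \near (0 : R), u != 0 -> A (u^-1 *: (((fun u => f (x + u *: dir j))
        \o shift t) (u *: 1) - f (x + t *: dir j))) by [].
    (* With |u| < t the sum t + u stays positive, so every such increment is admissible and the
       limit is two-sided. *)
    have hb : \forall u \near (0 : R), `|u| < t by exact: nbhs0_lt.
    move: h hb; apply: filterS2 => u h + u0.
    move=> /ltr_normlP[ut1 ut2].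
    have := h u0; rewrite /pquot /psteps /= -addrA -scalerDl.
    rewrite /shift /GRing.scale /= mulr1 [t + u]addrC; apply.
    by apply: psteps_ge0 => //; lra.
  split; first by apply/cvg_ex; exists (d t).
  by apply: (cvg_lim (@Rhausdorff R)).
- apply/subspace_continuousP => t /=; rewrite in_itv /= => ts.
  exact: (segment_cvg Hx hd).
- move=> hts e; rewrite in_itv /= in hts; exists t => //.
  by move: e; rewrite scale0r addr0 subr0 mulrC.
Qed.

Definition relopen V : Prop :=
  V `<=` H /\ forall x, V x -> \forall y \near within H (nbhs x), V y.

Definition relcont V f : Prop :=
  forall x, V x -> f y @[y --> within H (nbhs x)] --> f x.

Lemma relopen_relcont V f : relopen V ->
  {within V, continuous f} <-> relcont V f.
Proof.
move=> [VH Vo]; split.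
  move=> /subspace_continuousP h x Vx A hA.
  have h1 : \forall y \near nbhs x, V y -> A (f y) by exact: h x Vx A hA.
  have h2 : \forall y \near nbhs x, H y -> V y by exact: Vo.
  suff : \forall y \near nbhs x, H y -> A (f y) by [].
  by move: h1 h2; apply: filterS2 => y h1 h2 Hy; apply/h1/h2.
move=> h; apply/subspace_continuousP => x Vx A hA.
have h1 : \forall y \near nbhs x, H y -> A (f y) by exact: h x Vx A hA.
suff : \forall y \near nbhs x, V y -> A (f y) by [].
by apply: filterS h1 => y h1 Vy; apply/h1/VH.
Qed.

Lemma relcont_box V f x (e : R) : relcont V f -> V x -> 0 < e ->
  \forall y \near within H (nbhs x), `|f y - f x| < e.
Proof.
move=> hf Vx e0; have /cvgrPdist_lt/(_ e e0) := hf x Vx.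
by apply: filterS => y; rewrite distrC.
Qed.

Lemma CkS k V f : relopen V ->
  Ck k.+1 V f <-> relcont V f /\
    forall j, (forall x, V x -> pderivable j f x) /\ Ck k V (pderive j f).
Proof. by move=> Vo; rewrite /= relopen_relcont. Qed.

Lemma Ck_relcont k V f : relopen V -> Ck k V f -> relcont V f.
Proof. by move=> Vo; case: k => [|k] [/(relopen_relcont _ Vo)]. Qed.

Lemma Ck0 V f : relopen V -> Ck 0 V f <-> relcont V f.
Proof. by move=> Vo; rewrite /= (relopen_relcont f Vo); split => [[]|]. Qed.

Lemma Ck_pd k V f x j : Ck k.+1 V f -> V x -> is_pd j f x (pderive j f x).
Proof. by move=> /= [_ h] Vx; have [/(_ x Vx)] := h j. Qed.

Lemma Ck_pderive k V f j : Ck k.+1 V f -> Ck k V (pderive j f).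
Proof. by move=> /= [_ h]; have [] := h j. Qed.

Lemma Ck_prev k V f : Ck k.+1 V f -> Ck k V f.
Proof.
elim: k f => [|k IH] f; first by move=> [? _]; split.
move=> [hf h]; split => // j; have [h1 h2] := h j; split => //.
exact: IH.
Qed.

Lemma relcont_near V f g : relopen V -> (forall x, V x -> f x = g x) ->
  relcont V f -> relcont V g.
Proof.
move=> [_ Vo] fg hf x Vx; rewrite -fg //.
apply: cvg_trans (hf x Vx); apply: near_eq_cvg.
by move: (Vo x Vx); apply: filterS => y Vy; rewrite fg.
Qed.

Lemma Ck_eq k V f g : relopen V -> (forall x, V x -> f x = g x) ->
  Ck k V f -> Ck k V g.
Proof.
move=> Vo; elim: k f g => [|k IH] f g fg.
  by rewrite !Ck0 //; exact: relcont_near.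
rewrite !CkS // => -[cf hf]; split; first exact: relcont_near cf.
have [VH Vn] := Vo.
have fgn x : V x -> \forall y \near within H (nbhs x), f y = g y.
  by move=> Vx; move: (Vn x Vx); apply: filterS.
move=> j; have [df kf] := hf j; split.
  move=> x Vx; have := pderivableP (df x Vx).
  move=> /(is_pd_near (VH _ Vx) (fgn x Vx)).
  exact: is_pd_pderivable.
apply: IH kf => x Vx; exact: pderive_near (VH _ Vx) (fgn x Vx).
Qed.

Lemma Ck_mk k V f (d : 'I_n.+1 -> 'rV[R]_n.+1 -> R) : relopen V ->
  relcont V f -> (forall j x, V x -> is_pd j f x (d j x)) ->
  (forall j, Ck k V (d j)) -> Ck k.+1 V f.
Proof.
move=> Vo cf hd kd; apply/CkS => //; split => // j; split.
  by move=> x Vx; apply: is_pd_pderivable (hd j x Vx).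
apply: Ck_eq (kd j) => // x Vx.
by rewrite (is_pd_unique (proj1 Vo _ Vx) (hd j x Vx)).
Qed.

Lemma Ck_local k V f : relopen V ->
  (forall x, V x -> exists V', [/\ relopen V', V' x & Ck k V' f]) -> Ck k V f.
Proof.
move=> Vo; elim: k f => [|k IH] f h.
  apply/Ck0 => // x Vx; have [V' [Vo' Vx' hf]] := h x Vx.
  by move/Ck0: hf => /(_ Vo'); apply.
apply/CkS => //; split.
  move=> x Vx; have [V' [Vo' Vx' hf]] := h x Vx.
  exact: (Ck_relcont Vo' hf).
move=> j; split => [x Vx|].
  have [V' [Vo' Vx' hf]] := h x Vx.
  exact: is_pd_pderivable (Ck_pd hf Vx').
apply: IH => x Vx; have [V' [Vo' Vx' hf]] := h x Vx.
by exists V'; split => //; exact: Ck_pderive.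
Qed.

Lemma Ck_sub k V V' f : relopen V -> relopen V' -> V `<=` V' ->
  Ck k V' f -> Ck k V f.
Proof. by move=> Vo Vo' VV' hf; apply: Ck_local => // x /VV' Vx; exists V'. Qed.

Lemma Ck_cst k V (c : R) : relopen V -> Ck k V (fun=> c).
Proof.
move=> Vo; have cc (a : R) : relcont V (fun=> a) by move=> x _; exact: cvg_cst.
elim: k c => [|k IH] c; first exact/Ck0.
by apply: (Ck_mk (d := fun _ _ => 0)) => // j x Vx; exact: is_pd_cst.
Qed.

Lemma relcontD V f g : relcont V f -> relcont V g ->
  relcont V (fun x => f x + g x).
Proof. by move=> hf hg x Vx; apply: cvgD; [exact: hf|exact: hg]. Qed.

Lemma relcontM V f g : relcont V f -> relcont V g ->
  relcont V (fun x => f x * g x).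
Proof. by move=> hf hg x Vx; apply: cvgM; [exact: hf|exact: hg]. Qed.

Lemma CkD k V f g : relopen V -> Ck k V f -> Ck k V g ->
  Ck k V (fun x => f x + g x).
Proof.
move=> Vo; elim: k f g => [|k IH] f g.
  by rewrite !Ck0 //; exact: relcontD.
move=> kf kg; apply: (Ck_mk (d := fun j x => pderive j f x + pderive j g x)) => //.
- exact: relcontD (Ck_relcont Vo kf) (Ck_relcont Vo kg).
- by move=> j x Vx; apply: is_pdD; [exact: (Ck_pd kf)|exact: (Ck_pd kg)].
- by move=> j; apply: IH; exact: Ck_pderive.
Qed.

Lemma Ck_mul k V f g : relopen V -> Ck k V f -> Ck k V g ->
  Ck k V (fun x => f x * g x).
Proof.
move=> Vo; elim: k f g => [|k IH] f g.
  by rewrite !Ck0 //; exact: relcontM.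
move=> kf kg; apply: (Ck_mk
  (d := fun j x => pderive j f x * g x + f x * pderive j g x)) => //.
- exact: relcontM (Ck_relcont Vo kf) (Ck_relcont Vo kg).
- by move=> j x Vx; apply: is_pdM; [exact: (Ck_pd kf)|exact: (Ck_pd kg)].
- move=> j; apply: CkD => //; apply: IH; by [exact: Ck_pderive|exact: Ck_prev].
Qed.

Lemma CkN k V f : relopen V -> Ck k V f -> Ck k V (fun x => - f x).
Proof.
move=> Vo hf; apply: (Ck_eq (f := fun x => -1 * f x)) => //.
  by move=> x _; rewrite mulN1r.
by apply: Ck_mul => //; exact: Ck_cst.
Qed.

Lemma CkB k V f g : relopen V -> Ck k V f -> Ck k V g ->
  Ck k V (fun x => f x - g x).
Proof. by move=> Vo kf kg; apply: CkD => //; exact: CkN. Qed.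

Lemma Ck_sum k V (I : Type) (r : seq I) (P : pred I) (F : I -> 'rV[R]_n.+1 -> R) :
  relopen V ->
  (forall i, Ck k V (F i)) -> Ck k V (fun x => \sum_(i <- r | P i) F i x).
Proof.
move=> Vo hF; elim: r => [|i r IH].
  by apply: (Ck_eq (f := fun=> 0)) => //; [move=> x _; rewrite big_nil|exact: Ck_cst].
apply: (Ck_eq (f := fun x => (if P i then F i x else 0) + \sum_(i <- r | P i) F i x)) => //.
  by move=> x _; rewrite big_cons; case: ifP => //; rewrite add0r.
by apply: CkD => //; case: (P i) => //; exact: Ck_cst.
Qed.

Lemma Ck_prod k V (I : Type) (r : seq I) (P : pred I) (F : I -> 'rV[R]_n.+1 -> R) :
  relopen V ->
  (forall i, Ck k V (F i)) -> Ck k V (fun x => \prod_(i <- r | P i) F i x).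
Proof.
move=> Vo hF; elim: r => [|i r IH].
  by apply: (Ck_eq (f := fun=> 1)) => //; [move=> x _; rewrite big_nil|exact: Ck_cst].
apply: (Ck_eq (f := fun x => (if P i then F i x else 1) * \prod_(i <- r | P i) F i x)) => //.
  by move=> x _; rewrite big_cons; case: ifP => //; rewrite mul1r.
by apply: Ck_mul => //; case: (P i) => //; exact: Ck_cst.
Qed.

Lemma CkV k V f : relopen V -> (forall x, V x -> f x != 0) -> Ck k V f ->
  Ck k V (fun x => (f x)^-1).
Proof.
move=> Vo f0 kf.
have cV : relcont V (fun x => (f x)^-1).
  by move=> x Vx; apply: cvgV; [exact: f0|exact: (Ck_relcont Vo kf)].
elim: k kf => [|k IH] kf; first exact/Ck0.
apply: (Ck_mk (d := fun j x => - (pderive j f x * ((f x)^-1 * (f x)^-1)))) => //.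
- move=> j x Vx; rewrite -invfM -expr2.
  apply: is_pdV; [exact: (proj1 Vo)|exact: f0|exact: (Ck_pd kf)].
- move=> j; apply: CkN => //; apply: Ck_mul => //; first exact: Ck_pderive.
  by apply: Ck_mul => //; apply: IH; exact: Ck_prev.
Qed.

Lemma Ck_det k V m (A : 'rV[R]_n.+1 -> 'M[R]_m) : relopen V ->
  (forall a b, Ck k V (fun x => A x a b)) -> Ck k V (fun x => \det (A x)).
Proof.
move=> Vo hA; rewrite /determinant; apply: Ck_sum => // s.
apply: Ck_mul => //; first exact: Ck_cst.
exact: Ck_prod.
Qed.

Lemma Ck_invmx k V m (A : 'rV[R]_n.+1 -> 'M[R]_m) : relopen V ->
  (forall x, V x -> A x \in unitmx) ->
  (forall a b, Ck k V (fun x => A x a b)) ->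
  forall a b, Ck k V (fun x => invmx (A x) a b).
Proof.
move=> Vo uA hA i j.
apply: (Ck_eq (f := fun x => (\det (A x))^-1 * cofactor (A x) j i)) => //.
  by move=> x Vx; rewrite /invmx uA // mxE /adjugate mxE.
apply: Ck_mul => //.
  apply: CkV => //; last exact: Ck_det.
  by move=> x /uA; rewrite unitmxE unitfE.
rewrite /cofactor; apply: Ck_mul => //; first exact: Ck_cst.
apply: Ck_det => // a b; rewrite (_ : (fun x => _) = fun x => A x (lift j a) (lift i b)) //.
by apply/funext => x; rewrite !mxE.
Qed.

Let stepE x j (t : R) k : (x + t *: dir j) ord0 k = x ord0 k + t * (k == j)%:R.
Proof. by rewrite !mxE eqxx. Qed.

Lemma step_bound f j V (d e : R) w (s : R) : H w -> 0 <= e ->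
  0 < s -> (forall t, 0 <= t <= s -> V (w + t *: dir j)) ->
  (forall z, V z -> is_pd j f z (pderive j f z)) ->
  (forall z, V z -> `|pderive j f z - d| <= e) ->
  `|f (w + s *: dir j) - f w - d * s| <= e * s.
Proof.
move=> Hw e0 s0 hV hf hd.
have [t ts ->] : exists2 t, 0 < t < s &
    f (w + s *: dir j) - f w = s * pderive j f (w + t *: dir j).
  by apply: pd_mvt => // t ts; apply/hf/hV.
rewrite [d * s]mulrC -mulrBr normrM (gtr0_norm s0) mulrC ler_wpM2r ?(ltW s0) //.
by apply/hd/hV; case/andP: ts => t0 ts; rewrite !ltW.
Qed.

(** Passing from [x] to [y] one coordinate at a time keeps every segment in the box and in the
    half-space, so the one-dimensional estimates add up, also at boundary points. *)
Lemma box_bound f x (d : 'I_n.+1 -> R) (e r : R) : H x -> 0 <= e -> 0 < r ->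
  (forall z, H z -> (forall k, `|z ord0 k - x ord0 k| < r) ->
     forall j, is_pd j f z (pderive j f z) /\ `|pderive j f z - d j| <= e) ->
  forall y, H y -> (forall k, `|y ord0 k - x ord0 k| < r) ->
    `|f y - f x - \sum_j d j * (y ord0 j - x ord0 j)|
      <= e * \sum_j `|y ord0 j - x ord0 j|.
Proof.
move=> Hx e0 r0 hr y Hy yr.
pose Q z := H z /\ forall k, `|z ord0 k - x ord0 k| < r.
have step k w s : Q w -> Q (w + s *: dir k) ->
    `|f (w + s *: dir k) - f w - d k * s| <= e * `|s|.
  have pos (w' : 'rV[R]_n.+1) s' : 0 < s' -> Q w' -> Q (w' + s' *: dir k) ->
    `|f (w' + s' *: dir k) - f w' - d k * s'| <= e * s'.
    move=> s0 [Hw Qw] [Hws Qws].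
    apply: (step_bound (V := Q)) => //.
    - move=> t /andP[t0 ts]; split; first exact: psteps_ge0.
      move=> l; move: (Qw l) (Qws l); rewrite !stepE.
      case: (l == k); rewrite ?mulr1 ?mulr0 ?addr0 // !ltr_norml.
      by move=> /andP[? ?] /andP[? ?]; apply/andP; split; lra.
    - by move=> z [Hz Qz]; case: (hr z Hz Qz k).
    - by move=> z [Hz Qz]; case: (hr z Hz Qz k).
  move=> Qw Qs; have [s0|s0|->] := ltrgt0P s.
  - exact: pos.
  - have := pos (w + s *: dir k) (- s); rewrite oppr_gt0 s0 => /(_ isT Qs).
    rewrite -addrA -scalerDl subrr scale0r addr0 => /(_ Qw).
    rewrite -normrN; congr (`| _ | <= _); ring.
  - by rewrite scale0r addr0 subrr !mulr0 subrr normr0.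
(* The first [k] coordinates are already those of [y]. The last one comes from [x] or from [y],
   hence is nonnegative. *)
pose z k : 'rV[R]_n.+1 := \row_j (if (j < k)%N then y ord0 j else x ord0 j).
have Qz k : Q (z k).
  split; first by rewrite /halfspace /= mxE; case: ifP => _; [exact: Hy|exact: Hx].
  by move=> l; rewrite mxE; case: ifP => // _; rewrite subrr normr0.
have zS (k : 'I_n.+1) : z k.+1 = z k + (y ord0 k - x ord0 k) *: dir k.
  apply/rowP => l; rewrite stepE !mxE ltnS leq_eqVlt.
  have [->|lk] := eqVneq l k; first by rewrite ltnn eqxx /= mulr1 addrC subrK.
  by rewrite -val_eqE in lk; rewrite (negbTE lk) /= mulr0 addr0.
have z0 : z 0%N = x by apply/rowP => l; rewrite mxE.
have zn : z n.+1 = y by apply/rowP => l; rewrite mxE ltn_ord.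
have -> : f y - f x = \sum_(k < n.+1) (f (z k.+1) - f (z k)).
  by rewrite -(big_mkord xpredT (fun k => f (z k.+1) - f (z k)))
       telescope_sumr // zn z0.
rewrite -sumrB mulr_sumr; apply: le_trans (ler_norm_sum _ _ _) _.
apply: ler_sum => k _; rewrite zS; apply: step => //.
by rewrite -zS.
Qed.

(** Continuity of the partials makes the tolerance in [box_bound] arbitrarily small: Frechet
    differentiability relative to the half-space. *)
Lemma Ck1_diff V f x (e : R) : relopen V -> Ck 1 V f -> V x -> 0 < e ->
  \forall y \near within H (nbhs x),
    `|f y - f x - \sum_j pderive j f x * (y ord0 j - x ord0 j)|
      <= e * \sum_j `|y ord0 j - x ord0 j|.
Proof.
move=> Vo kf Vx e0; have [VH Vn] := Vo.
have hd j : relcont V (pderive j f).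
  by apply: (Ck_relcont Vo (k := 0)); exact: Ck_pderive.
have hn : \forall y \near within H (nbhs x),
    V y /\ forall j, `|pderive j f y - pderive j f x| < e.
  have h2 : \forall y \near within H (nbhs x),
      forall j, `|pderive j f y - pderive j f x| < e.
    by apply: filter_forall => j; exact: (relcont_box (hd j) Vx e0).
  by move: (Vn x Vx) h2; apply: filterS2.
move/near_boxP: hn => [r r0 hr].
apply/near_boxP; exists r => //; apply: box_bound => //; first exact: VH.
  exact: ltW.
move=> z Hz Qz j; have [Vz h] := hr z Hz Qz.
by split; [exact: (Ck_pd kf)|exact/ltW].
Qed.

Lemma locally_constant V f x : relopen V -> V x ->
  (forall y j, V y -> is_pd j f y 0) ->
  \forall y \near within H (nbhs x), f y = f x.
Proof.
move=> [VH Vn] Vx hf; have /near_boxP[r r0 hr] := Vn x Vx.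
apply/near_boxP; exists r => // y Hy yr.
have hb z : H z -> (forall k, `|z ord0 k - x ord0 k| < r) ->
     forall j, is_pd j f z (pderive j f z) /\ `|pderive j f z - 0| <= 0.
  move=> Hz Qz j; have h := hf z j (hr z Hz Qz).
  by rewrite (is_pd_unique Hz h) subrr normr0.
have := box_bound (VH _ Vx) (lexx 0) r0 hb Hy yr.
rewrite mul0r big1 => [|j _]; last by rewrite mul0r.
by rewrite subr0 normr_le0 subr_eq0 => /eqP.
Qed.

Lemma pd_shift j f x w d : H w -> is_pd j f (x + w) d ->
  is_pd j (fun y => f (y + w)) x d.
Proof.
move=> Hw h A hA.
have {}h : \forall u \near (0 : R), u != 0 -> psteps j (x + w) u ->
  A (pquot j f (x + w) u) by exact: h _ hA.
apply: near_psteps; apply: filterS h => u h u0 su.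
have := h u0; rewrite /pquot addrAC; apply.
by rewrite /psteps /= addrAC /halfspace /= mxE addr_ge0.
Qed.

(** The mean value theorem is applied in direction [i] to the difference between a [j]-translate of
    [f] and [f], then in direction [j] to [pderive i f]. The second difference becomes [t ^+ 2]
    times a mixed partial at a nearby point. *)
Lemma pderiveC_aux V f x i j (e : R) : relopen V -> Ck 2 V f -> V x -> 0 < e ->
  exists2 r, 0 < r & forall t, 0 < t < r ->
  `|f (x + t *: dir i + t *: dir j) - f (x + t *: dir i) - f (x + t *: dir j) + f x
    - t ^+ 2 * pderive j (pderive i f) x| <= t ^+ 2 * e.
Proof.
move=> Vo kf Vx e0; have [VH Vn] := Vo.
have cd : relcont V (pderive j (pderive i f)).
  by apply: (Ck_relcont Vo (k := 0)); do 2!apply: Ck_pderive.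
have /near_boxP[r r0 hr] : \forall y \near within H (nbhs x),
    V y /\ `|pderive j (pderive i f) y - pderive j (pderive i f) x| < e.
  by move: (Vn x Vx) (relcont_box cd Vx e0); apply: filterS2.
(* Half the radius, because for [i = j] the two steps add up in one coordinate. *)
exists (r / 2) => [|t /andP[t0 tr]]; first by rewrite divr_gt0.
have in_box (a b : R) : 0 <= a <= t -> 0 <= b <= t ->
    V (x + a *: dir i + b *: dir j) /\
    `|pderive j (pderive i f) (x + a *: dir i + b *: dir j) -
      pderive j (pderive i f) x| < e.
  move=> /andP[a0 at_] /andP[b0 bt]; apply: hr.
    by apply: psteps_ge0 => //; apply: psteps_ge0 => //; exact: VH.
  move=> k; rewrite !stepE ltr_norml.
  by case: (k == i); case: (k == j); rewrite ?mulr1 ?mulr0 ?addr0; apply/andP; split; lra.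
have t0W := ltW t0.
have tt : 0 <= t <= t by apply/andP; split.
have zt : (0 : R) <= 0 <= t by apply/andP; split.
have Hd (a : R) (k : 'I_n.+1) : 0 <= a -> H (a *: dir k).
  by move=> a0; rewrite /halfspace /= !mxE mulr_ge0 // ler0n.
have [s ss e1] : exists2 s, 0 < s < t &
    (f (x + t *: dir i + t *: dir j) - f (x + t *: dir i)) -
    (f (x + t *: dir j) - f x)
    = t * (pderive i f (x + s *: dir i + t *: dir j) - pderive i f (x + s *: dir i)).
  apply: (pd_mvt (f := fun y => f (y + t *: dir j) - f y)) => //; first exact: VH.
  move=> s st; apply: is_pdB.
    apply: pd_shift; first exact/Hd/ltW.
    by have [Vz _] := in_box s t st tt; exact: (Ck_pd kf).
  have [] := in_box s 0 st zt; rewrite scale0r addr0 => Vz _.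
  exact: (Ck_pd kf).
have st : 0 <= s <= t by case/andP: ss => ? ?; rewrite !ltW.
have [u us e2] : exists2 u, 0 < u < t &
    pderive i f (x + s *: dir i + t *: dir j) - pderive i f (x + s *: dir i)
    = t * pderive j (pderive i f) (x + s *: dir i + u *: dir j).
  apply: pd_mvt => //.
    by apply: psteps_ge0; [exact: VH|case/andP: st].
  move=> u ut; have [Vz _] := in_box s u st ut.
  exact: (Ck_pd (k := 0) (Ck_pderive i kf) Vz).
have -> : f (x + t *: dir i + t *: dir j) - f (x + t *: dir i) - f (x + t *: dir j) + f x
  = t * (t * pderive j (pderive i f) (x + s *: dir i + u *: dir j)).
  by rewrite -e2 -e1; ring.
rewrite mulrA -expr2 -mulrBr normrM ger0_norm ?sqr_ge0 //.
apply: ler_wpM2l; first exact: sqr_ge0.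
by have [|_ /ltW] := in_box s u st; first by case/andP: us => ? ?; rewrite !ltW.
Qed.

(* Both mixed partials are limits of the same second difference, taken with
   positive increments so that it stays in the half-space. *)
Lemma pderiveC V f x i j : relopen V -> Ck 2 V f -> V x ->
  pderive i (pderive j f) x = pderive j (pderive i f) x.
Proof.
move=> Vo kf Vx.
set a := pderive i _ x; set b := pderive j _ x.
apply/eqP; rewrite -subr_eq0 -normr_le0; apply/ler_addgt0Pl => e e0; rewrite addr0.
have e2 : 0 < e / 2 by rewrite divr_gt0.
have [r r0 hr] := pderiveC_aux i j Vo kf Vx e2.
have [r' r0' hr'] := pderiveC_aux j i Vo kf Vx e2.
pose t := Num.min r r' / 2.
have m0 : 0 < Num.min r r' by rewrite lt_min r0.
have t0 : 0 < t by rewrite divr_gt0.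
have tm : t < Num.min r r' by rewrite /t; lra.
have : 0 < t < r by rewrite t0 (lt_le_trans tm) // ge_min lexx.
have : 0 < t < r' by rewrite t0 (lt_le_trans tm) // ge_min lexx orbT.
move=> /hr' + /hr; rewrite -/a -/b.
have -> : f (x + t *: dir j + t *: dir i) - f (x + t *: dir j) - f (x + t *: dir i)
  + f x = f (x + t *: dir i + t *: dir j) - f (x + t *: dir i) - f (x + t *: dir j)
  + f x by rewrite [x + t *: dir j + _]addrAC; ring.
set q := _ + f x => h1 h2.
have t2 : 0 < t ^+ 2 by rewrite exprn_gt0.
rewrite -(ler_pM2l t2) -{1}(gtr0_norm t2) -normrM.
have -> : t ^+ 2 * (a - b) = (q - t ^+ 2 * b) - (q - t ^+ 2 * a) by ring.
apply: le_trans (ler_normB _ _) _.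
by apply: le_trans (lerD h2 h1) _; rewrite -mulrDr -splitr.
Qed.

End MeanValue.

Section ChainRule.
Context {R : realType} {m n : nat}.

(** The linear approximation [Ck1_diff] is used at the moving point [phi (x + t *: dj)]. Its error
    is a small multiple of the increments of [phi], whose quotients converge and so have a sum
    eventually bounded by the constant [c] below. *)
Lemma is_pd_comp (phi : 'rV[R]_m.+1 -> 'rV[R]_n.+1) V (f : 'rV[R]_n.+1 -> R) x j
    (d : 'I_n.+1 -> R) :
  relopen V -> Ck 1 V f -> halfspace x -> V (phi x) ->
  (\forall y \near within halfspace (nbhs x), halfspace (phi y)) ->
  (forall k, is_pd j (fun y => phi y ord0 k) x (d k)) ->
  is_pd j (f \o phi) x (\sum_k pderive k f (phi x) * d k).
Proof.
move=> Vo kf Hx Vx Hphi hd.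
have PF := psteps_proper j Hx.
set dj := delta_mx ord0 j : 'rV[R]_m.+1.
set F := within (psteps j x) (0 : R)^'.
pose c : R := \sum_k (`|d k| + 1).
have c0 : 0 <= c by apply: sumr_ge0 => k _; rewrite addr_ge0.
have hc : \forall t \near F, forall k, `|pquot j (fun y => phi y ord0 k) x t| <= `|d k| + 1.
  apply: filter_forall => k; apply: (cvgr_norm_le (d k)); first exact: hd.
  by rewrite ltrDl.
have hphi (P : 'rV[R]_n.+1 -> Prop) : (\forall y \near within halfspace (nbhs (phi x)), P y) ->
    \forall t \near F, P (phi (x + t *: dj)).
  move=> /near_boxP[e e0 he].
  have h1 : \forall t \near F, forall k, `|phi (x + t *: dj) ord0 k - phi x ord0 k| < e.
    apply: filter_forall => k.
    have /cvgrPdist_lt/(_ e e0) := is_pd_incr_cvg (hd k).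
    by apply: filterS => t; rewrite distrC.
  have h2 := within_near j Hphi.
  by move: h1 h2; apply: filterS2 => t h1 h2; apply: he.
suff h : pquot j (f \o phi) x t -
    \sum_k pderive k f (phi x) * pquot j (fun y => phi y ord0 k) x t @[t --> F] --> 0.
  rewrite /is_pd -/F -[X in _ --> X]add0r.
  rewrite (_ : (fun t => _) = fun t => pquot j (f \o phi) x t -
    \sum_k pderive k f (phi x) * pquot j (fun y => phi y ord0 k) x t +
    \sum_k pderive k f (phi x) * pquot j (fun y => phi y ord0 k) x t); last first.
    by apply/funext => t; rewrite subrK.
  apply: cvgD h _; apply: cvg_big => [|k _]; first exact: add_continuous.
  by apply: cvgM; [exact: cvg_cst|exact: hd].
apply/cvgr0Pnorm_le => e e0.
have e1 : 0 < e / (c + 1) by rewrite divr_gt0 // ltr_wpDl.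
have hF := hphi _ (Ck1_diff Vo kf Vx e1).
move: hF hc; apply: filterS2 => t h1 h2.
rewrite /pquot -/dj /=.
have -> : \sum_k pderive k f (phi x) * (t^-1 * (phi (x + t *: dj) ord0 k - phi x ord0 k))
  = t^-1 * \sum_k pderive k f (phi x) * (phi (x + t *: dj) ord0 k - phi x ord0 k).
  by rewrite mulr_sumr; apply: eq_bigr => k _; rewrite mulrCA.
rewrite -mulrBr normrM.
apply: le_trans (ler_wpM2l (normr_ge0 _) h1) _.
have : \sum_k `|pquot j (fun y => phi y ord0 k) x t| <= c by apply: ler_sum.
under eq_bigr do rewrite /pquot normrM -/dj.
rewrite -mulr_sumr => h3; rewrite mulrCA.
apply: le_trans (ler_wpM2l (ltW e1) h3) _.
by rewrite mulrAC ler_pdivrMr ?ltr_wpDl // ler_wpM2l ?(ltW e0) // lerDl.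
Qed.

End ChainRule.

Local Opaque pderive Ck.

Section MatrixCalculus.
Context {R : realType} {n : nat}.
Implicit Types (x y : 'rV[R]_n.+1) (j : 'I_n.+1) (V : set 'rV[R]_n.+1).

Definition is_pdm p q j (A : 'rV[R]_n.+1 -> 'M[R]_(p, q)) x (D : 'M[R]_(p, q)) :=
  forall a b, is_pd j (fun y => A y a b) x (D a b).

Definition pderivem p q j (A : 'rV[R]_n.+1 -> 'M[R]_(p, q)) x : 'M[R]_(p, q) :=
  \matrix_(a, b) pderive j (fun y => A y a b) x.

Lemma is_pd_near_on V j (f g : 'rV[R]_n.+1 -> R) x d :
  relopen V -> V x -> (forall y, V y -> f y = g y) ->
  is_pd j f x d -> is_pd j g x d.
Proof.
move=> Vo Vx fg; apply: is_pd_near; first exact: (proj1 Vo).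
by move: (proj2 Vo x Vx); apply: filterS.
Qed.

Lemma pderive_near_on V j (f g : 'rV[R]_n.+1 -> R) x :
  relopen V -> V x -> (forall y, V y -> f y = g y) ->
  pderive j f x = pderive j g x.
Proof.
move=> Vo Vx fg; apply: pderive_near; first exact: (proj1 Vo).
by move: (proj2 Vo x Vx); apply: filterS.
Qed.

Lemma is_pdm_near V p q j (A B : 'rV[R]_n.+1 -> 'M[R]_(p, q)) x D :
  relopen V -> V x -> (forall y, V y -> A y = B y) ->
  is_pdm j A x D -> is_pdm j B x D.
Proof.
by move=> Vo Vx AB hA a b; apply: is_pd_near_on Vo Vx _ (hA a b) => y /AB ->.
Qed.

Lemma is_pdm_unique p q j (A : 'rV[R]_n.+1 -> 'M[R]_(p, q)) x D D' :
  halfspace x -> is_pdm j A x D -> is_pdm j A x D' -> D = D'.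
Proof.
move=> Hx h h'; apply/matrixP => a b.
by rewrite -(is_pd_unique Hx (h a b)) (is_pd_unique Hx (h' a b)).
Qed.

Lemma Ck_pdm V k p q j (A : 'rV[R]_n.+1 -> 'M[R]_(p, q)) x :
  (forall a b, Ck k.+1 V (fun y => A y a b)) -> V x ->
  is_pdm j A x (pderivem j A x).
Proof. by move=> kA Vx a b; rewrite mxE; exact: (Ck_pd (kA a b) Vx). Qed.

Lemma is_pdm_cst p q j (C : 'M[R]_(p, q)) x : is_pdm j (fun=> C) x 0.
Proof. by move=> a b; rewrite mxE; exact: is_pd_cst. Qed.

Lemma is_pdmD p q j (A B : 'rV[R]_n.+1 -> 'M[R]_(p, q)) x DA DB :
  is_pdm j A x DA -> is_pdm j B x DB ->
  is_pdm j (fun y => A y + B y) x (DA + DB).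
Proof.
move=> hA hB a b; rewrite mxE.
rewrite (_ : (fun y => _) = fun y => A y a b + B y a b); first exact: is_pdD.
by apply/funext => y; rewrite mxE.
Qed.

Lemma is_pdm_mul p q r j (A : 'rV[R]_n.+1 -> 'M[R]_(p, q))
    (B : 'rV[R]_n.+1 -> 'M[R]_(q, r)) x DA DB :
  is_pdm j A x DA -> is_pdm j B x DB ->
  is_pdm j (fun y => A y *m B y) x (DA *m B x + A x *m DB).
Proof.
move=> hA hB a b; rewrite !mxE -big_split /=.
rewrite (_ : (fun y => _) = fun y => \sum_k A y a k * B y k b).
  by apply: is_pd_sum => k; exact: is_pdM.
by apply/funext => y; rewrite mxE.
Qed.

Lemma is_pdm_trmx p q j (A : 'rV[R]_n.+1 -> 'M[R]_(p, q)) x D :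
  is_pdm j A x D -> is_pdm j (fun y => (A y)^T) x D^T.
Proof.
move=> hA a b; rewrite mxE (_ : (fun y => _) = fun y => A y b a) //.
by apply/funext => y; rewrite mxE.
Qed.

Lemma is_pdm_scale p q j (f : 'rV[R]_n.+1 -> R)
    (A : 'rV[R]_n.+1 -> 'M[R]_(p, q)) x d D :
  is_pd j f x d -> is_pdm j A x D ->
  is_pdm j (fun y => f y *: A y) x (d *: A x + f x *: D).
Proof.
move=> hf hA a b; rewrite !mxE.
rewrite (_ : (fun y => _) = fun y => f y * A y a b); first exact: is_pdM.
by apply/funext => y; rewrite mxE.
Qed.

Lemma is_pdm_sum p q j (I : Type) (r : seq I)
    (A : I -> 'rV[R]_n.+1 -> 'M[R]_(p, q)) x (D : I -> 'M[R]_(p, q)) :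
  (forall i, is_pdm j (A i) x (D i)) ->
  is_pdm j (fun y => \sum_(i <- r) A i y) x (\sum_(i <- r) D i).
Proof.
move=> hA a b; rewrite summxE (_ : (fun y => _) = fun y => \sum_(i <- r) A i y a b).
  by apply: is_pd_sum => i; exact: hA.
by apply/funext => y; rewrite summxE.
Qed.

Lemma is_pd_trace p j (A : 'rV[R]_n.+1 -> 'M[R]_p) x D :
  is_pdm j A x D -> is_pd j (fun y => \tr (A y)) x (\tr D).
Proof. by move=> hA; apply: is_pd_sum. Qed.

(** The cofactor formula behind [Ck_invmx] yields existence of the derivative; its value follows by
    differentiating [invmx (A y) *m A y = 1%:M]. *)
Lemma is_pdm_invmx V k p j (A : 'rV[R]_n.+1 -> 'M[R]_p) x D :
  relopen V -> V x -> (forall y, V y -> A y \in unitmx) ->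
  (forall a b, Ck k.+1 V (fun y => A y a b)) ->
  is_pdm j A x D ->
  is_pdm j (fun y => invmx (A y)) x (- (invmx (A x) *m D *m invmx (A x))).
Proof.
move=> Vo Vx uA kA hA; have Hx := proj1 Vo _ Vx.
have hI := Ck_pdm (j := j) (Ck_invmx Vo uA kA) Vx.
suff <- : pderivem j (fun y => invmx (A y)) x = - (invmx (A x) *m D *m invmx (A x)) by [].
have h1 : is_pdm j (fun y => invmx (A y) *m A y) x 0.
  refine (is_pdm_near Vo Vx _ (@is_pdm_cst p p j 1%:M x)) => y Vy.
  by rewrite mulVmx // uA.
have /eqP := is_pdm_unique Hx (is_pdm_mul hI hA) h1.
rewrite addr_eq0 => /eqP /(congr1 (mulmxr (invmx (A x)))) /=.
by rewrite mulmxK ?uA // mulNmx.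
Qed.

End MatrixCalculus.

(** * Levi-Civita connection in a chart *)

Section LeviCivita.
Context {R : realType} {n : nat}.
Variables (G : 'rV[R]_n.+1 -> 'M[R]_n.+1).
Implicit Types (x y : 'rV[R]_n.+1) (l m k : 'I_n.+1).

(* [chr l x m k] is Gamma^k_(l m): the row vector [X] of components of a field
   has covariant derivative [d_l X + X *m chr l]. *)
Definition chr l x : 'M[R]_n.+1 := \matrix_(m, k)
  (2^-1 * \sum_d invmx (G x) k d *
    (pderive l (fun y => G y m d) x + pderive m (fun y => G y l d) x
     - pderive d (fun y => G y l m) x)).

(* The matrix of R(d_l, d_m) acting on rows of components. *)
Definition curv l m x : 'M[R]_n.+1 :=
  pderivem l (chr m) x - pderivem m (chr l) x
  + chr m x *m chr l x - chr l x *m chr m x.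

Variables (V : set 'rV[R]_n.+1).
Hypotheses (Vo : relopen V) (kG : forall a b, Ck 2 V (fun y => G y a b)).
Hypotheses (symG : forall x, V x -> (G x)^T = G x).
Hypotheses (unitG : forall x, V x -> G x \in unitmx).

Lemma pderive_symG l a b x : V x ->
  pderive l (fun y => G y a b) x = pderive l (fun y => G y b a) x.
Proof.
by move=> Vx; apply: pderive_near_on Vo Vx _ => y /symG e; rewrite -{2}e mxE.
Qed.

Lemma chr_sym l m k x : V x -> chr l x m k = chr m x l k.
Proof.
move=> Vx; rewrite !mxE; congr (_ * _); apply: eq_bigr => d _; congr (_ * _).
have -> := pderive_symG d l m Vx; congr (_ - _); exact: addrC.
Qed.

Lemma chr_lower l m k x : V x -> (chr l x *m G x) m k =
  2^-1 * (pderive l (fun y => G y m k) x + pderive m (fun y => G y l k) x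
     - pderive k (fun y => G y l m) x).
Proof.
move=> Vx.
have -> : chr l x = 2^-1 *: (\matrix_(m, d)
    (pderive l (fun y => G y m d) x + pderive m (fun y => G y l d) x
     - pderive d (fun y => G y l m) x) *m invmx (G x)).
  apply/matrixP => a b; rewrite !mxE; congr (_ * _); apply: eq_bigr => d _.
  rewrite mulrC mxE; congr (_ * _).
  by rewrite -[in RHS](symG Vx) -trmx_inv mxE.
by rewrite -scalemxAl mulmxKV ?unitG // !mxE.
Qed.

(** Adding the lowered symbols with their last two indices exchanged cancels everything except the
    [l]-derivative of [G]. *)
Lemma metric_compatible l x : V x ->
  is_pdm l G x (chr l x *m G x + G x *m (chr l x)^T).
Proof.
move=> Vx a b.
suff -> : (chr l x *m G x + G x *m (chr l x)^T) a b = pderive l (fun y => G y a b) x.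
  exact: (Ck_pd (kG a b) Vx).
rewrite mxE -{2}(symG Vx) -trmx_mul [X in _ + X]mxE !chr_lower //.
have -> := pderive_symG l b a Vx; lra.
Qed.

Lemma chr_Ck l a b : Ck 1 V (fun y => chr l y a b).
Proof.
apply: (@Ck_eq R n 1 V (fun x => 2^-1 * \sum_d invmx (G x) b d *
    (pderive l (fun y => G y a d) x + pderive a (fun y => G y l d) x
     - pderive d (fun y => G y l a) x))) => //.
  by move=> x _; rewrite mxE.
apply: Ck_mul => //; first exact: Ck_cst.
apply: Ck_sum => // d; apply: Ck_mul => //.
  by apply: Ck_invmx => // c e; exact: Ck_prev.
by apply: CkB => //; first apply: CkD => //; exact: Ck_pderive.
Qed.

Lemma chr_pdm l m x : V x -> is_pdm l (chr m) x (pderivem l (chr m) x).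
Proof. by move=> Vx; apply: (Ck_pdm (k := 0) _ Vx); exact: chr_Ck. Qed.

(** By metric compatibility a second derivative of [G] is a polynomial in [G], the symbols and their
    first derivatives ([D l m] below). Equating the two orders of differentiation leaves exactly the
    skewness. *)
Lemma curv_skew l m x : V x -> curv l m x *m G x + G x *m (curv l m x)^T = 0.
Proof.
move=> Vx; have Hx := proj1 Vo _ Vx.
pose dd l m := pderivem l (chr m) x.
pose D l m := dd l m *m G x + chr m x *m (chr l x *m G x + G x *m (chr l x)^T)
  + ((chr l x *m G x + G x *m (chr l x)^T) *m (chr m x)^T + G x *m (dd l m)^T).
have h l' m' : is_pdm l' (pderivem m' G) x (D l' m').
  have h0 : is_pdm l' (fun y => chr m' y *m G y + G y *m (chr m' y)^T) x (D l' m').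
    apply: is_pdmD.
      by apply: is_pdm_mul (chr_pdm Vx) (metric_compatible Vx).
    by apply: is_pdm_mul (metric_compatible Vx) (is_pdm_trmx (chr_pdm Vx)).
  refine (is_pdm_near Vo Vx _ h0) => y Vy.
  have e := is_pdm_unique (proj1 Vo _ Vy) (metric_compatible (l := m') Vy).
  by apply: e; exact: (Ck_pdm kG Vy).
have e : D l m = D m l.
  apply: (is_pdm_unique Hx (h l m)) => a b.
  have pmE l' : (fun y => pderivem l' G y a b) = pderive l' (fun y => G y a b).
    by apply/funext => y; rewrite mxE.
  have := is_pd_unique Hx (h m l a b); rewrite !pmE => <-.
  rewrite -(pderiveC _ _ Vo (kG a b) Vx).
  exact: (Ck_pd (k := 0) (Ck_pderive _ (kG a b)) Vx).
move: e; rewrite /D /curv /dd.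
have trD (X Y : 'M[R]_n.+1) : (X + Y)^T = X^T + Y^T by exact: linearD.
have trN (X : 'M[R]_n.+1) : (- X)^T = - X^T by exact: linearN.
move: (pderivem l (chr m) x) (pderivem m (chr l) x) (chr l x) (chr m x) (G x).
move=> D1 D2 C1 C2 g.
rewrite !(trD, trN, trmx_mul, mulmxDl, mulmxDr, mulNmx, mulmxN, mulmxA).
move: (D1 *m g) (D2 *m g) (g *m D1^T) (g *m D2^T) (C2 *m C1 *m g) (C1 *m C2 *m g).
move: (C2 *m g *m C1^T) (C1 *m g *m C2^T) (g *m C1^T *m C2^T) (g *m C2^T *m C1^T).
move=> d1 d2 e1 e2 a1 a2 b1 b2 c1 c2 /matrixP e.
apply/matrixP => a b; have := e a b; rewrite !mxE => {}e; lra.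
Qed.

End LeviCivita.

(** * The Jacobi equation of the angle function *)

(* At a point, with [J] and [N] the tangent frame and the normal: [B] has rows
   D_b N, [S b] has rows D_b J_c, [M b] has rows D_b D_c N and [K l m] is the
   curvature R(d_l, d_m) of the ambient space. *)
Section PointwiseIdentity.
Context {R : realType} {n : nat}.
Variables (g : 'M[R]_n.+1) (G : 'M[R]_n.+2) (J : 'M[R]_(n.+1, n.+2)).
Variables (N : 'rV[R]_n.+2) (B : 'M[R]_(n.+1, n.+2)).
Variables (S M : 'I_n.+1 -> 'M[R]_(n.+1, n.+2)) (K : 'I_n.+2 -> 'I_n.+2 -> 'M[R]_n.+2).
Implicit Types (b c d : 'I_n.+1) (l m : 'I_n.+2).
Hypotheses (symG : G^T = G) (unitG : G \in unitmx) (unitg : g \in unitmx).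
Hypotheses (gE : g = J *m G *m J^T) (JN : J *m G *m N^T = 0).
Hypotheses (NN : N *m G *m N^T = 1%:M) (BN : B *m G *m N^T = 0).
Local Notation gi := (invmx g).
Local Notation beta := (B *m G *m J^T).
Hypothesis SN : forall b, S b *m G *m N^T = - (J *m G *m (row b B)^T).
Hypothesis S_sym : forall b c, row c (S b) = row b (S c).
Hypothesis MN : forall b, M b *m G *m N^T = - (B *m G *m (row b B)^T).
Local Notation dbeta b := (M b *m G *m J^T + B *m G *m (S b)^T).
Hypothesis dbeta_sym : forall b, (dbeta b)^T = dbeta b.
Hypothesis M_curv : forall b d, row d (M b) - row b (M d) =
  N *m \sum_l \sum_m (J b l * J d m) *: K l m.
Hypothesis K_skew : forall l m, K l m *m G + G *m (K l m)^T = 0.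

Local Notation L b := (S b *m G *m J^T).
(* [L b *m gi] is the matrix of Christoffel symbols of the hypersurface, so the
   rows of [P b] are the second covariant derivatives of [N]. *)
Definition second_cov (b : 'I_n.+1) : 'M[R]_(n.+1, n.+2) := M b - L b *m gi *m B.
Local Notation P := second_cov.

Lemma trmx_gi : gi^T = gi.
Proof. by rewrite trmx_inv gE !trmx_mul trmxK symG mulmxA. Qed.

Lemma gi_sym b c : gi b c = gi c b.
Proof. by rewrite -[in RHS]trmx_gi mxE. Qed.

Lemma NJ : N *m G *m J^T = 0.
Proof. by apply: trmx_inj; rewrite !trmx_mul trmxK symG trmx0 mulmxA JN. Qed.

(* The inverse metric is read off the orthogonal frame [(N, J)]. *)
Lemma frame_complete : invmx G = N^T *m N + J^T *m gi *m J.
Proof.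
pose E : 'M[R]_(1 + n.+1, n.+2) := col_mx N J.
pose T := N^T *m N + J^T *m gi *m J.
have TE : T *m G *m E^T = E^T.
  rewrite /E tr_col_mx mul_mx_row /T !mulmxDl; congr row_mx.
    rewrite -!mulmxA (mulmxA N) NN mulmx1 (mulmxA J) JN !mulmx0.
    exact: addr0.
  rewrite -!mulmxA (mulmxA N) NJ mulmx0 add0r (mulmxA J) -gE mulVmx //.
  exact: mulmx1.
have EE : E *m G *m E^T = block_mx 1%:M 0 0 g.
  rewrite /E tr_col_mx mul_col_mx mul_mx_row !mul_col_mx NN JN NJ -gE.
  by rewrite -block_mxEh.
have uE : E^T \in unitmx.
  have [] // := @mulmx1_unit R n.+2
    ((block_mx 1%:M 0 0 gi : 'M[R]_(1 + n.+1)) *m (E *m G)) E^T.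
  rewrite -mulmxA EE.
  have -> : (1%:M : 'M[R]_(1 + n.+1)) =
      block_mx 1%:M 0 0 gi *m (block_mx 1%:M 0 0 g : 'M[R]_(1 + n.+1)).
    rewrite mulmx_block !mulmx0 !mul0mx !addr0 add0r mulmx1 mulVmx //.
    exact: scalar_mx_block.
  by [].
have TG : T *m G = 1%:M.
  by rewrite -[LHS](mulmxK uE) TE mulmxV.
by rewrite -[LHS]mul1mx -TG mulmxK.
Qed.

Lemma tangent_proj : J^T *m gi *m J = invmx G - N^T *m N.
Proof. by rewrite frame_complete addrC addKr. Qed.

(** By [SN], [beta] is minus the normal component of D_b J_c, which is symmetric because the
    connection is torsion-free ([S_sym]). *)
Lemma beta_sym : beta^T = beta.
Proof.
have opE p q (X : 'M[R]_(p, q)) i j : (- X) i j = - X i j by rewrite mxE.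
have e b c : beta b c = - (S b *m G *m N^T) c ord0.
  have <- : beta^T c b = beta b c by rewrite mxE.
  rewrite SN opE opprK !trmx_mul trmxK symG mulmxA [LHS]mxE [RHS]mxE.
  by apply: eq_bigr => k _; rewrite [B^T _ _]mxE [(row b B)^T _ _]mxE [row b B _ _]mxE.
apply/matrixP => b c; rewrite mxE !e; congr (- _).
have rE b' c' : (S b' *m G *m N^T) c' ord0 = (row c' (S b') *m G *m N^T) ord0 ord0.
  by rewrite -!row_mul [RHS]mxE.
by rewrite !rE S_sym.
Qed.

(** Weingarten formula: D_b N has no normal part by [BN], so only the tangential half of
    [frame_complete] contributes. *)
Lemma B_tangent : B = beta *m gi *m J.
Proof.
by rewrite -[LHS](mulmxK unitG) frame_complete mulmxDr !mulmxA BN mul0mx add0r.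
Qed.

Lemma BS b : B *m G *m (S b)^T = beta *m gi *m (L b)^T.
Proof. by rewrite {1}B_tangent !trmx_mul trmxK symG !mulmxA. Qed.

(** The right side is the covariant derivative of [beta] for the induced connection: each of its two
    slots receives one Christoffel correction. *)
Lemma PJ b : P b *m G *m J^T =
  dbeta b - beta *m gi *m (L b)^T - L b *m gi *m beta.
Proof.
by rewrite /P !mulmxBl BS addrK -!mulmxA.
Qed.

Lemma PJ_sym b : (P b *m G *m J^T)^T = P b *m G *m J^T.
Proof.
have trB (X Y : 'M[R]_n.+1) : (X - Y)^T = X^T - Y^T by exact: linearB.
rewrite PJ !trB dbeta_sym -addrA -[RHS]addrA; congr (_ + _).
have e : (beta *m gi *m (L b)^T)^T = L b *m gi *m beta.
  by rewrite trmx_mul trmxK (trmx_mul beta) trmx_gi beta_sym mulmxA.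
by rewrite e -e trmxK addrC.
Qed.

(** The rough Laplacian of [N] along the immersion. *)
Definition lap_vec : 'rV[R]_n.+2 := \sum_b \sum_c gi b c *: row c (P b).

(** The Christoffel corrections in [P] are symmetric by [S_sym], so commuting the derivatives costs
    only the ambient curvature acting on [N]. *)
Lemma row_P_curv b d : row d (P b) =
  row b (P d) + N *m \sum_l \sum_m (J b l * J d m) *: K l m.
Proof.
have rB (X Y : 'M[R]_(n.+1, n.+2)) k : row k (X - Y) = row k X - row k Y.
  exact: linearB.
rewrite /P !rB -M_curv -!mulmxA !row_mul S_sym.
by rewrite addrAC [_ + (row d _ - _)]addrC subrK.
Qed.

Definition ric_of : 'M[R]_n.+2 := \matrix_(m, c) \sum_l K l m c l.

Lemma skew_NN l m : N *m K l m *m G *m N^T = 0.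
Proof.
have /(congr1 (fun X => N *m X *m N^T)) := K_skew l m.
rewrite mulmxDr mulmxDl mulmx0 mul0mx !mulmxA => e.
have tE : (N *m K l m *m G *m N^T)^T = N *m G *m (K l m)^T *m N^T.
  by rewrite !trmx_mul trmxK symG !mulmxA.
move: e; rewrite -tE; set X := _ *m N^T => /matrixP e; apply/matrixP => i j.
rewrite !ord1; have := e ord0 ord0; rewrite mxE [X^T _ _]mxE.
rewrite [(0 : 'M[R]_(1, 1)) _ _]mxE => {}e.
lra.
Qed.

(** The trace runs over tangential directions, whereas Ricci traces over all of them. By
    [tangent_proj] the difference is the direction [N], where skewness gives zero ([skew_NN]). *)
Lemma curv_trace d : \sum_b \sum_c gi b c *
    (N *m (\sum_l \sum_m (J b l * J d m) *: K l m) *m G *m J^T) ord0 c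
  = (N *m ric_of^T *m J^T) ord0 d.
Proof.
pose T := J^T *m gi *m J.
have sc1 p q (a : R) (X : 'M[R]_(p, q)) i j : (a *: X) i j = a * X i j by rewrite mxE.
transitivity (\sum_l \sum_m J d m * (N *m K l m *m G *m T^T) ord0 l).
  transitivity (\sum_b \sum_c \sum_l \sum_m J d m *
      ((N *m K l m *m G *m J^T) ord0 c * (gi b c * J b l))).
    apply: eq_bigr => b _; apply: eq_bigr => c _.
    rewrite mulmx_sumr !mulmx_suml summxE mulr_sumr; apply: eq_bigr => l _.
    rewrite mulmx_sumr !mulmx_suml summxE mulr_sumr; apply: eq_bigr => m _.
    by rewrite -scalemxAr -!scalemxAl sc1; ring.
  under eq_bigr do rewrite exchange_big /=.
  rewrite exchange_big /=; apply: eq_bigr => l _.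
  under eq_bigr do rewrite exchange_big /=.
  rewrite exchange_big /=; apply: eq_bigr => m _.
  under eq_bigr do rewrite -mulr_sumr.
  rewrite -mulr_sumr; congr (_ * _).
  rewrite /T !trmx_mul trmxK trmx_gi !mulmxA [RHS]mxE.
  apply: eq_bigr => b _; rewrite [in RHS]mxE mulr_suml.
  by apply: eq_bigr => c _; rewrite gi_sym mulrA.
rewrite exchange_big [RHS]mxE; apply: eq_bigr => m _.
rewrite -mulr_sumr mulrC; congr (_ * _); last by rewrite mxE.
have -> : T^T = invmx G - N^T *m N.
  rewrite -tangent_proj /T !trmx_mul trmxK trmx_gi.
  by rewrite mulmxA.
rewrite mxE; under [RHS]eq_bigr do rewrite !mxE mulr_sumr.
rewrite exchange_big /=; apply: eq_bigr => l _.
rewrite mulmxBr mulmxK // mulmxA skew_NN mul0mx subr0.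
by rewrite mxE.
Qed.

(* Codazzi: the symmetry of [P b] in its last two slots moves the trace onto
   the mean curvature, up to the curvature term [row_P_curv]. *)
Lemma lap_vec_tangent d : (lap_vec *m G *m J^T) ord0 d =
  \tr (gi *m (P d *m G *m J^T)) + (N *m ric_of^T *m J^T) ord0 d.
Proof.
have sc1 p q (a : R) (X : 'M[R]_(p, q)) i j : (a *: X) i j = a * X i j by rewrite mxE.
rewrite -curv_trace /lap_vec !mulmx_suml summxE /mxtrace -big_split /=.
apply: eq_bigr => b _; rewrite !mulmx_suml summxE [X in X + _]mxE -big_split /=.
apply: eq_bigr => c _; rewrite -!scalemxAl sc1 -mulrDr; congr (_ * _).
have symE b' i j : (P b' *m G *m J^T) i j = (P b' *m G *m J^T) j i.
  by rewrite -[in RHS]PJ_sym [RHS]mxE.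
rewrite -!row_mul [LHS]mxE symE.
have -> : (P b *m G *m J^T) d c = (row d (P b) *m G *m J^T) ord0 c.
  by rewrite -!row_mul [RHS]mxE.
rewrite row_P_curv (mulmxDl (row b _)) (mulmxDl (row b _ *m _)) [LHS]mxE; congr (_ + _).
by rewrite -!row_mul [LHS]mxE symE.
Qed.

(** D_c N is tangent, so the normal part of its derivative is -<D_c N, D_b N>; the trace is minus
    the squared norm of the second fundamental form. *)
Lemma lap_vec_normal : lap_vec *m G *m N^T = - (\tr (gi *m (B *m G *m B^T)))%:M.
Proof.
have sc1 p q (a : R) (X : 'M[R]_(p, q)) i j : (a *: X) i j = a * X i j by rewrite mxE.
have PN b : P b *m G *m N^T = - (B *m G *m (row b B)^T).
  by rewrite /P !mulmxBl MN -!(mulmxA (L b *m gi)) BN mulmx0 subr0.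
apply/matrixP => i j; rewrite !ord1 {i j} /lap_vec !mulmx_suml summxE.
rewrite mxE mxE mulr1n /mxtrace -sumrN; apply: eq_bigr => b _.
rewrite !mulmx_suml summxE mxE -sumrN; apply: eq_bigr => c _.
rewrite -!scalemxAl sc1 -!row_mul PN -mulrN; congr (_ * _).
rewrite !mxE; congr (- _); apply: eq_bigr => k _.
by rewrite !mxE.
Qed.

(** [q] stands for the differential of psi and [Hs] for its Hessian. [dH] then says that the
    derivative of the psi-mean curvature vanishes in every tangent direction [d]. *)
Variables (q : 'cV[R]_n.+2) (Hs : 'M[R]_n.+2).
Hypothesis dH : forall d, \tr (gi *m (P d *m G *m J^T)) =
  - ((row d B *m q) ord0 ord0 + (N *m Hs^T *m J^T) ord0 d).

(** [frame_complete] recovers [lap_vec] from its tangential and normal parts. The hypothesis [dH]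
    leaves [- q^T *m B^T] in the tangential part, and the drift term on the left cancels it because
    the shape operator is self-adjoint ([BB] below). *)
Lemma lap_vec_formula (e : 'cV[R]_n.+2) :
  lap_vec *m e + q^T *m J^T *m gi *m B *m e =
  N *m (ric_of - Hs)^T *m invmx G *m e
  - (\tr (gi *m (B *m G *m B^T)))%:M *m N *m e
  - (N *m (ric_of - Hs)^T *m N^T) *m (N *m e).
Proof.
have LJ : lap_vec *m G *m J^T = N *m (ric_of - Hs)^T *m J^T - q^T *m B^T.
  apply/rowP => d; rewrite lap_vec_tangent dH.
  have trB (X Y : 'M[R]_n.+2) : (X - Y)^T = X^T - Y^T by exact: linearB.
  rewrite trB mulmxBr mulmxBl [RHS]mxE [in RHS]mxE.
  have -> : (row d B *m q) ord0 ord0 = (q^T *m B^T) ord0 d.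
    by rewrite -trmx_mul [RHS]mxE -row_mul mxE.
  rewrite [X in _ = _ + X + _]mxE [X in _ = _ + X]mxE; ring.
have lapE : lap_vec = - (\tr (gi *m (B *m G *m B^T)))%:M *m N +
    (N *m (ric_of - Hs)^T *m J^T - q^T *m B^T) *m gi *m J.
  rewrite -[LHS](mulmxK unitG) frame_complete mulmxDr (mulmxA _ N^T) lap_vec_normal.
  by rewrite -LJ !mulmxA.
have BB : B^T *m gi *m J = J^T *m gi *m B.
  have -> : B^T = J^T *m gi *m beta.
    by rewrite [in LHS]B_tangent (trmx_mul _ J) (trmx_mul beta) trmx_gi beta_sym mulmxA.
  by rewrite [in RHS]B_tangent !mulmxA.
have qB : q^T *m B^T *m gi *m J = q^T *m J^T *m gi *m B.
  by rewrite -!(mulmxA q^T) BB.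
set Kt := (ric_of - Hs)^T.
have KJ : N *m Kt *m J^T *m gi *m J = N *m Kt *m invmx G - N *m Kt *m N^T *m N.
  by rewrite -!(mulmxA (N *m Kt)) tangent_proj mulmxBr !mulmxA.
rewrite lapE -/Kt; set a := \tr _.
rewrite (mulmxBl (N *m Kt *m J^T)) (mulmxBl (_ *m gi)) qB KJ !mulmxDl !mulNmx !mulmxA.
move: (a%:M *m N *m e) (_ *m invmx G *m e) (_ *m N *m e) (_ *m B *m e) => x y z w.
apply/matrixP => i j; rewrite !mxE; ring.
Qed.

End PointwiseIdentity.

(** * Covariant derivatives along an immersion, in coordinates *)

Section LocalHypersurface.
Context {R : realType} {n : nat}.
Variables (phi Nf : 'rV[R]_n.+1 -> 'rV[R]_n.+2).
Variables (g : 'rV[R]_n.+1 -> 'M[R]_n.+1) (G : 'rV[R]_n.+2 -> 'M[R]_n.+2).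
Variables (V : set 'rV[R]_n.+1) (U : set 'rV[R]_n.+2).
Hypotheses (Vo : relopen V) (Uo : relopen U) (phiU : forall x, V x -> U (phi x)).
Hypotheses (kphi : forall k, Ck 3 V (fun x => phi x ord0 k)).
Hypotheses (kN : forall k, Ck 2 V (fun x => Nf x ord0 k)).
Hypotheses (kG : forall a b, Ck 2 U (fun y => G y a b)).
Hypotheses (symG : forall y, U y -> (G y)^T = G y).
Hypotheses (unitG : forall y, U y -> G y \in unitmx).

Local Notation C l x := (chr G l (phi x)).
Local Notation Gp x := (G (phi x)).

Definition tangent x : 'M[R]_(n.+1, n.+2) :=
  \matrix_(b, k) pderive b (fun y => phi y ord0 k) x.
Local Notation J := tangent.

(* The connection matrix of the pullback bundle along [phi]. *)
Definition Gam b x : 'M[R]_n.+2 := \sum_l J x b l *: C l x.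

Definition dNf b x : 'rV[R]_n.+2 := pderivem b Nf x.

Definition covN b x : 'rV[R]_n.+2 := dNf b x + Nf x *m Gam b x.

(* Rows D_b N, so [shape *m G *m J^T] is minus the second fundamental form. *)
Definition shape x : 'M[R]_(n.+1, n.+2) := \matrix_(b, k) covN b x ord0 k.
Local Notation B := shape.

Definition covJ b x : 'M[R]_(n.+1, n.+2) := pderivem b J x + J x *m Gam b x.

(** The value that the product and chain rules predict for the derivative of [Gam c] in direction
    [b], confirmed by [Gam_pd]; [dcovN] and [dshape] play the same role for [covN] and [shape]. *)
Definition dGam b c x : 'M[R]_n.+2 :=
  \sum_l (pderivem b J x c l *: C l x +
          J x c l *: \sum_m J x b m *: pderivem m (chr G l) (phi x)).

Definition dcovN b c x : 'rV[R]_n.+2 :=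
  pderivem b (dNf c) x + (dNf b x *m Gam c x + Nf x *m dGam b c x).

Definition dshape b x : 'M[R]_(n.+1, n.+2) := \matrix_(c, k) dcovN b c x ord0 k.

Definition cov2N b x : 'M[R]_(n.+1, n.+2) := dshape b x + B x *m Gam b x.

Let phi_half x : V x -> \forall y \near within halfspace (nbhs x), halfspace (phi y).
Proof.
move=> Vx; move: (proj2 Vo x Vx); apply: filterS => y Vy.
exact: (proj1 Uo _ (phiU Vy)).
Qed.

Lemma comp_pd b (F : 'rV[R]_n.+2 -> R) x : Ck 1 U F -> V x ->
  is_pd b (fun y => F (phi y)) x (\sum_k J x b k * pderive k F (phi x)).
Proof.
move=> kF Vx.
have hk k : is_pd b (fun y => phi y ord0 k) x (J x b k).
  by rewrite mxE; exact: (Ck_pd (kphi k) Vx).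
have := is_pd_comp Uo kF (proj1 Vo _ Vx) (phiU Vx) (phi_half Vx) hk.
by under eq_bigr do rewrite mulrC.
Qed.

Lemma comp_pdm p q b (F : 'rV[R]_n.+2 -> 'M[R]_(p, q)) x D :
  (forall a c, Ck 1 U (fun y => F y a c)) -> V x ->
  (forall k, is_pdm k F (phi x) (D k)) ->
  is_pdm b (fun y => F (phi y)) x (\sum_k J x b k *: D k).
Proof.
move=> kF Vx hD a c.
suff -> : (\sum_k J x b k *: D k) a c =
    \sum_k J x b k * pderive k (fun y => F y a c) (phi x) by exact: comp_pd (kF a c) Vx.
rewrite summxE; apply: eq_bigr => k _; rewrite mxE.
by rewrite (is_pd_unique (proj1 Uo _ (phiU Vx)) (hD k a c)).
Qed.

Lemma metric_pd b x : V x ->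
  is_pdm b (fun y => Gp y) x (Gam b x *m Gp x + Gp x *m (Gam b x)^T).
Proof.
move=> Vx.
suff -> : Gam b x *m Gp x + Gp x *m (Gam b x)^T =
   \sum_k J x b k *: (C k x *m Gp x + Gp x *m (C k x)^T).
  apply: comp_pdm => //; first by move=> a c; exact: Ck_prev.
  by move=> k; apply: (metric_compatible Uo) => //; exact: phiU.
rewrite /Gam mulmx_suml linear_sum mulmx_sumr -big_split /=.
by apply: eq_bigr => k _; rewrite linearZ /= -scalemxAl -scalemxAr scalerDr.
Qed.

(** By [metric_pd] the derivative of the metric is a sum of two connection terms, and each joins one
    factor to form its covariant derivative. The orthogonality relations are differentiated with
    this rule. *)
Lemma cov_leibniz p q b (A : 'rV[R]_n.+1 -> 'M[R]_(p, n.+2))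
    (E : 'rV[R]_n.+1 -> 'M[R]_(q, n.+2)) x DA DE : V x ->
  is_pdm b A x DA -> is_pdm b E x DE ->
  is_pdm b (fun y => A y *m Gp y *m (E y)^T) x
    ((DA + A x *m Gam b x) *m Gp x *m (E x)^T
     + A x *m Gp x *m (DE + E x *m Gam b x)^T).
Proof.
move=> Vx hA hE.
have := is_pdm_mul (is_pdm_mul hA (metric_pd (b := b) Vx)) (is_pdm_trmx hE).
congr is_pdm.
have trD (X Y : 'M[R]_(q, n.+2)) : (X + Y)^T = X^T + Y^T by exact: linearD.
rewrite trD trmx_mul !(mulmxDl, mulmxDr, mulmxA) -!addrA; do 2!congr (_ + _).
by rewrite addrC.
Qed.

Lemma tangent_Ck b k : Ck 2 V (fun y => J y b k).
Proof.
apply: (Ck_eq (f := pderive b (fun y => phi y ord0 k))) => //.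
  by move=> y _; rewrite mxE.
exact: (Ck_pderive _ (kphi k)).
Qed.

Lemma tangent_pd b x : V x -> is_pdm b J x (pderivem b J x).
Proof. by move=> Vx; exact: (Ck_pdm (k := 1) (@tangent_Ck) Vx). Qed.

Lemma dtangent_sym b c k x : V x -> pderivem b J x c k = pderivem c J x b k.
Proof.
move=> Vx.
have JE d : (fun y => J y d k) = pderive d (fun y => phi y ord0 k).
  by apply/funext => y; rewrite mxE.
rewrite [LHS]mxE [RHS]mxE !JE.
exact: (pderiveC b c Vo (Ck_prev (kphi k)) Vx).
Qed.

(** Torsion-freeness: second partials of [phi] commute and the ambient Christoffel symbols are
    symmetric. *)
Lemma covJ_sym b c x : V x -> row c (covJ b x) = row b (covJ c x).
Proof.
move=> Vx; apply/rowP => k; rewrite ![row _ _ _ _]mxE ![covJ _ _ _ _]mxE.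
congr (_ + _); first exact: dtangent_sym.
rewrite [LHS]mxE [RHS]mxE.
have scE (a : R) (A : 'M[R]_n.+2) i j : (a *: A) i j = a * A i j by rewrite mxE.
under eq_bigr do rewrite summxE mulr_sumr.
under [in RHS]eq_bigr do rewrite summxE mulr_sumr.
rewrite exchange_big; apply: eq_bigr => l _; apply: eq_bigr => m _.
rewrite !scE mulrCA; congr (_ * (_ * _)).
by apply: (chr_sym Uo symG); exact: phiU.
Qed.

Lemma Gam_pd b c x : V x -> is_pdm b (Gam c) x (dGam b c x).
Proof.
move=> Vx; apply: is_pdm_sum => l; apply: is_pdm_scale.
  exact: tangent_pd.
apply: comp_pdm => //; first by move=> a d; exact: chr_Ck.
by move=> m; apply: (chr_pdm Uo) => //; exact: phiU.
Qed.

(** The second derivatives of [phi] inside [dGam] cancel by symmetry, and the chain rule terms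
    assemble into the ambient curvature: curvature commutes with pullback. *)
Lemma Gam_curv b d x : V x ->
  dGam b d x - dGam d b x + Gam d x *m Gam b x - Gam b x *m Gam d x =
  \sum_l \sum_m (J x b l * J x d m) *: curv G l m (phi x).
Proof.
move=> Vx.
have sum_split (F1 F2 F3 F4 : 'I_n.+2 -> 'I_n.+2 -> 'M[R]_n.+2) :
    \sum_l \sum_m (J x b l * J x d m) *: (F1 l m - F2 l m + F3 l m - F4 l m) =
    \sum_l \sum_m (J x b l * J x d m) *: F1 l m
    - \sum_l \sum_m (J x b l * J x d m) *: F2 l m
    + \sum_l \sum_m (J x b l * J x d m) *: F3 l m
    - \sum_l \sum_m (J x b l * J x d m) *: F4 l m.
  rewrite -!sumrB -big_split -sumrB /=; apply: eq_bigr => l _.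
  rewrite -!sumrB -big_split -sumrB /=; apply: eq_bigr => m _.
  by rewrite !(scalerBr, scalerDr).
rewrite /curv sum_split.
have mulE b1 d1 : Gam b1 x *m Gam d1 x =
    \sum_l \sum_m (J x b1 l * J x d1 m) *: (C l x *m C m x).
  rewrite /Gam mulmx_suml; apply: eq_bigr => l _.
  rewrite mulmx_sumr; apply: eq_bigr => m _.
  by rewrite -scalemxAl -scalemxAr scalerA.
rewrite (mulE b d); congr (_ + _).
rewrite (mulE d b) exchange_big /=; congr (_ + _); last first.
  by apply: eq_bigr => l _; apply: eq_bigr => m _; rewrite mulrC.
rewrite /dGam !big_split /= opprD addrACA.
rewrite (_ : \sum_l pderivem b J x d l *: C l x - _ = 0); last first.
  apply/eqP; rewrite subr_eq0; apply/eqP/eq_bigr => l _.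
  by congr (_ *: _); exact: dtangent_sym.
rewrite add0r; congr (_ - _).
  under eq_bigr do rewrite scaler_sumr.
  rewrite exchange_big /=; apply: eq_bigr => l _; apply: eq_bigr => m _.
  by rewrite scalerA mulrC.
apply: eq_bigr => l _; rewrite scaler_sumr; apply: eq_bigr => m _.
by rewrite scalerA.
Qed.

Lemma Nf_pd b x : V x -> is_pdm b Nf x (dNf b x).
Proof.
by move=> Vx; apply: (Ck_pdm (k := 1)) Vx => a k; rewrite ord1; exact: kN.
Qed.

Lemma dNf_Ck c a k : Ck 1 V (fun y => dNf c y a k).
Proof.
apply: (Ck_eq (f := pderive c (fun y => Nf y ord0 k))) => //.
  by move=> y _; rewrite (ord1 a) [RHS]mxE.
exact: (Ck_pderive _ (kN k)).
Qed.

Lemma ddNf_sym b c x : V x -> pderivem b (dNf c) x = pderivem c (dNf b) x.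
Proof.
move=> Vx; apply/matrixP => a k; rewrite ord1.
have NE d : (fun y => dNf d y ord0 k) = pderive d (fun y => Nf y ord0 k).
  by apply/funext => y; rewrite mxE.
rewrite [LHS]mxE [RHS]mxE !NE.
exact: (pderiveC b c Vo (kN k) Vx).
Qed.

Lemma covN_pd b c x : V x -> is_pdm b (covN c) x (dcovN b c x).
Proof.
move=> Vx; apply: is_pdmD.
  exact: (Ck_pdm (k := 0) (@dNf_Ck c) Vx).
by apply: is_pdm_mul; [exact: Nf_pd|exact: Gam_pd].
Qed.

Lemma shape_pd b x : V x -> is_pdm b B x (dshape b x).
Proof.
move=> Vx c k; rewrite [dshape _ _ _ _]mxE.
rewrite (_ : (fun y => _) = fun y => covN c y ord0 k); first exact: covN_pd.
by apply/funext => y; rewrite mxE.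
Qed.

Lemma row_shape b x : row b (B x) = covN b x.
Proof. by apply/rowP => k; rewrite [LHS]mxE [LHS]mxE. Qed.

Lemma row_cov2N b c x : row c (cov2N b x) = dcovN b c x + covN c x *m Gam b x.
Proof.
have rD (X Y : 'M[R]_(n.+1, n.+2)) : row c (X + Y) = row c X + row c Y.
  exact: linearD.
rewrite /cov2N rD; congr (_ + _).
  by apply/rowP => k; rewrite [LHS]mxE [LHS]mxE.
by rewrite row_mul; congr (_ *m _); exact: row_shape.
Qed.

Lemma cov2N_curv b d x : V x -> row d (cov2N b x) - row b (cov2N d x) =
  Nf x *m \sum_l \sum_m (J x b l * J x d m) *: curv G l m (phi x).
Proof.
move=> Vx; rewrite -Gam_curv // !row_cov2N /dcovN ddNf_sym // /covN.
rewrite !(mulmxDl, mulmxDr, mulmxBr, mulmxN, mulmxA).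
move: (pderivem d _ x) (dNf b x *m _) (dNf d x *m _) (Nf x *m dGam b d x)
  (Nf x *m dGam d b x) (Nf x *m Gam d x *m _) (Nf x *m Gam b x *m _).
move=> a1 a2 a3 a4 a5 a6 a7; apply/rowP => k; rewrite !mxE; ring.
Qed.

End LocalHypersurface.

(** * Rough Laplacian of the normal under constant weighted mean curvature *)

Section LaplacianOfNormal.
Context {R : realType} {n : nat}.
Variables (phi Nf : 'rV[R]_n.+1 -> 'rV[R]_n.+2).
Variables (g : 'rV[R]_n.+1 -> 'M[R]_n.+1) (G : 'rV[R]_n.+2 -> 'M[R]_n.+2).
Variables (V : set 'rV[R]_n.+1) (U : set 'rV[R]_n.+2).
Hypotheses (Vo : relopen V) (Uo : relopen U) (phiU : forall x, V x -> U (phi x)).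
Hypotheses (kphi : forall k, Ck 3 V (fun x => phi x ord0 k)).
Hypotheses (kN : forall k, Ck 2 V (fun x => Nf x ord0 k)).
Hypotheses (kG : forall a b, Ck 2 U (fun y => G y a b)).
Hypotheses (symG : forall y, U y -> (G y)^T = G y).
Hypotheses (unitG : forall y, U y -> G y \in unitmx).
Local Notation Gp x := (G (phi x)).
Local Notation J := (tangent phi).
Local Notation B := (shape phi Nf G).
Local Notation S b x := (covJ phi G b x).
Local Notation M b x := (cov2N phi Nf G b x).
Hypotheses (gE : forall x, V x -> g x = J x *m Gp x *m (J x)^T).
Hypotheses (unitg : forall x, V x -> g x \in unitmx).
Hypotheses (kg : forall a b, Ck 1 V (fun x => g x a b)).
Hypotheses (JN : forall x, V x -> J x *m Gp x *m (Nf x)^T = 0).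
Hypotheses (NN : forall x, V x -> Nf x *m Gp x *m (Nf x)^T = 1%:M).

Let Hx x : V x -> halfspace x. Proof. exact: (proj1 Vo). Qed.
Let symGp x : V x -> (Gp x)^T = Gp x. Proof. by move=> /phiU /symG. Qed.
Let unitGp x : V x -> Gp x \in unitmx. Proof. by move=> /phiU /unitG. Qed.
Let leib := @cov_leibniz _ _ phi G V U Vo Uo phiU kphi kG symG unitG.
Let Jpd b x (Vx : V x) : is_pdm b J x (pderivem b J x) := tangent_pd Vo kphi Vx.
Let Npd b x (Vx : V x) : is_pdm b Nf x (dNf Nf b x) := Nf_pd kN Vx.
Let Bpd b x (Vx : V x) : is_pdm b B x (dshape phi Nf G b x) :=
  shape_pd Vo Uo phiU kphi kN kG unitG Vx.

(** Obtained by differentiating [NN]. The next two lemmas differentiate [JN] and this relation;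
    together they supply [BN], [SN] and [MN] of the pointwise identity. *)
Lemma shape_normal x : V x -> B x *m Gp x *m (Nf x)^T = 0.
Proof.
move=> Vx.
have e b : covN phi Nf G b x *m Gp x *m (Nf x)^T = 0.
  have h := leib Vx (Npd (b := b) Vx) (Npd (b := b) Vx); rewrite -!/(covN phi Nf G b x) in h.
  have h0 : is_pdm b (fun y => Nf y *m Gp y *m (Nf y)^T) x 0.
    by refine (is_pdm_near Vo Vx _ (@is_pdm_cst _ _ 1 1 b 1%:M x)) => y Vy; rewrite NN.
  have := is_pdm_unique (Hx Vx) h h0; set X := _ *m (Nf x)^T.
  have -> : Nf x *m Gp x *m (covN phi Nf G b x)^T = X^T.
    by rewrite /X !trmx_mul trmxK symGp // mulmxA.
  move=> /matrixP e; apply/matrixP => i j; rewrite !ord1.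
  have := e ord0 ord0; rewrite [(X + X^T) _ _]mxE [X^T _ _]mxE [RHS]mxE => {}e.
  rewrite [RHS]mxE; lra.
apply/row_matrixP => b; rewrite !row_mul row0 -[RHS](e b); do 2 congr (_ *m _).
exact: row_shape.
Qed.

Lemma covJ_normal b x : V x ->
  S b x *m Gp x *m (Nf x)^T = - (J x *m Gp x *m (row b (B x))^T).
Proof.
move=> Vx; have h := leib Vx (Jpd (b := b) Vx) (Npd (b := b) Vx).
have h0 : is_pdm b (fun y => J y *m Gp y *m (Nf y)^T) x 0.
  by refine (is_pdm_near Vo Vx _ (@is_pdm_cst _ _ n.+1 1 b 0 x)) => y Vy; rewrite JN.
have /eqP := is_pdm_unique (Hx Vx) h h0; rewrite addr_eq0 => /eqP.
by rewrite -/(covJ phi G b x) -/(covN phi Nf G b x) => ->; rewrite -row_shape.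
Qed.

Lemma cov2N_normal b x : V x ->
  M b x *m Gp x *m (Nf x)^T = - (B x *m Gp x *m (row b (B x))^T).
Proof.
move=> Vx; have h := leib Vx (Bpd (b := b) Vx) (Npd (b := b) Vx).
have h0 : is_pdm b (fun y => B y *m Gp y *m (Nf y)^T) x 0.
  refine (is_pdm_near Vo Vx _ (@is_pdm_cst _ _ n.+1 1 b 0 x)) => y Vy.
  by rewrite shape_normal.
have /eqP := is_pdm_unique (Hx Vx) h h0; rewrite addr_eq0 => /eqP.
by rewrite -/(cov2N phi Nf G b x) -/(covN phi Nf G b x) => ->; rewrite -row_shape.
Qed.

Let Ssym b c x (Vx : V x) : row c (S b x) = row b (S c x) :=
  covJ_sym Vo Uo phiU kphi symG b c Vx.

Lemma shape_sym x : V x ->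
  (B x *m Gp x *m (J x)^T)^T = B x *m Gp x *m (J x)^T.
Proof.
move=> Vx; apply: (beta_sym (S := fun b => S b x) (N := Nf x)).
- exact: symGp.
- by move=> b; exact: covJ_normal.
- by move=> b c; exact: Ssym.
Qed.

Local Notation dbeta b x := (M b x *m Gp x *m (J x)^T + B x *m Gp x *m (S b x)^T).

Lemma beta_pd b x : V x ->
  is_pdm b (fun y => B y *m Gp y *m (J y)^T) x (dbeta b x).
Proof. by move=> Vx; exact: (leib Vx (Bpd (b := b) Vx) (Jpd (b := b) Vx)). Qed.

Lemma dbeta_sym b x : V x -> (dbeta b x)^T = dbeta b x.
Proof.
move=> Vx; apply: is_pdm_unique (Hx Vx) (is_pdm_trmx (beta_pd (b := b) Vx)) _.
refine (is_pdm_near Vo Vx _ (beta_pd (b := b) Vx)) => y Vy.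
by rewrite shape_sym.
Qed.

Local Notation L b x := (S b x *m Gp x *m (J x)^T).

Lemma induced_metric_pd b x : V x -> is_pdm b g x (L b x + (L b x)^T).
Proof.
move=> Vx.
have -> : (L b x)^T = J x *m Gp x *m (S b x)^T.
  by rewrite !trmx_mul trmxK symGp // mulmxA.
by refine (is_pdm_near Vo Vx _ (leib Vx (Jpd (b := b) Vx) (Jpd (b := b) Vx))) => y Vy; rewrite gE.
Qed.

Lemma symg x : V x -> (g x)^T = g x.
Proof. by move=> Vx; rewrite gE // !trmx_mul trmxK symGp // mulmxA. Qed.

(* Gauss formula: the tangential part of D_b J_c has the Christoffel symbols of
   the induced metric as components. *)
Lemma induced_chr b x : V x -> chr g b x = L b x *m invmx (g x).
Proof.
move=> Vx; rewrite -[LHS](mulmxK (unitg Vx)); congr (_ *m _).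
apply/matrixP => m k; rewrite (chr_lower symg unitg) //.
have dE b' c d : pderive b' (fun y => g y c d) x = L b' x c d + L b' x d c.
  have h : is_pdm b' g x _ := induced_metric_pd Vx.
  rewrite (is_pd_unique (Hx Vx) (h c d)) [LHS]mxE.
  by congr (_ + _); rewrite [LHS]mxE.
have Lsym b' c d : L b' x c d = L c x b' d.
  have rE b1 c1 : L b1 x c1 d = (row c1 (S b1 x) *m Gp x *m (J x)^T) ord0 d.
    by rewrite -!row_mul [RHS]mxE.
  by rewrite !rE Ssym.
rewrite !dE (Lsym m b k) (Lsym k b m) (Lsym k m b); lra.
Qed.

Variables (Psi : 'rV[R]_n.+2 -> R).
Hypothesis kPsi : Ck 2 U Psi.
Definition grad_at y : 'cV[R]_n.+2 := \col_k pderive k Psi y.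
Definition hess_at y : 'M[R]_n.+2 := \matrix_(l, k)
  (pderive l (pderive k Psi) y - \sum_c chr G l y k c * pderive c Psi y).
Local Notation q x := (grad_at (phi x)).

(** The constant is minus the psi-mean curvature, since the left side of [cmc] is div N + <grad psi,
    N>. *)
Variable H0 : R.
Hypothesis cmc : forall x, V x ->
  \tr (invmx (g x) *m (B x *m Gp x *m (J x)^T)) + (Nf x *m q x) ord0 ord0 = H0.

Local Notation P b x :=
  (second_cov (g x) (Gp x) (J x) (B x) (fun b => S b x) (fun b => M b x) b).

(** The covariant derivative of a differential is the Hessian. A covector carries the connection
    term with a minus sign, so it reappears here with a plus sign. *)
Let grad_pd b x : V x -> is_pdm b (fun y => q y) x
  (Gam phi G b x *m q x + (hess_at (phi x))^T *m (row b (J x))^T).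
Proof.
move=> Vx.
have h : is_pdm b (fun y => q y) x
    (\sum_l J x b l *: (\col_k pderive l (pderive k Psi) (phi x))).
  apply: (comp_pdm Vo Uo phiU kphi (F := grad_at)) => //.
    move=> a c; rewrite (_ : (fun y => _) = pderive a Psi); last first.
      by apply/funext => y; rewrite mxE.
    exact: Ck_pderive.
  move=> l a c; rewrite [X in is_pd _ _ _ X]mxE.
  rewrite (_ : (fun y => _) = pderive a Psi); last by apply/funext => y; rewrite mxE.
  exact: (Ck_pd (k := 0) (Ck_pderive _ kPsi) (phiU Vx)).
suff -> : Gam phi G b x *m q x + (hess_at (phi x))^T *m (row b (J x))^T =
  \sum_l J x b l *: (\col_k pderive l (pderive k Psi) (phi x)) by [].
apply/colP => k; rewrite [LHS]mxE summxE.
have -> : (Gam phi G b x *m q x) k ord0 =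
    \sum_l J x b l * \sum_c chr G l (phi x) k c * pderive c Psi (phi x).
  rewrite /Gam mulmx_suml summxE; apply: eq_bigr => l _.
  rewrite -scalemxAl [LHS]mxE; congr (_ * _).
  by rewrite [LHS]mxE; apply: eq_bigr => c _; congr (_ * _); rewrite mxE.
have -> : ((hess_at (phi x))^T *m (row b (J x))^T) k ord0 =
    \sum_l J x b l * hess_at (phi x) l k.
  rewrite [LHS]mxE; apply: eq_bigr => l _; rewrite mulrC.
  by congr (_ * _); [rewrite [LHS]mxE [LHS]mxE|rewrite [LHS]mxE].
rewrite -big_split /=; apply: eq_bigr => l _.
rewrite -mulrDr [RHS]mxE; congr (_ * _).
by rewrite [hess_at _ _ _]mxE [RHS]mxE addrC subrK.
Qed.

(** Metric traces commute with covariant differentiation: the derivative of the inverse metric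
    supplies the two Christoffel corrections of [PJ], after a cyclic permutation under the trace. *)
Let trace_pd d x : V x ->
  is_pd d (fun y => \tr (invmx (g y) *m (B y *m Gp y *m (J y)^T))) x
    (\tr (invmx (g x) *m (P d x *m Gp x *m (J x)^T))).
Proof.
move=> Vx.
have hg := is_pdm_invmx Vo Vx unitg kg (induced_metric_pd (b := d) Vx).
have := is_pd_trace (is_pdm_mul hg (beta_pd (b := d) Vx)).
congr is_pd.
rewrite (PJ (fun b => S b x) (fun b => M b x) (symGp Vx) (unitGp Vx) (unitg Vx)
  (gE Vx) (JN Vx) (NN Vx) (shape_normal Vx)).
set gi := invmx _; set bt := B x *m _ *m _; set l := L d x; set db := dbeta d x.
clearbody gi bt l db.
have trD (X Y : 'M[R]_n.+1) : \tr (X + Y) = \tr X + \tr Y by exact: linearD.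
have trN (X : 'M[R]_n.+1) : \tr (- X) = - \tr X by exact: linearN.
rewrite (mulmxDr gi l) (mulmxDl _ _ gi) opprD (mulmxDl _ _ bt) !mulNmx.
rewrite !(mulmxBr gi) !mulmxA !(trD, trN).
have -> : \tr (gi *m l^T *m gi *m bt) = \tr (gi *m bt *m gi *m l^T).
  by rewrite -mulmxA mxtrace_mulC mulmxA.
ring.
Qed.

Theorem laplacian_of_normal x (e : 'cV[R]_n.+2) : V x ->
  lap_vec (g x) (Gp x) (J x) (B x) (fun b => S b x) (fun b => M b x) *m e
    + (q x)^T *m (J x)^T *m invmx (g x) *m B x *m e =
  Nf x *m (ric_of (fun l m => curv G l m (phi x)) - hess_at (phi x))^T
    *m invmx (Gp x) *m e
  - (\tr (invmx (g x) *m (B x *m Gp x *m (B x)^T)))%:M *m Nf x *m e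
  - (Nf x *m (ric_of (fun l m => curv G l m (phi x)) - hess_at (phi x))^T
      *m (Nf x)^T) *m (Nf x *m e).
Proof.
move=> Vx; apply: lap_vec_formula.
- exact: symGp.
- exact: unitGp.
- exact: unitg.
- exact: gE.
- exact: JN.
- exact: NN.
- exact: shape_normal.
- by move=> b; exact: covJ_normal.
- by move=> b c; exact: Ssym.
- by move=> b; exact: cov2N_normal.
- by move=> b; exact: dbeta_sym.
- by move=> b d; apply: cov2N_curv Vx.
- by move=> l m; apply: (curv_skew (V := U)) => //; exact: phiU.
(* What remains is [dH], obtained by differentiating both summands of [cmc]. *)
move=> d; apply/eqP; rewrite -addr_eq0; apply/eqP.
have h2 : is_pdm d (fun y => Nf y *m q y) x _ := is_pdm_mul (Npd Vx) (grad_pd Vx).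
have h1 := is_pdD (trace_pd (d := d) Vx) (h2 ord0 ord0).
have h0 : is_pd d (fun y => \tr (invmx (g y) *m (B y *m Gp y *m (J y)^T))
    + (Nf y *m q y) ord0 ord0) x 0.
  refine (is_pd_near_on Vo Vx _ (@is_pd_cst _ _ d H0 x)) => y Vy.
  by rewrite cmc.
rewrite -[RHS](is_pd_unique (Hx Vx) h0) (is_pd_unique (Hx Vx) h1); congr (_ + _).
have -> : row d (B x) *m q x = dNf Nf d x *m q x + Nf x *m (Gam phi G d x *m q x).
  rewrite (_ : row d (B x) = covN phi Nf G d x); last exact: row_shape.
  by rewrite /covN mulmxDl mulmxA.
have -> : (Nf x *m (hess_at (phi x))^T *m (J x)^T) ord0 d =
    (Nf x *m ((hess_at (phi x))^T *m (row d (J x))^T)) ord0 ord0.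
  rewrite mulmxA [LHS]mxE [RHS]mxE; apply: eq_bigr => k _; congr (_ * _).
  by rewrite [LHS]mxE [RHS]mxE [RHS]mxE.
by rewrite [in RHS]mulmxDr addrA [RHS]mxE.
Qed.

End LaplacianOfNormal.

(** * Positive definite matrices *)

Section PositiveDefinite.
Context {R : realType}.

Definition posdef n (g : 'M[R]_n) : Prop :=
  forall w : 'rV[R]_n, w != 0 -> 0 < (w *m g *m w^T) ord0 ord0.

Lemma posdef_unit n (g : 'M[R]_n) : posdef g -> g \in unitmx.
Proof.
move=> gp; rewrite -row_free_unit -kermx_eq0; apply/rowV0P => w /sub_kermxP wg.
apply/eqP; apply: contraT => /gp; by rewrite wg mul0mx mxE ltxx.
Qed.

Lemma posdef_congr n (g P : 'M[R]_n) : P \in unitmx -> posdef g ->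
  posdef (P *m g *m P^T).
Proof.
move=> uP gp w w0; have : w *m P != 0.
  by apply: contraNneq w0 => e; rewrite -(mulmxK uP w) e mul0mx.
by move=> /gp; rewrite trmx_mul !mulmxA.
Qed.

(* Symmetric Gaussian elimination, one row at a time. *)
Lemma posdef_normal_form n (g : 'M[R]_n) : g^T = g -> posdef g ->
  exists P : 'M[R]_n, P *m g *m P^T = 1%:M.
Proof.
elim: n g => [|n IH]; first by exists 1%:M; rewrite [LHS]thinmx0 [RHS]thinmx0.
rewrite -[n.+1]/(1 + n)%N => g sg pg.
pose a := ulsubmx g ord0 ord0.
have aE : ulsubmx g = a%:M by rewrite [LHS]mx11_scalar.
have drE : dlsubmx g = (ursubmx g)^T by rewrite -{1}sg trmx_ursub.
have gE : g = block_mx a%:M (ursubmx g) (ursubmx g)^T (drsubmx g).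
  by rewrite -aE -drE submxK.
set b := ursubmx g in gE drE; set d := drsubmx g in gE.
have a0 : 0 < a.
  have := pg (row_mx (1%:M : 'M[R]_1) 0 : 'rV[R]_(1 + n)).
  have -> : row_mx 1%:M 0 *m g *m (row_mx (1%:M : 'M[R]_1) (0 : 'rV[R]_n))^T = a%:M.
    rewrite gE mul_row_block !mul0mx !addr0 !mul1mx tr_row_mx mul_row_col.
    by rewrite trmx0 mulmx0 addr0 trmx1 mulmx1.
  rewrite mxE mulr1n; apply; apply/eqP => /matrixP /(_ ord0 (lshift n ord0)).
  by rewrite row_mxEl !mxE => /eqP; rewrite oner_eq0.
(* [E] clears the first row and column off the pivot [a]. The remaining block [d'] is the Schur
   complement, which inherits symmetry and positivity. *)
pose E : 'M[R]_(1 + n) := block_mx 1%:M 0 (- (a^-1 *: b^T)) 1%:M.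
have uE : E \in unitmx by rewrite unitmxE det_lblock !det1 mulr1 unitr1.
pose d' := d - a^-1 *: (b^T *m b).
have EgE : E *m g *m E^T = block_mx a%:M 0 0 d'.
  rewrite gE /E tr_block_mx !mulmx_block.
  have -> : (- (a^-1 *: b^T))^T = - (a^-1 *: b) by rewrite linearN linearZ /= trmxK.
  have a1 : a != 0 by rewrite gt_eqF.
  have e1 : - (a^-1 *: b^T) *m a%:M + 1%:M *m b^T = 0.
    by rewrite mulNmx mul_mx_scalar scalerA divff // scale1r mul1mx addNr.
  have e2 : a%:M *m - (a^-1 *: b) + b *m 1%:M = 0.
    by rewrite mulmxN mul_scalar_mx scalerA divff // scale1r mulmx1 addNr.
  rewrite e1 !trmx1 !trmx0 !mul0mx !mulmx0 !addr0 !add0r !mul1mx e2 !mulmx1.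
  by congr block_mx; rewrite mulNmx -scalemxAl addrC.
have pE : posdef (E *m g *m E^T) by apply: posdef_congr.
have sE : (E *m g *m E^T)^T = E *m g *m E^T.
  by rewrite !trmx_mul trmxK sg mulmxA.
have sd : d'^T = d'.
  by move: sE; rewrite EgE tr_block_mx => /eq_block_mx[_ _ _].
have pd : posdef d'.
  move=> w w0; have := pE (row_mx 0 w); rewrite EgE mul_row_block.
  rewrite !mul0mx !mulmx0 !add0r tr_row_mx mul_row_col mul0mx add0r; apply.
  by apply: contraNneq w0 => /eqP; rewrite row_mx_eq0 eqxx /= => /eqP ->.
have [P' hP'] := IH d' sd pd.
exists ((block_mx (Num.sqrt a)^-1%:M 0 0 P' : 'M[R]_(1 + n)) *m E).
rewrite trmx_mul !mulmxA -(mulmxA _ E) -(mulmxA _ (E *m g)) EgE.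
rewrite tr_block_mx !mulmx_block !mul0mx !mulmx0 !addr0 !add0r !trmx0.
rewrite !mulmx0 !mul0mx tr_scalar_mx -!scalar_mxM !addr0 hP'.
have s0 : Num.sqrt a != 0 by rewrite gt_eqF ?sqrtr_gt0.
have -> : (Num.sqrt a)^-1 * a * (Num.sqrt a)^-1 = 1.
  by rewrite -[X in _ * X * _](sqr_sqrtr (ltW a0)) expr2 mulrA mulVf // mul1r mulfV.
by rewrite !add0r -scalar_mx_block.
Qed.

Lemma trace_sym_sq_ge0 n (C : 'M[R]_n) : 0 <= \tr (C *m C^T).
Proof.
apply: sumr_ge0 => i _; rewrite mxE; apply: sumr_ge0 => j _.
by rewrite mxE -expr2 sqr_ge0.
Qed.

Lemma trace_sym_sq_eq0 n (C : 'M[R]_n) : \tr (C *m C^T) = 0 -> C = 0.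
Proof.
move=> /eqP; rewrite psumr_eq0 => [/allP h|i _]; last first.
  by rewrite mxE; apply: sumr_ge0 => j _; rewrite mxE -expr2 sqr_ge0.
apply/matrixP => i j; rewrite [RHS]mxE.
have := h i (mem_index_enum i); rewrite /= mxE psumr_eq0 => [/allP h'|k _]; last first.
  by rewrite mxE -expr2 sqr_ge0.
have := h' j (mem_index_enum j); rewrite /= mxE -expr2 sqrf_eq0.
by move=> /eqP.
Qed.

(** In a basis orthonormal for [g] the trace is the squared Frobenius norm of [C]. For the second
    fundamental form this is |A|^2, which vanishes only if A does. *)
Lemma posdef_trace n (g b : 'M[R]_n) : g^T = g -> posdef g -> b^T = b ->
  0 <= \tr (invmx g *m b *m invmx g *m b) /\
  (\tr (invmx g *m b *m invmx g *m b) = 0 -> b = 0).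
Proof.
move=> sg pg sb; have [P hP] := posdef_normal_form sg pg.
have [uP uPT] : P \in unitmx /\ P^T \in unitmx.
  have [] // := @mulmx1_unit R n P (g *m P^T).
    by rewrite mulmxA.
  by rewrite unitmx_tr.
have giE : invmx g = P^T *m P.
  have ug := posdef_unit pg.
  have e : g *m (P^T *m P) = 1%:M.
    apply: (can_inj (mulKmx uP)); rewrite !mulmxA hP mul1mx; exact/esym/mulmx1.
  by rewrite -[LHS]mulmx1 -e mulKmx.
pose C := P *m b *m P^T.
have sC : C^T = C by rewrite /C !trmx_mul trmxK sb mulmxA.
have -> : \tr (invmx g *m b *m invmx g *m b) = \tr (C *m C^T).
  have -> : invmx g *m b *m invmx g *m b = P^T *m (P *m b *m P^T *m P *m b).
    by rewrite giE !mulmxA.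
  by rewrite mxtrace_mulC sC /C !mulmxA.
split; first exact: trace_sym_sq_ge0.
move=> /trace_sym_sq_eq0 C0.
by rewrite -[b](mulKmx uP) -[P *m b](mulmxK uPT) -/C C0 mul0mx mulmx0.
Qed.

End PositiveDefinite.

(** * Components of the normal along a parallel coordinate differential *)

Section VerticalComponent.
Context {R : realType} {n : nat}.
Variables (phi Nf : 'rV[R]_n.+1 -> 'rV[R]_n.+2).
Variables (g : 'rV[R]_n.+1 -> 'M[R]_n.+1) (G : 'rV[R]_n.+2 -> 'M[R]_n.+2).
Variables (V : set 'rV[R]_n.+1) (U : set 'rV[R]_n.+2).
Hypotheses (Vo : relopen V) (Uo : relopen U) (phiU : forall x, V x -> U (phi x)).
Hypotheses (kphi : forall k, Ck 3 V (fun x => phi x ord0 k)).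
Hypotheses (kN : forall k, Ck 2 V (fun x => Nf x ord0 k)).
Hypotheses (kG : forall a b, Ck 2 U (fun y => G y a b)).
Hypotheses (symG : forall y, U y -> (G y)^T = G y).
Hypotheses (unitG : forall y, U y -> G y \in unitmx).
Local Notation Gp x := (G (phi x)).
Local Notation J := (tangent phi).
Local Notation B := (shape phi Nf G).
Local Notation S b x := (covJ phi G b x).
Local Notation M b x := (cov2N phi Nf G b x).
Hypotheses (gE : forall x, V x -> g x = J x *m Gp x *m (J x)^T).
Hypotheses (unitg : forall x, V x -> g x \in unitmx).
(* The differential of the coordinate k0 is parallel. *)
Variable k0 : 'I_n.+2.
Hypothesis chr_k0 : forall y l m, U y -> chr G l y m k0 = 0.
Local Notation theta := (fun y : 'rV[R]_n.+1 => Nf y ord0 k0).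
Local Notation e0 := (delta_mx k0 ord0 : 'cV[R]_n.+2).

(** By [chr_k0] covariant and ordinary derivatives agree on the component [k0]. *)
Let Gam_k0 p (X : 'M[R]_(p, n.+2)) b c x : V x -> (X *m Gam phi G b x) c k0 = 0.
Proof.
move=> Vx; rewrite mxE big1 // => m _; rewrite /Gam summxE big1 ?mulr0 // => l _.
by rewrite mxE chr_k0 ?mulr0 //; exact: phiU.
Qed.

Lemma theta_pd b x : V x -> pderive b theta x = B x b k0.
Proof.
move=> Vx; rewrite [RHS]mxE [RHS]mxE (Gam_k0 _ _ _ Vx) addr0.
by rewrite [RHS]mxE.
Qed.

Lemma theta_pd2 b c x : V x ->
  pderive b (pderive c theta) x = (M b x) c k0.
Proof.
move=> Vx.
have -> : pderive b (pderive c theta) x = pderive b (fun y => B y c k0) x.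
  by apply: (pderive_near_on _ Vo Vx) => y Vy; exact: theta_pd.
have h : is_pdm b B x _ := shape_pd Vo Uo phiU kphi kN kG unitG Vx.
rewrite (is_pd_unique (proj1 Vo _ Vx) (h c k0)).
by rewrite /cov2N [RHS]mxE (Gam_k0 _ _ _ Vx) addr0.
Qed.

(** The [k0] column of [second_cov] is the Hessian of [theta] in the induced metric, because its
    correction terms are the induced Christoffel symbols ([induced_chr]). *)
Lemma theta_laplacian x : V x ->
  \tr (invmx (g x) *m \matrix_(b, c) (pderive b (pderive c theta) x
     - \sum_d chr g b x c d * pderive d theta x)) =
  (lap_vec (g x) (Gp x) (J x) (B x) (fun b => S b x) (fun b => M b x) *m e0) ord0 ord0.
Proof.
move=> Vx.
have cE p (X : 'M[R]_(p, n.+2)) i : (X *m e0) i ord0 = X i k0.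
  rewrite mxE (bigD1 k0) //= mxE !eqxx mulr1 big1 ?addr0 // => j /negbTE jk.
  by rewrite mxE jk mulr0.
rewrite cE /lap_vec summxE /mxtrace.
under eq_bigr do rewrite mxE.
rewrite exchange_big /=; apply: eq_bigr => b _.
rewrite summxE; apply: eq_bigr => c _.
have gs : (invmx (g x))^T = invmx (g x).
  by rewrite trmx_inv (symg phiU symG gE Vx).
rewrite -{1}gs [(_^T) _ _]mxE [RHS]mxE; congr (_ * _).
rewrite [LHS]mxE [RHS]mxE /second_cov [RHS]mxE theta_pd2 //; congr (_ + _).
rewrite [RHS]mxE; congr (- _).
rewrite -(induced_chr Vo Uo phiU kphi kG symG unitG gE unitg _ Vx) [RHS]mxE.
by apply: eq_bigr => d _; congr (_ * _); exact: theta_pd.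
Qed.

End VerticalComponent.

(** * Charts of manifolds and of the cylinder *)

Section Charts.
Context {R : realType} {n : nat} (W : rman R n) (i : cidx W).
Hypotheses (imgo : relopen (img i)) (prmK : forall p, dom W i p -> prm W i (crd W i p) = p).
Implicit Types (a b c : 'I_n.+1).

Definition chart_metric (y : 'rV[R]_n.+1) : 'M[R]_n.+1 := met W i (prm W i y).

Lemma img_prm y : img i y -> dom W i (prm W i y) /\ crd W i (prm W i y) = y.
Proof. by case=> p dp <-; rewrite prmK. Qed.

Lemma img_crd p : dom W i p -> img i (crd W i p).
Proof. by move=> dp; exists p. Qed.

Lemma ptl_near a (F F' : pt W -> R) p : dom W i p ->
  (forall q, dom W i q -> F q = F' q) -> ptl i a F p = ptl i a F' p.
Proof.
move=> dp FF; apply: (pderive_near_on _ imgo (img_crd dp)) => y /img_prm[dy _].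
exact: FF.
Qed.

Lemma christoffelE a b c y : img i y ->
  christoffel i a b c (prm W i y) = chr chart_metric a y b c.
Proof.
move=> iy; have [dy cy] := img_prm iy.
rewrite [RHS]mxE /christoffel; congr (_ * _); apply: eq_bigr => d _.
by rewrite /ptl cy.
Qed.

Lemma riemannE a b c l p : dom W i p ->
  riemann i a b c l p = curv chart_metric a b (crd W i p) c l.
Proof.
move=> dp; have ip := img_crd dp; rewrite /riemann /curv.
have dE a1 b1 c1 l1 : ptl i a1 (christoffel i b1 c1 l1) p =
    pderivem a1 (chr chart_metric b1) (crd W i p) c1 l1.
  rewrite [RHS]mxE; apply: (pderive_near_on _ imgo ip) => y iy /=.
  exact: christoffelE.
have cE a1 b1 c1 : christoffel i a1 b1 c1 p = chr chart_metric a1 (crd W i p) b1 c1.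
  by rewrite -christoffelE // prmK.
rewrite !dE; set D1 := pderivem _ _ _; set D2 := pderivem _ _ _.
set C1 := chr _ b _; set C2 := chr _ a _.
have subE (X Y : 'M[R]_n.+1) : (X - Y) c l = X c l - Y c l by rewrite !mxE.
have addE (X Y : 'M[R]_n.+1) : (X + Y) c l = X c l + Y c l by rewrite !mxE.
rewrite subE addE subE -[RHS]addrA; congr (_ + _).
rewrite sumrB; congr (_ - _); rewrite [RHS]mxE; apply: eq_bigr => m _.
  by rewrite !cE.
by rewrite !cE.
Qed.

Lemma ptl_ptl a b (F : pt W -> R) p : dom W i p ->
  ptl i a (ptl i b F) p = pderive a (pderive b (F \o prm W i)) (crd W i p).
Proof.
move=> dp; apply: (pderive_near_on _ imgo (img_crd dp)) => y iy /=.
by rewrite /ptl; have [_ ->] := img_prm iy.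
Qed.

Lemma hessianE (F : pt W -> R) p : dom W i p ->
  hessian i F p = \matrix_(a, b) (pderive a (pderive b (F \o prm W i)) (crd W i p)
    - \sum_c chr chart_metric a (crd W i p) b c * pderive c (F \o prm W i) (crd W i p)).
Proof.
move=> dp; apply/matrixP => a b; rewrite [LHS]mxE [RHS]mxE ptl_ptl //; congr (_ - _).
apply: eq_bigr => c _; congr (_ * _).
by rewrite -christoffelE ?prmK //; exact: img_crd.
Qed.

End Charts.

Lemma relopen_open {R : realType} {n : nat} (V O : set 'rV[R]_n.+1) :
  open O -> V = O `&` halfspace -> relopen V.
Proof.
move=> oO ->; split => [x []//|x [Ox Hx]].
have : \forall y \near nbhs x, O y by exact: open_nbhs_nbhs.
by apply: filterS => y Oy Hy.
Qed.

Lemma manifold_img {R : realType} {n : nat} (W : rman R n) (i : cidx W) :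
  smooth_manifold W -> relopen (img i).
Proof. by case=> _ _ _  /(_ i) [_ [A oA e] _ _ _] _; exact: relopen_open oA e. Qed.

Lemma manifold_prmK {R : realType} {n : nat} (W : rman R n) (i : cidx W) p :
  smooth_manifold W -> dom W i p -> prm W i (crd W i p) = p.
Proof. by case=> _ _ _  /(_ i) [_ _ h _ _] _; exact: h. Qed.

(** * Functions on the cylinder that depend on one factor only *)

Section Pullback.
Context {R : realType} {n : nat}.
Implicit Types (y : 'rV[R]_(1 + n.+1)) (F : 'rV[R]_n.+1 -> R) (V : set 'rV[R]_n.+1).
Local Notation hor F := (fun y : 'rV[R]_n.+2 => F (rsubmx (y : 'rV[R]_(1 + n.+1)))).
Local Notation sh b := (rshift 1 b : 'I_n.+2).
Local Notation vt := (ord0 : 'I_n.+2).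

Lemma halfspace_rsubmx (y : 'rV[R]_n.+2) :
  halfspace y <-> halfspace (rsubmx (y : 'rV[R]_(1 + n.+1))).
Proof.
rewrite /halfspace /= mxE (_ : rshift 1 ord_max = ord_max) //.
by apply: val_inj.
Qed.

Lemma step_rsubmx (y : 'rV[R]_n.+2) (b : 'I_n.+1) (t : R) :
  rsubmx (y + t *: delta_mx ord0 (sh b) : 'rV[R]_(1 + n.+1)) =
  rsubmx (y : 'rV[R]_(1 + n.+1)) + t *: delta_mx ord0 b.
Proof.
by apply/rowP => k; rewrite !mxE.
Qed.

Lemma step_rsubmx0 (y : 'rV[R]_n.+2) (t : R) :
  rsubmx (y + t *: delta_mx ord0 vt : 'rV[R]_(1 + n.+1)) =
  rsubmx (y : 'rV[R]_(1 + n.+1)).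
Proof. by apply/rowP => k; rewrite !mxE eqxx /= mulr0 addr0. Qed.

Lemma step_first (y : 'rV[R]_n.+2) (b : 'I_n.+1) (t : R) :
  (y + t *: delta_mx ord0 (sh b)) ord0 vt = y ord0 vt.
Proof. by rewrite !mxE eqxx /= mulr0 addr0. Qed.

Lemma psteps_rsubmx (b : 'I_n.+1) (y : 'rV[R]_n.+2) :
  psteps (sh b) y = psteps b (rsubmx (y : 'rV[R]_(1 + n.+1))).
Proof.
by apply/seteqP; split => t; rewrite /psteps /= halfspace_rsubmx step_rsubmx.
Qed.

Lemma is_pd_hor (b : 'I_n.+1) F (y : 'rV[R]_n.+2) d :
  is_pd b F (rsubmx (y : 'rV[R]_(1 + n.+1))) d -> is_pd (sh b) (hor F) y d.
Proof.
rewrite /is_pd -psteps_rsubmx (_ : (fun t => pquot (sh b) _ y t) =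
  (fun t => pquot b F (rsubmx (y : 'rV[R]_(1 + n.+1))) t)) //.
by apply/funext => t; rewrite /pquot step_rsubmx.
Qed.

Lemma pderive_hor (b : 'I_n.+1) F (y : 'rV[R]_n.+2) :
  pderive (sh b) (hor F) y = pderive b F (rsubmx (y : 'rV[R]_(1 + n.+1))).
Proof.
apply: pderive_quot; first exact: psteps_rsubmx.
by move=> t; rewrite /pquot step_rsubmx.
Qed.

Lemma is_pd_hor0 F (y : 'rV[R]_n.+2) : is_pd vt (hor F) y 0.
Proof.
rewrite /is_pd (_ : (fun t => _) = fun=> 0); first exact: cvg_cst.
by apply/funext => t; rewrite /pquot step_rsubmx0 subrr mulr0.
Qed.

Lemma is_pd_vert (b : 'I_n.+1) (w : R -> R) (y : 'rV[R]_n.+2) :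
  is_pd (sh b) (fun y : 'rV[R]_n.+2 => w (y ord0 vt)) y 0.
Proof.
rewrite /is_pd (_ : (fun t => _) = fun=> 0); first exact: cvg_cst.
by apply/funext => t; rewrite /pquot step_first subrr mulr0.
Qed.

Lemma is_pd_vert0 (w : R -> R) (y : 'rV[R]_n.+2) : derivable w (y ord0 vt) 1 ->
  is_pd vt (fun y : 'rV[R]_n.+2 => w (y ord0 vt)) y (derive1 w (y ord0 vt)).
Proof.
move=> dw; apply: cvg_within_filter.
rewrite /derivable in dw.
have -> : derive1 w (y ord0 vt) = lim (h^-1 *: ((w \o shift (y ord0 vt)) (h *: (1:R)) - w (y ord0 vt)) @[h --> 0^']).
  by rewrite derive1E.
rewrite (_ : (fun t => pquot _ _ _ t) = fun h => h^-1 *: ((w \o shift (y ord0 vt)) (h *: (1:R)) - w (y ord0 vt))) //.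
apply/funext => t; rewrite /pquot /= !mxE eqxx /= mulr1.
by rewrite /GRing.scale /= mulr1 addrC.
Qed.

Lemma relopen_hor V : relopen V ->
  relopen (fun y : 'rV[R]_n.+2 => V (rsubmx (y : 'rV[R]_(1 + n.+1)))).
Proof.
move=> [VH Vn]; split => [y /VH|y Vy]; first by rewrite halfspace_rsubmx.
have /near_boxP[e e0 he] := Vn _ Vy.
apply/near_boxP; exists e => // z Hz hz; apply: he.
  by rewrite -halfspace_rsubmx.
by move=> k; rewrite !mxE.
Qed.

Lemma relcont_hor V F : relcont V F ->
  relcont (fun y : 'rV[R]_n.+2 => V (rsubmx (y : 'rV[R]_(1 + n.+1)))) (hor F).
Proof.
move=> cF y Vy; apply/cvgrPdist_lt => e e0.
have /near_boxP[d d0 hd] := relcont_box cF Vy e0.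
apply/near_boxP; exists d => // z Hz hz; rewrite distrC; apply: hd.
  by rewrite -halfspace_rsubmx.
by move=> k; rewrite !mxE.
Qed.

Lemma ord_split (P : 'I_n.+2 -> Prop) : P vt -> (forall b, P (sh b)) -> forall j, P j.
Proof.
move=> P0 PS j; have [k ->|b ->] := split_ordP (j : 'I_(1 + n.+1)); last exact: PS.
suff -> : (lshift n.+1 k : 'I_n.+2) = vt by [].
by apply: val_inj; rewrite /= ord1.
Qed.

Lemma Ck_hor k V F : relopen V -> Ck k V F ->
  Ck k (fun y : 'rV[R]_n.+2 => V (rsubmx (y : 'rV[R]_(1 + n.+1)))) (hor F).
Proof.
move=> Vo; have Wo := relopen_hor Vo; elim: k F => [|k IH] F kF.
  by apply/Ck0 => //; apply: relcont_hor; exact: Ck_relcont kF.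
apply/CkS => //; split; first by apply: relcont_hor; exact: Ck_relcont kF.
elim/ord_split => [|b]; split => [y Vy|].
- exact: is_pd_pderivable (is_pd_hor0 F y).
- apply: (Ck_eq (f := fun=> 0)) => //; last exact: Ck_cst.
  by move=> y Vy; rewrite (is_pd_unique (proj1 Wo _ Vy) (is_pd_hor0 F y)).
- exact: is_pd_pderivable (is_pd_hor (Ck_pd kF Vy)).
- rewrite (_ : pderive (sh b) (hor F) = hor (pderive b F)).
    by apply: IH; exact: Ck_pderive.
  by apply/funext => y; exact: pderive_hor.
Qed.

Lemma relcont_vert (V : set 'rV[R]_n.+2) (w : R -> R) :
  (forall t, derivable w t 1) -> relcont V (fun y => w (y ord0 vt)).
Proof.
move=> hw y Vy; apply/cvgrPdist_lt => e e0.
have /derivable1_diffP/differentiable_continuous := hw (y ord0 vt).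
move=> /cvgrPdist_lt/(_ e e0)/nbhs_ballP[d d0 hd].
apply/near_boxP; exists d => // z Hz hz; apply: hd.
by rewrite /ball /= distrC.
Qed.

Lemma Ck_vert k (V : set 'rV[R]_n.+2) (w : R -> R) : relopen V ->
  (forall l t, derivable (derive1n l w) t 1) ->
  Ck k V (fun y => w (y ord0 vt)).
Proof.
move=> Vo; elim: k w => [|k IH] w hw; have cw := relcont_vert (V := V) (hw 0%N).
  exact/Ck0.
apply/CkS => //; split => //; elim/ord_split => [|b]; split => [y Vy|].
- exact: is_pd_pderivable (is_pd_vert0 (hw 0%N _)).
- apply: (Ck_eq (f := fun y => derive1 w (y ord0 vt))) => //.
    move=> y Vy; rewrite (is_pd_unique (proj1 Vo _ Vy) (is_pd_vert0 (hw 0%N _))) //.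
  apply: IH => l t; have := hw l.+1 t.
  by rewrite derive1Sn.
- exact: is_pd_pderivable (is_pd_vert b w y).
- apply: (Ck_eq (f := fun=> 0)) => //; last exact: Ck_cst.
  by move=> y Vy; rewrite (is_pd_unique (proj1 Vo _ Vy) (is_pd_vert b w y)).
Qed.

End Pullback.

(** * Curvature, Hessian and boundary of the product *)

Section CylinderCharts.
Context {R : realType} {n : nat} (M : rman R n) (M_riem : riemannian_manifold M).
Variable i : cidx M.
Local Notation W := (cylinder M).
Local Notation sh b := (rshift 1 b : 'I_n.+2).
Local Notation vt := (ord0 : 'I_n.+2).
Local Notation rs X := (rsubmx (X : 'rV[R]_(1 + n.+1))).
Implicit Types (q : pt M * R) (a b c d : 'I_n.+1) (k l m : 'I_n.+2).

Let vtE : vt = lshift n.+1 (ord0 : 'I_1). Proof. exact: val_inj. Qed.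

Lemma sum_first (F : 'I_n.+2 -> R) : \sum_k F k = F vt + \sum_b F (sh b).
Proof.
rewrite big_ord_recl; congr (_ + _); apply: eq_bigr => b _; congr F.
exact: val_inj.
Qed.

Lemma img_cylinder (y : 'rV[R]_n.+2) : img (M := W) i y <-> img i (rs y).
Proof.
split=> [[q [dq _] <-]|[p dp e]].
  by rewrite /= row_mxKr; exists q.1.
exists (p, y ord0 vt); first by split.
rewrite /= e; apply/rowP => k; elim/(@ord_split n): k => [|b].
  by rewrite vtE [LHS]row_mxEl mxE eqxx mulr1n.
by rewrite [LHS]row_mxEr mxE.
Qed.

Lemma relopen_img : relopen (img i).
Proof. by apply: manifold_img; case: M_riem. Qed.

Lemma relopen_img_cylinder : relopen (img (M := W) i).
Proof.
have -> : img (M := W) i = (fun y : 'rV[R]_n.+2 => img i (rs y)).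
  by apply/seteqP; split => y; rewrite img_cylinder.
exact: relopen_hor relopen_img.
Qed.

Lemma prmK_man p : dom M i p -> prm M i (crd M i p) = p.
Proof. by apply: manifold_prmK; case: M_riem. Qed.

Lemma prmK_cylinder q : dom W i q -> prm W i (crd W i q) = q.
Proof.
case: q => p t [/= dp _]; rewrite row_mxKr row_mxKl prmK_man //.
by rewrite mxE eqxx mulr1n.
Qed.

Lemma crd_cylinder_half q : dom M i q.1 -> halfspace (crd W i q).
Proof.
move=> dq; apply: (proj1 relopen_img_cylinder); by exists q.
Qed.

Lemma Ck_cylinder (k : nat) (F : pt M -> R) : Ck k (img i) (F \o prm M i) ->
  Ck k (img (M := W) i) ((fun q => F q.1) \o prm W i).
Proof.
move=> kF; have -> : img (M := W) i = (fun y : 'rV[R]_n.+2 => img i (rs y)).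
  by apply/seteqP; split => y; rewrite img_cylinder.
exact: (Ck_hor relopen_img kF).
Qed.

Lemma ptl_hor a (F : pt M -> R) q :
  ptl (M := W) i (sh a) (fun q => F q.1) q = ptl i a F q.1.
Proof.
rewrite /ptl.
have := pderive_hor a (F \o prm M i) (crd W i q).
by rewrite row_mxKr.
Qed.

Lemma ptl_hor0 (F : pt M -> R) q : dom M i q.1 ->
  ptl (M := W) i vt (fun q => F q.1) q = 0.
Proof.
move=> dq; apply: (is_pd_unique (crd_cylinder_half dq)).
exact: (is_pd_hor0 (F \o prm M i)).
Qed.

Lemma ptl_cst k (C : R) q : dom M i q.1 -> ptl (M := W) i k (fun=> C) q = 0.
Proof.
move=> dq; apply: (is_pd_unique (crd_cylinder_half dq)).
exact: is_pd_cst.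
Qed.

Lemma met_cylinder a b q : met W i q (sh a) (sh b) = met M i q.1 a b.
Proof. by rewrite [LHS]block_mxEdr. Qed.

Lemma met_cylinder0l k q : met W i q vt k = (vt == k)%:R.
Proof.
elim/(@ord_split n): k => [|b].
  by rewrite vtE [LHS]block_mxEul mxE.
by rewrite [in LHS]vtE [LHS]block_mxEur mxE.
Qed.

Lemma met_cylinder0r k q : met W i q k vt = (k == vt)%:R.
Proof.
elim/(@ord_split n): k => [|b].
  by rewrite vtE [LHS]block_mxEul mxE.
by rewrite [in LHS]vtE [LHS]block_mxEdl mxE.
Qed.

Lemma dmet_hor a b c q :
  ptl (M := W) i (sh a) (fun q => met W i q (sh b) (sh c)) q =
  ptl i a (fun p => met M i p b c) q.1.
Proof. by rewrite -ptl_hor; congr ptl; apply/funext => q'; exact: met_cylinder. Qed.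

(** Metric coefficients with a vertical index are constant, and the others do not depend on the
    height. Hence Christoffel symbols with a vertical index vanish, and with them the curvature in
    vertical directions. *)
Lemma dmet_vert k l m q : dom M i q.1 -> [|| k == vt, l == vt | m == vt] ->
  ptl (M := W) i k (fun q => met W i q l m) q = 0.
Proof.
move=> dq /or3P[] /eqP ->.
- elim/(@ord_split n): l => [|b].
    rewrite (_ : (fun q => _) = fun=> (vt == m)%:R); first exact: ptl_cst.
    by apply/funext => q'; exact: met_cylinder0l.
  elim/(@ord_split n): m => [|c].
    rewrite (_ : (fun q => _) = fun=> (sh b == vt)%:R); first exact: ptl_cst.
    by apply/funext => q'; exact: met_cylinder0r.
  rewrite (_ : (fun q => _) = fun q => met M i q.1 b c); first exact: (ptl_hor0 (fun p => met M i p b c) dq).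
  by apply/funext => q'; exact: met_cylinder.
- rewrite (_ : (fun q => _) = fun=> (vt == m)%:R); first exact: ptl_cst.
  by apply/funext => q'; exact: met_cylinder0l.
- rewrite (_ : (fun q => _) = fun=> (l == vt)%:R); first exact: ptl_cst.
  by apply/funext => q'; exact: met_cylinder0r.
Qed.

Lemma met_posdef p : dom M i p -> posdef (met M i p).
Proof. by move=> dp w w0; case: M_riem => _ [_ h _ _]; exact: h. Qed.

Lemma met_sym p : dom M i p -> (met M i p)^T = met M i p.
Proof. by move=> dp; case: M_riem => _ [h _ _ _]; exact: h. Qed.

Lemma ginv_cylinder q : dom M i q.1 ->
  ginv (M := W) i q = (block_mx 1%:M 0 0 (ginv i q.1) : 'M[R]_(1 + n.+1)).
Proof.
move=> dq; have u := posdef_unit (met_posdef dq).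
have e : (block_mx 1%:M 0 0 (ginv i q.1) : 'M[R]_(1 + n.+1)) *m
    (block_mx 1%:M 0 0 (met M i q.1) : 'M[R]_(1 + n.+1)) = 1%:M.
  rewrite mulmx_block !mulmx0 !mul0mx !addr0 add0r mulmx1 mulVmx //.
  exact/esym/scalar_mx_block.
have [_ uW] := mulmx1_unit e.
by rewrite /ginv -[RHS](mulmxK uW) e mul1mx.
Qed.

Lemma christoffel_hor a b c q : dom M i q.1 ->
  christoffel (M := W) i (sh a) (sh b) (sh c) q = christoffel i a b c q.1.
Proof.
move=> dq; rewrite /christoffel; congr (_ * _).
rewrite ginv_cylinder // sum_first.
have -> : (block_mx 1%:M 0 0 (ginv i q.1) : 'M[R]_(1 + n.+1)) (sh c) vt = 0.
  by rewrite vtE [LHS]block_mxEdl mxE.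
rewrite mul0r add0r; apply: eq_bigr => d _; rewrite !dmet_hor; congr (_ * _).
by rewrite [LHS]block_mxEdr.
Qed.

Lemma christoffel_vert k l m q : dom M i q.1 -> [|| k == vt, l == vt | m == vt] ->
  christoffel (M := W) i k l m q = 0.
Proof.
move=> dq h; rewrite /christoffel big1 ?mulr0 // => d _.
case/or3P: h => h.
- by rewrite !dmet_vert ?h ?orbT // addr0 subrr mulr0.
- by rewrite !dmet_vert ?h ?orbT // addr0 subrr mulr0.
have [->|d0] := eqVneq d vt.
  by rewrite !dmet_vert ?eqxx ?orbT // addr0 subrr mulr0.
rewrite ginv_cylinder // (eqP h); elim/(@ord_split n): d d0 => [|d] d0; first by rewrite eqxx in d0.
have -> : (block_mx 1%:M 0 0 (ginv i q.1) : 'M[R]_(1 + n.+1)) vt (sh d) = 0.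
  by rewrite vtE [LHS]block_mxEur mxE.
by rewrite mul0r.
Qed.

Let iW : relopen (img (M := W) i) := relopen_img_cylinder.

Lemma riemann_hor a b c d q : dom M i q.1 ->
  riemann (M := W) i (sh a) (sh b) (sh c) (sh d) q = riemann i a b c d q.1.
Proof.
move=> dq; have dW : dom W i q by split.
have dE a1 b1 c1 d1 : ptl (M := W) i (sh a1) (christoffel (M := W) i (sh b1) (sh c1) (sh d1)) q
    = ptl i a1 (christoffel i b1 c1 d1) q.1.
  rewrite -ptl_hor; apply: (ptl_near iW prmK_cylinder) => // q' [dq' _].
  exact: christoffel_hor.
rewrite /riemann !dE; congr (_ + _).
rewrite sum_first !(@christoffel_vert _ _ vt) ?eqxx ?orbT // !mul0r subrr add0r.
by apply: eq_bigr => m _; rewrite !christoffel_hor.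
Qed.

Lemma riemann_vert j k l m q : dom M i q.1 -> [|| j == vt, k == vt | l == vt] ->
  riemann (M := W) i j k l m q = 0.
Proof.
move=> dq h; have dW : dom W i q by split.
have ptl0 j1 k1 l1 m1 : [|| j1 == vt, k1 == vt | l1 == vt] ->
    ptl (M := W) i j1 (christoffel (M := W) i k1 l1 m1) q = 0.
  move=> h1; have [h2|] := boolP [|| k1 == vt, l1 == vt | m1 == vt].
    rewrite (@ptl_near _ _ W i iW prmK_cylinder _ _ (fun=> 0)) ?ptl_cst // => q' [dq' _].
    exact: christoffel_vert.
  (* If the symbol has no vertical index, the direction of differentiation is vertical, and the
     symbol does not depend on the height. *)
  move: h1; elim/(@ord_split n): k1 => [|b]; first by rewrite eqxx.
  elim/(@ord_split n): l1 => [|c]; first by rewrite eqxx orbT.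
  elim/(@ord_split n): m1 => [|d]; first by rewrite eqxx !orbT.
  rewrite !orbF => /eqP -> _.
  rewrite (@ptl_near _ _ W i iW prmK_cylinder _ _ (fun q => christoffel i b c d q.1)) ?ptl_hor0 //.
  by move=> q' [dq' _]; exact: christoffel_hor.
rewrite /riemann ptl0 // (ptl0 k) //; last by rewrite orbCA.
rewrite subrr add0r big1 // => d _.
have [->|d0] := eqVneq d vt.
  by rewrite !(@christoffel_vert _ _ vt) ?eqxx ?orbT // !mul0r subrr.
case/or3P: h => h.
- by rewrite (@christoffel_vert j d) ?h // (@christoffel_vert j l) ?h // mulr0 mul0r subrr.
- by rewrite (@christoffel_vert k l) ?h // (@christoffel_vert k d) ?h // mulr0 mul0r subrr.
by rewrite (@christoffel_vert k l) ?h ?orbT // (@christoffel_vert j l) ?h ?orbT // !mul0r subrr.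
Qed.

Lemma ricci_cylinder q : dom M i q.1 ->
  ricci (M := W) i q = (block_mx 0 0 0 (ricci i q.1) : 'M[R]_(1 + n.+1)).
Proof.
move=> dq; apply/matrixP; elim/(@ord_split n) => [|b].
  move=> k; rewrite mxE big1 => [|a _]; last by rewrite riemann_vert ?eqxx ?orbT.
  elim/(@ord_split n): k => [|c]; first by rewrite vtE [RHS]block_mxEul mxE.
  by rewrite vtE [RHS]block_mxEur mxE.
elim/(@ord_split n) => [|c].
  rewrite mxE big1 => [|a _]; last by rewrite riemann_vert ?eqxx ?orbT.
  by rewrite vtE [RHS]block_mxEdl mxE.
rewrite [RHS]block_mxEdr [LHS]mxE [RHS]mxE sum_first riemann_vert ?eqxx // add0r.
by apply: eq_bigr => a _; rewrite riemann_hor.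
Qed.

Variables (h : pt M -> R) (h_smooth : CinfM h).
Variables (v : R -> R) (v_smooth : forall (r : nat) t, derivable (derive1n r v) t 1).
Variable psi : pt W -> R.
Hypothesis psiE : forall q : pt M * R, psi q = h q.1 + v q.2.

Let psi_prm : psi \o prm W i =
  fun y : 'rV[R]_n.+2 => (h \o prm M i) (rs y) + v (y ord0 vt).
Proof. by apply/funext => y; rewrite /= psiE /= mxE -vtE. Qed.

Lemma psi_Ck (k : nat) : Ck k (img (M := W) i) (psi \o prm W i).
Proof.
rewrite psi_prm; apply: CkD => //; first by apply: Ck_cylinder; exact: h_smooth.
exact: Ck_vert.
Qed.

Lemma ptl_psi_hor a q : dom M i q.1 ->
  ptl (M := W) i (sh a) psi q = ptl i a h q.1.
Proof.
move=> dq; rewrite {1}/ptl psi_prm.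
apply: (is_pd_unique (crd_cylinder_half dq)).
rewrite -[X in is_pd _ _ _ X]addr0; apply: is_pdD; last exact: is_pd_vert.
apply: is_pd_hor; rewrite row_mxKr.
by apply: (Ck_pd (k := 0) (h_smooth 1 i)); exact: img_crd.
Qed.

Lemma crd_cylinder0 q : crd W i q ord0 vt = q.2.
Proof. by rewrite vtE [LHS]row_mxEl mxE eqxx mulr1n. Qed.

Lemma ptl_psi_vert q : dom M i q.1 -> ptl (M := W) i vt psi q = derive1 v q.2.
Proof.
move=> dq; rewrite {1}/ptl psi_prm.
apply: (is_pd_unique (crd_cylinder_half dq)).
have hv : is_pd vt (fun y : 'rV[R]_n.+2 => v (y ord0 vt)) (crd W i q) (derive1 v q.2).
  by have := @is_pd_vert0 R n v (crd W i q) (@v_smooth 0%N _); rewrite crd_cylinder0.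
rewrite -[X in is_pd _ _ _ X]add0r; apply: is_pdD hv.
exact: (is_pd_hor0 (h \o prm M i)).
Qed.

Lemma ptl_vert_fun k (w : R -> R) q : dom M i q.1 -> derivable w q.2 1 ->
  ptl (M := W) i k (fun q => w q.2) q = (k == vt)%:R * derive1 w q.2.
Proof.
move=> dq dw; apply: (is_pd_unique (crd_cylinder_half dq)).
have -> : (fun q : pt M * R => w q.2) \o prm W i = fun y : 'rV[R]_n.+2 => w (y ord0 vt).
  by apply/funext => y; rewrite /= mxE -vtE.
elim/(@ord_split n): k => [|b].
  rewrite eqxx mul1r.
  have hw : is_pd vt (fun y : 'rV[R]_n.+2 => w (y ord0 vt)) (crd W i q)
      (derive1 w (crd W i q ord0 vt)) by apply: is_pd_vert0; rewrite crd_cylinder0.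
  by rewrite crd_cylinder0 in hw.
by rewrite mul0r; exact: is_pd_vert.
Qed.

Lemma hessian_cylinder q : dom M i q.1 ->
  hessian (M := W) i psi q =
  (block_mx (derive1n 2 v q.2)%:M 0 0 (hessian i h q.1) : 'M[R]_(1 + n.+1)).
Proof.
move=> dq; have dW : dom W i q by split.
have dh k a : ptl (M := W) i k (ptl (M := W) i (sh a) psi) q =
    ptl (M := W) i k (fun q => ptl i a h q.1) q.
  apply: (ptl_near iW prmK_cylinder) => // q' [dq' _]; exact: ptl_psi_hor.
have dv k : ptl (M := W) i k (ptl (M := W) i vt psi) q = (k == vt)%:R * derive1n 2 v q.2.
  rewrite (@ptl_near _ _ W i iW prmK_cylinder _ _ (fun q => derive1 v q.2)) //.
    rewrite ptl_vert_fun //; exact: (@v_smooth 1%N _).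
  by move=> q' [dq' _]; exact: ptl_psi_vert.
apply/matrixP; elim/(@ord_split n) => [|a]; elim/(@ord_split n) => [|b]; rewrite [LHS]mxE.
- rewrite dv big1 => [|c _]; last by rewrite christoffel_vert ?eqxx // mul0r.
  by rewrite vtE [RHS]block_mxEul mxE eqxx mul1r subr0.
- rewrite dh ptl_hor0 // big1 => [|c _]; last by rewrite christoffel_vert ?eqxx // mul0r.
  by rewrite vtE [RHS]block_mxEur mxE subr0.
- rewrite dv big1 => [|c _]; last by rewrite christoffel_vert ?eqxx ?orbT // mul0r.
  by rewrite vtE [RHS]block_mxEdl mxE subr0 mul0r.
rewrite dh ptl_hor [RHS]block_mxEdr [RHS]mxE; congr (_ - _).
rewrite sum_first christoffel_vert ?eqxx ?orbT // mul0r add0r.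
by apply: eq_bigr => c _; rewrite christoffel_hor // ptl_psi_hor.
Qed.

Lemma form_block (a : R) (A : 'M[R]_n.+1) (X Y : 'rV[R]_n.+2) :
  (X *m (block_mx a%:M 0 0 A : 'M[R]_(1 + n.+1)) *m Y^T) ord0 ord0 =
  a * X ord0 vt * Y ord0 vt + (rs X *m A *m (rs Y)^T) ord0 ord0.
Proof.
rewrite mxE sum_first [RHS]addrC [LHS]addrC; congr (_ + _).
  rewrite [RHS]mxE; apply: eq_bigr => b _; congr (_ * _); last by rewrite !mxE.
  rewrite !mxE sum_first.
  rewrite [X in _ * X](_ : _ = 0); last by rewrite vtE [LHS]block_mxEur mxE.
  rewrite mulr0 add0r; apply: eq_bigr => c _; congr (_ * _).
    by rewrite [RHS]mxE.
  by rewrite [LHS]block_mxEdr.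
congr (_ * _); last by rewrite mxE.
rewrite mxE.
rewrite sum_first big1 ?addr0 => [|c _].
  by rewrite vtE [X in _ * X]block_mxEul mxE eqxx mulr1n mulrC.
by rewrite [X in _ * X](_ : _ = 0) ?mulr0 // vtE [LHS]block_mxEdl mxE.
Qed.

Lemma inner_cylinder q (X Y : 'rV[R]_n.+2) :
  inner (M := W) i q X Y = X ord0 vt * Y ord0 vt + inner i q.1 (rs X) (rs Y).
Proof. by rewrite [LHS]form_block mul1r. Qed.

Lemma ric_w_cylinder q (X Y : 'rV[R]_n.+2) : dom M i q.1 ->
  ric_w (M := W) psi i q X Y =
  - derive1n 2 v q.2 * X ord0 vt * Y ord0 vt + ric_w h i q.1 (rs X) (rs Y).
Proof.
move=> dq; rewrite [LHS]/ric_w ricci_cylinder // hessian_cylinder //.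
have e (A B : 'M[R]_n.+1) (t : R) : (block_mx 0 0 0 A : 'M[R]_(1 + n.+1))
    - block_mx t%:M 0 0 B = block_mx (- t)%:M 0 0 (A - B).
  by rewrite opp_block_mx add_block_mx sub0r !oppr0 !addr0 raddfN.
by rewrite -form_block -e.
Qed.

Lemma bchart_cylinder q : bchart (M := W) i q <-> bchart i q.1.
Proof.
have e : crd W i q ord0 ord_max = crd M i q.1 ord0 ord_max.
  rewrite (_ : ord_max = sh ord_max); last exact: val_inj.
  by rewrite [LHS]row_mxEr.
by split => [[[dq _] hq]|[dq hq]]; split; rewrite -?e // e.
Qed.

Lemma second_ff_cylinder q (eta X Y : 'rV[R]_n.+2) : dom M i q.1 ->
  second_ff_boundary (M := W) i q eta X Y =
  second_ff_boundary i q.1 (rs eta) (rs X) (rs Y).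
Proof.
move=> dq; rewrite /second_ff_boundary inner_cylinder mxE.
rewrite big1 => [|k _]; last first.
  by rewrite big1 // => l _; rewrite christoffel_vert ?eqxx ?orbT // !mul0r.
rewrite mul0r add0r; congr inner; apply/rowP => c; rewrite !mxE.
rewrite sum_first big1 => [|l _]; last by rewrite christoffel_vert ?eqxx // !mul0r.
rewrite add0r; apply: eq_bigr => a _; rewrite sum_first.
rewrite christoffel_vert ?eqxx ?orbT // !mul0r add0r.
by apply: eq_bigr => b _; rewrite christoffel_hor // !mxE.
Qed.

End CylinderCharts.

Lemma relopen_crd {R : realType} {n : nat} (S : rman R n) (a : cidx S) (A : set (pt S)) :
  smooth_manifold S -> open A -> relopen (crd S a @` (dom S a `&` A)).
Proof.
move=> hS oA; have imgS := manifold_img a hS.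
have prmKS p : dom S a p -> prm S a (crd S a p) = p := manifold_prmK hS.
split=> [x [p [dp _] <-]|x [p [dp Ap] <-]].
  by apply: (proj1 imgS); exact: img_crd.
have ip := img_crd dp.
have cprm : {within img a, continuous (prm S a)}.
  by case: hS => _ _ _ /(_ a) [_ _ _ _ h] _.
have nA : nbhs (prm S a (crd S a p)) A.
  by rewrite prmKS //; apply: open_nbhs_nbhs.
have h1 : \forall y \near nbhs (crd S a p), img a y -> A (prm S a y).
  by move/subspace_continuousP: cprm => /(_ _ ip); exact.
have h2 : \forall y \near nbhs (crd S a p), halfspace y -> img a y.
  exact: (proj2 imgS).
suff : \forall y \near nbhs (crd S a p),
    halfspace y -> (crd S a @` (dom S a `&` A)) y by [].
move: h1 h2; apply: filterS2 => y h1y h2y Hy.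
have iy := h2y Hy; have [dy cy] := img_prm prmKS iy.
by exists (prm S a y) => //; split => //; exact: h1y.
Qed.

(** * Boundary points *)

Section Boundary.
Context {R : realType} {n : nat}.
Implicit Types (x y : 'rV[R]_n.+1) (b : 'I_n.+1) (V : set 'rV[R]_n.+1).

(** A small step of sign opposite to [d] would decrease [F] strictly, and away from the boundary
    such a step is admissible. *)
Lemma interior_min_pd V b (F : 'rV[R]_n.+1 -> R) x d : relopen V -> V x ->
  0 < x ord0 ord_max -> (forall y, V y -> F x <= F y) -> is_pd b F x d -> d = 0.
Proof.
move=> Vo Vx x0 hF hd; apply/eqP; apply: contraT => d0.
have dd : 0 < d * d by rewrite -expr2 exprn_even_gt0.
have hA : \forall r \near d, 0 < r * d.
  have : (r * d @[r --> d]) --> d * d by apply: cvgM; [exact: cvg_id|exact: cvg_cst].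
  by move=> /cvgr_gt/(_ _ dd).
have h1 : \forall t \near (0 : R), t != 0 -> psteps b x t -> 0 < pquot b F x t * d.
  exact: hd _ hA.
have /near_boxP[e e0 he] := proj2 Vo x Vx.
have /nbhs_ballP[e' e'0 he'] := h1.
(* Small enough to stay in [V], to keep the quotient of the sign of [d], and to remain in the
   half-space. *)
pose s := Num.min (Num.min e e') (x ord0 ord_max) / 2.
have m0 : 0 < Num.min (Num.min e e') (x ord0 ord_max) by rewrite !lt_min e0 e'0 x0.
have s0 : 0 < s by rewrite divr_gt0.
have sm : s < Num.min (Num.min e e') (x ord0 ord_max) by rewrite /s; lra.
have [[se se'] sx] : (s < e /\ s < e') /\ s < x ord0 ord_max.
  by move: sm; rewrite !lt_min => /andP[/andP[]].
pose t := - Num.sg d * s.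
have ts : `|t| = s by rewrite normrM normrN normr_sg d0 mul1r gtr0_norm.
have t0 : t != 0 by rewrite -normr_gt0 ts.
have pt : psteps b x t.
  rewrite /psteps /halfspace /= !mxE eqxx /=.
  have : `|t * (ord_max == b)%:R| <= s.
    by rewrite normrM ts; case: (_ == _); rewrite ?normr1 ?normr0 ?mulr1 ?mulr0 // ltW.
  by rewrite ler_norml => /andP[? _]; lra.
have := he' t; rewrite /ball /= sub0r normrN ts => /(_ se' t0 pt).
have Vt : V (x + t *: delta_mx ord0 b).
  apply: he => // k; rewrite !mxE eqxx /= addrAC subrr add0r normrM ts.
  by case: (_ == _); rewrite ?normr1 ?normr0 ?mulr1 ?mulr0.
have F0 := hF _ Vt.
suff : pquot b F x t * d <= 0 by rewrite leNgt => /negbTE ->.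
rewrite /pquot mulrAC; apply: mulr_le0_ge0; last by rewrite subr_ge0.
have -> : t^-1 * d = - (s^-1 * `|d|) by rewrite /t invfM invrN invr_sg normrEsg; ring.
by rewrite oppr_le0 mulr_ge0 // invr_ge0 ltW.
Qed.

Lemma boundary_pd_ge0 V b (F : 'rV[R]_n.+1 -> R) x d : relopen V -> V x ->
  (forall y, V y -> F x <= F y) -> is_pd b F x d -> 0 <= d.
Proof.
move=> Vo Vx hF hd; have Hx := proj1 Vo _ Vx; have PF := psteps_proper b Hx.
have hr : pquot b F x t @[t --> (0 : R)^'+] --> d.
  by apply: cvg_trans hd => A; exact: at_right_psteps.
apply: (cvgr_to_ge hr).
have hV : \forall t \near (0 : R)^'+, V (x + t *: delta_mx ord0 b).
  have h := within_near b (proj2 Vo x Vx).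
  exact: (at_right_psteps Hx h).
have h0 : \forall t \near (0 : R)^'+, 0 < t by exact: nbhs_right_gt.
move: hV h0; apply: filterS2 => t Vt t0.
by rewrite /pquot mulr_ge0 ?invr_ge0 ?(ltW t0) // subr_ge0 hF.
Qed.

(** Steps in a direction other than the last stay on the boundary, so the difference quotients
    vanish near zero. *)
Lemma boundary_tangent_pd V b (F : 'rV[R]_n.+1 -> R) x d : relopen V -> V x ->
  b != ord_max -> x ord0 ord_max = 0 ->
  (forall y, V y -> y ord0 ord_max = 0 -> F y = 0) -> is_pd b F x d -> d = 0.
Proof.
move=> Vo Vx bL x0 hF hd; have Hx := proj1 Vo _ Vx; have PF := psteps_proper b Hx.
have h0 : is_pd b F x 0.
  rewrite /is_pd; apply: cvg_near_cst.
  move: (within_near b (proj2 Vo x Vx)); apply: filterS => t Vt.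
  rewrite /pquot !hF ?subrr ?mulr0 //.
  by rewrite !mxE eqxx /= (negbTE (_ : ord_max != b)) ?mulr0 ?addr0 // eq_sym.
by rewrite -(is_pd_unique Hx hd) (is_pd_unique Hx h0).
Qed.

Variables (W : rman R n) (i : cidx W).
Implicit Types (X eta : 'rV[R]_n.+1).

(** Subtracting a multiple of [eta] makes the last component of [X] zero, and the rest is orthogonal
    to [eta]. Pairing with [eta] thus reads off the last component up to a positive factor. *)
Lemma inner_unit_normalP p eta : inner_unit_normal i p eta ->
  exists2 lam : R, 0 < lam & forall X, inner i p X eta = lam * X ord0 ord_max.
Proof.
move=> [e1 e2 e3]; exists (eta ord0 ord_max)^-1; first by rewrite invr_gt0.
move=> X; pose r := X ord0 ord_max / eta ord0 ord_max.
have innB Y Z : inner i p (Y - r *: Z) eta = inner i p Y eta - r * inner i p Z eta.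
  by rewrite /inner !mulmxBl -!scalemxAl mxE [X in _ + X]mxE [X in _ - X]mxE.
have : inner i p (X - r *: eta) eta = 0.
  by apply: e3; rewrite !mxE /r divfK ?subrr // gt_eqF.
rewrite innB e1 mulr1 => /eqP; rewrite subr_eq0 => /eqP ->.
by rewrite /r mulrC.
Qed.

Lemma inner_unit_normal_exists p : (met W i p)^T = met W i p -> posdef (met W i p) ->
  exists eta, inner_unit_normal i p eta.
Proof.
move=> sG pG; have uG := posdef_unit pG.
(* The gradient of the last coordinate, to be normalized. *)
pose w := row ord_max (ginv i p).
have wE X : inner i p X w = X ord0 ord_max.
  rewrite /inner /w rowE trmx_mul /ginv trmx_inv sG mulmxA mulmxK //.
  by rewrite trmx_delta -colE mxE.
have w0 : w != 0.
  apply/eqP => e; have := wE (delta_mx ord0 ord_max).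
  rewrite e /inner trmx0 mulmx0 !mxE !eqxx => /eqP.
  by rewrite eq_sym oner_eq0.
have wL : 0 < w ord0 ord_max by rewrite -wE; exact: pG.
pose s := Num.sqrt (w ord0 ord_max).
have s0 : 0 < s by rewrite sqrtr_gt0.
have sE X : inner i p X (s^-1 *: w) = s^-1 * X ord0 ord_max.
  by rewrite -wE /inner linearZ /= -scalemxAr mxE.
exists (s^-1 *: w); split => [||X X0].
- rewrite sE mxE mulrA -invfM -expr2 sqr_sqrtr ?ltW // mulVf // gt_eqF //.
- by rewrite mxE mulr_gt0 // invr_gt0.
- by rewrite sE X0 mulr0.
Qed.

(* If a boundary point were interior in the chart [i], the last coordinate of
   the chart [j] would have an interior minimum there, so the transition
   Jacobian would have a zero column. *)
Lemma boundary_bchart p : riemannian_manifold W -> dom W i p -> boundary p ->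
  bchart i p.
Proof.
move=> W_riem dip [j [djp xj0]]; split => //.
have [W_smooth [gsym gpos _ gtrans]] := W_riem.
have imgo := manifold_img i W_smooth.
have xi0 : 0 <= crd W i p ord0 ord_max by apply: (proj1 imgo); exact: img_crd.
move: xi0; rewrite le_eqVlt => /orP[/eqP->//|xi0].
have oj : open (dom W j) by case: W_smooth => _ _ _ /(_ j) [].
have Vo := relopen_crd i W_smooth oj.
set V := crd W i @` _ in Vo.
have Vx : V (crd W i p) by exists p.
pose F y := crd W j (prm W i y) ord0 ord_max.
have kF : Ck 1 V F by case: W_smooth => _ _ _ _ h; exact: h.
have F0 y : V y -> F (crd W i p) <= F y.
  move=> [q [diq djq] <-]; rewrite /F !(manifold_prmK W_smooth) // xj0.
  by apply: (proj1 (manifold_img j W_smooth)); exact: img_crd.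
have col0 : trans_jac i j p *m delta_mx ord_max (ord0 : 'I_1) = 0.
  apply/colP => b; rewrite -colE [LHS]mxE [LHS]mxE [RHS]mxE.
  exact: (interior_min_pd Vo Vx xi0 F0 (Ck_pd (k := 0) kF Vx)).
have ui : met W i p \in unitmx.
  by apply: posdef_unit => w w0; exact: gpos.
have uJ : (trans_jac i j p)%R \in unitmx.
  move: ui; rewrite (gtrans i j p) // !unitmxE !det_mulmx.
  by rewrite !unitrM => /andP[/andP[]].
have := congr1 (mulmx (invmx (trans_jac i j p))) col0.
rewrite mulmx0 mulKmx // => /matrixP/(_ ord_max ord0).
by rewrite !mxE !eqxx => /eqP; rewrite oner_eq0.
Qed.

End Boundary.

(** * Hypersurfaces of the cylinder *)

Section HypersurfaceCharts.
Context {R : realType} {n : nat} (M : rman R n) (M_riem : riemannian_manifold M).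
Context (S : rman R n) (S_riem : riemannian_manifold S).
Local Notation W := (cylinder M).
Local Notation vt := (ord0 : 'I_n.+2).
Variables (f : pt S -> pt W) (N : cidx W -> pt S -> 'rV[R]_n.+2).
Hypotheses (f_imm : isometric_immersion f) (N_gauss : gauss_map f N).
Variables (a : cidx S) (i : cidx W).

Definition phi_chart (x : 'rV[R]_n.+1) : 'rV[R]_n.+2 := crd W i (f (prm S a x)).
Definition N_chart (x : 'rV[R]_n.+1) : 'rV[R]_n.+2 := N i (prm S a x).
Local Notation phi := phi_chart.
Local Notation Nf := N_chart.
Local Notation g := (chart_metric a).
Local Notation G := (chart_metric (W := W) i).
Local Notation V := (overlap f a i).
Local Notation U := (img (M := W) i).

Let S_smooth : smooth_manifold S. Proof. by case: S_riem. Qed.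
Let imgS : relopen (img a). Proof. exact: manifold_img. Qed.
Let prmKS p : dom S a p -> prm S a (crd S a p) = p.
Proof. exact: manifold_prmK. Qed.

Lemma overlapP x : V x ->
  [/\ dom S a (prm S a x), crd S a (prm S a x) = x & dom W i (f (prm S a x))].
Proof. by case=> p [dp dfp] <-; rewrite prmKS. Qed.

Lemma overlap_crd p : dom S a p -> dom W i (f p) -> V (crd S a p).
Proof. by move=> dp dfp; exists p. Qed.

Lemma overlap_img : V `<=` img a.
Proof. by move=> x [p [dp _] <-]; exists p. Qed.

Lemma open_dom_cylinder : open (dom W i).
Proof.
have oM : open (dom M i) by case: M_riem => -[_ _ _ /(_ i) [oA _ _ _ _] _].
rewrite (_ : dom W i = fst @^-1` dom M i).
  by apply: open_comp => // x _; exact: cvg_fst.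
by apply/seteqP; split => -[p t] //= [].
Qed.

Lemma relopen_overlap : relopen V.
Proof.
apply: relopen_crd => //; apply: open_comp open_dom_cylinder => x _.
by case: f_imm.
Qed.

Let Vo := relopen_overlap.
Let Uo : relopen U := @relopen_img_cylinder _ _ _ M_riem i.

Lemma phi_img x : V x -> U (phi x).
Proof. by case/overlapP => _ _ d; exists (f (prm S a x)). Qed.

Lemma chart_metric_phi x : V x -> G (phi x) = met W i (f (prm S a x)).
Proof.
by case/overlapP => _ _ d; rewrite /chart_metric /phi prmK_cylinder.
Qed.

Lemma phi_Ck k c : Ck k V (fun x => phi x ord0 c).
Proof. by case: f_imm => _ h _; exact: h. Qed.

Lemma N_Ck k c : Ck k V (fun x => Nf x ord0 c).
Proof. by case: N_gauss => _ h _ _; exact: h. Qed.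

Lemma metric_Ck_cylinder k c d : Ck k U (fun y => G y c d).
Proof.
elim/(@ord_split n): c => [|c].
  apply: (Ck_eq (f := fun=> (vt == d)%:R)) => //; last exact: Ck_cst.
  by move=> y _; rewrite /chart_metric met_cylinder0l.
elim/(@ord_split n): d => [|d].
  apply: (Ck_eq (f := fun=> (rshift 1 c == vt)%:R)) => //; last exact: Ck_cst.
  by move=> y _; rewrite /chart_metric met_cylinder0r.
apply: (Ck_eq (f := (fun q => met M i q.1 c d) \o prm W i)) => //.
  by move=> y _; rewrite /chart_metric met_cylinder.
apply: (Ck_cylinder M_riem (F := fun p => met M i p c d)).
by case: M_riem => _ [_ _ h _]; exact: h.
Qed.

Let prmKW (q : pt W) : dom W i q -> prm W i (crd W i q) = q.
Proof. exact: prmK_cylinder. Qed.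

Let dom1 y : U y -> dom M i (prm W i y).1.
Proof. by move=> Uy; have [[]] := img_prm prmKW Uy. Qed.

Lemma met_sym_cylinder q : dom M i q.1 -> (met W i q)^T = met W i q.
Proof.
move=> dq; apply/matrixP => k l; rewrite mxE.
elim/(@ord_split n): k => [|c]; first by rewrite met_cylinder0l met_cylinder0r eq_sym.
elim/(@ord_split n): l => [|d]; first by rewrite met_cylinder0l met_cylinder0r eq_sym.
by rewrite !met_cylinder -[in RHS](met_sym M_riem dq) mxE.
Qed.

Lemma met_unit_cylinder q : dom M i q.1 -> met W i q \in unitmx.
Proof.
move=> dq; have u := posdef_unit (met_posdef M_riem dq).
have e : met W i q *m (block_mx 1%:M 0 0 (ginv (M := M) i q.1) : 'M[R]_(1 + n.+1)) = 1%:M.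
  have e' : (block_mx 1%:M 0 0 (met M i q.1) : 'M[R]_(1 + n.+1)) *m
    (block_mx 1%:M 0 0 (ginv (M := M) i q.1) : 'M[R]_(1 + n.+1)) = 1%:M.
    rewrite mulmx_block !mulmx0 !mul0mx !addr0 add0r mulmx1 mulmxV //.
    exact/esym/scalar_mx_block.
  exact: e'.
by have [] := mulmx1_unit e.
Qed.

Lemma chart_metric_sym y : U y -> (G y)^T = G y.
Proof. by move=> Uy; apply: met_sym_cylinder; exact: dom1. Qed.

Lemma chart_metric_unit y : U y -> G y \in unitmx.
Proof. by move=> Uy; apply: met_unit_cylinder; exact: dom1. Qed.

Lemma jac_tangent p : dom S a p -> jac f a i p = tangent phi (crd S a p).
Proof. by move=> dp; apply/matrixP => b k; rewrite [LHS]mxE [RHS]mxE. Qed.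

Lemma jac_tangent_overlap x : V x -> jac f a i (prm S a x) = tangent phi x.
Proof. by case/overlapP => dx cx _; rewrite jac_tangent // cx. Qed.

Lemma induced_metric x : V x -> g x = tangent phi x *m G (phi x) *m (tangent phi x)^T.
Proof.
move=> Vx; rewrite chart_metric_phi // -jac_tangent_overlap //.
by case/overlapP: Vx => dx _ dfx; case: f_imm => _ _ h; exact: h.
Qed.

Lemma chart_metric_posdef x : V x -> posdef (g x).
Proof.
case/overlapP => dx _ _ w w0; case: S_riem => _ [_ h _ _].
exact: h.
Qed.

Lemma chart_metric_Ck k c d : Ck k V (fun x => g x c d).
Proof.
apply: (Ck_sub Vo imgS overlap_img).
by case: S_riem => _ [_ _ h _]; exact: h.
Qed.

Lemma tangent_normal x : V x -> tangent phi x *m G (phi x) *m (Nf x)^T = 0.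
Proof.
move=> Vx; rewrite chart_metric_phi // -jac_tangent_overlap //.
case/overlapP: Vx => dx _ dfx; case: N_gauss => _ _ _ h.
apply/matrixP => b j; rewrite ord1 [RHS]mxE -[RHS](h a i (prm S a x) b dx dfx) /inner.
by rewrite -!row_mul [RHS]mxE.
Qed.

Lemma normal_unit x : V x -> Nf x *m G (phi x) *m (Nf x)^T = 1%:M.
Proof.
move=> Vx; rewrite chart_metric_phi //.
case/overlapP: Vx => dx _ dfx; case: N_gauss => _ _ h _.
by apply/matrixP => b j; rewrite !ord1 [RHS]mxE; exact: h.
Qed.

Lemma cov_normalE b x : V x ->
  cov_normal f N a i b (prm S a x) = covN phi Nf G b x.
Proof.
move=> Vx; have [dx cx dfx] := overlapP Vx.
apply/rowP => k; rewrite [LHS]mxE [RHS]mxE; congr (_ + _).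
  by rewrite [RHS]mxE /ptl cx.
rewrite exchange_big [RHS]mxE; apply: eq_bigr => m _.
rewrite /Gam summxE mulr_sumr; apply: eq_bigr => l _.
rewrite jac_tangent_overlap // -(prmK_cylinder M_riem dfx) christoffelE.
- by rewrite [in RHS]mxE mulrC -/(phi x) [X in _ = _ * X]mulrC.
- exact: prmK_cylinder.
- exact: phi_img.
Qed.

Lemma second_ffE x : V x -> second_ff f N a i (prm S a x) =
  - (shape phi Nf G x *m G (phi x) *m (tangent phi x)^T).
Proof.
move=> Vx; apply/matrixP => b c; rewrite [LHS]mxE [RHS]mxE; congr (- _).
rewrite /inner cov_normalE // jac_tangent_overlap // chart_metric_phi //.
rewrite -row_shape -!row_mul [LHS]mxE [LHS]mxE [RHS]mxE.
apply: eq_bigr => k _; congr (_ * _).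
by rewrite [LHS]mxE [LHS]mxE [RHS]mxE.
Qed.

Lemma second_ff_sym p : dom S a p -> dom W i (f p) ->
  (second_ff f N a i p)^T = second_ff f N a i p.
Proof.
move=> dp dfp; have Vx := overlap_crd dp dfp.
rewrite -(prmKS dp) second_ffE // linearN /=; congr (- _).
apply: (shape_sym Vo Uo phi_img (phi_Ck 3) (N_Ck 2) (metric_Ck_cylinder 2) chart_metric_sym chart_metric_unit tangent_normal Vx).
Qed.

Variables (h : pt M -> R) (h_smooth : CinfM h).
Variables (v : R -> R) (v_smooth : forall (r : nat) t, derivable (derive1n r v) t 1).
Variables (psi : pt W -> R) (psiE : forall q : pt M * R, psi q = h q.1 + v q.2).
Hypothesis cmc : constant_mean_curvature_w f N psi.

Local Notation Psi := (psi \o prm W i).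
Local Notation q x := (grad_at Psi (phi x)).

Let kPsi k : Ck k U Psi. Proof. exact: (psi_Ck M_riem i h_smooth v_smooth psiE). Qed.

Lemma grad_psi x k : V x -> q x k ord0 = ptl (M := W) i k psi (f (prm S a x)).
Proof. by move=> Vx; rewrite mxE. Qed.

Lemma cmc_chart : exists H0, forall x, V x ->
  \tr (invmx (g x) *m (shape phi Nf G x *m G (phi x) *m (tangent phi x)^T))
  + (Nf x *m q x) ord0 ord0 = H0.
Proof.
have [H hH] := cmc; exists (- H) => x Vx; have [dx cx dfx] := overlapP Vx.
rewrite -(hH a i _ dx dfx) /mean_curvature_w opprD !opprK; congr (_ + _); last first.
  by rewrite mxE; apply: eq_bigr => k _; rewrite grad_psi.
rewrite /div_normal /mxtrace exchange_big; apply: eq_bigr => b _.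
rewrite mxE; apply: eq_bigr => c _.
have gs : (invmx (g x))^T = invmx (g x).
  rewrite trmx_inv; congr invmx; case: S_riem => _ [hs _ _ _]; exact: hs.
rewrite -[in LHS]gs [(_^T) _ _]mxE; congr (_ * _).
have oppE (X : 'M[R]_n.+1) : - (- X) c b = X c b by rewrite mxE opprK.
by rewrite -oppE -second_ffE // [X in - X]mxE opprK.
Qed.

(** The squared norm |A|^2, as the trace of the square of the shape operator. *)
Definition shape_norm2 (p : pt S) : R :=
  \tr (ginv a p *m second_ff f N a i p *m ginv a p *m second_ff f N a i p).

Lemma shape_norm2E x : V x -> shape_norm2 (prm S a x) =
  \tr (invmx (g x) *m (shape phi Nf G x *m G (phi x) *m (shape phi Nf G x)^T)).
Proof.
move=> Vx; rewrite /shape_norm2 second_ffE // /ginv -/(g x).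
rewrite !(mulmxN, mulNmx) opprK.
have Bt := B_tangent (chart_metric_sym (phi_img Vx)) (chart_metric_unit (phi_img Vx))
  (posdef_unit (chart_metric_posdef Vx)) (induced_metric Vx) (tangent_normal Vx)
  (normal_unit Vx) (shape_normal Vo Uo phi_img (phi_Ck 3) (N_Ck 2) (metric_Ck_cylinder 2)
    chart_metric_sym chart_metric_unit normal_unit Vx).
have bs : ((shape phi Nf G x *m G (phi x) *m (tangent phi x)^T)^T = _) :=
  shape_sym Vo Uo phi_img (phi_Ck 3) (N_Ck 2) (metric_Ck_cylinder 2) chart_metric_sym
    chart_metric_unit tangent_normal Vx.
set b := _ *m (tangent phi x)^T in Bt bs *; set gi := invmx (g x) in Bt *.
have -> : shape phi Nf G x *m G (phi x) *m (shape phi Nf G x)^T = b *m gi *m b.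
  have gs : gi^T = gi.
    rewrite trmx_inv; congr invmx; have [dx _ _] := overlapP Vx.
    by case: S_riem => _ [hs _ _ _]; exact: hs.
  have -> : (shape phi Nf G x)^T = (tangent phi x)^T *m gi *m b.
    rewrite [X in X^T]Bt (trmx_mul _ (tangent phi x)) (trmx_mul b) gs.
    by rewrite (_ : b^T = b) // mulmxA.
  by rewrite !mulmxA -/b.
by rewrite !mulmxA.
Qed.

Lemma ric_of_chart x : V x ->
  ric_of (fun l m => curv G l m (phi x)) - hess_at G Psi (phi x) =
  ricci (M := W) i (f (prm S a x)) - hessian (M := W) i psi (f (prm S a x)).
Proof.
move=> Vx; have [dx cx dfx] := overlapP Vx; congr (_ - _).
  apply/matrixP => m c; rewrite [LHS]mxE [RHS]mxE; apply: eq_bigr => l _.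
  by rewrite (riemannE Uo prmKW).
by rewrite (hessianE Uo prmKW).
Qed.

(** [laplacian_of_normal] is evaluated on the vertical covector. The angle is given chart by chart,
    so [u] is any function that agrees with the vertical component over the chart [i]. *)
Lemma laplacian_angle p (u : pt S -> R) : dom S a p -> dom W i (f p) ->
  (forall q, dom W i (f q) -> u q = N i q ord0 vt) ->
  laplacian_w (psi \o f) a u p =
  - N i p ord0 vt * (shape_norm2 p + derive1n 2 v (f p).2
    + ric_w psi i (f p) (N i p) (N i p)).
Proof.
move=> dp dfp uE; have Vx := overlap_crd dp dfp.
set x := crd S a p in Vx; have px : prm S a x = p by exact: prmKS.
have uV y : V y -> (u \o prm S a) y = Nf y ord0 vt.
  by case/overlapP => _ _ d; exact: uE.
have chr0 y l m : U y -> chr G l y m vt = 0.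
  move=> Uy; rewrite -(christoffelE prmKW) //.
  by rewrite (christoffel_vert M_riem (dom1 Uy)) ?eqxx ?orbT.
have [H0 hH0] := cmc_chart.
have unitgV y (Vy : V y) : g y \in unitmx := posdef_unit (chart_metric_posdef Vy).
have main := laplacian_of_normal Vo Uo phi_img (phi_Ck 3) (N_Ck 2) (metric_Ck_cylinder 2)
  chart_metric_sym chart_metric_unit induced_metric
  unitgV (chart_metric_Ck 1) tangent_normal
  normal_unit (kPsi 2) hH0 (delta_mx vt ord0 : 'cV[R]_n.+2) Vx.
have lapE : \tr (ginv a p *m hessian a u p) =
  (lap_vec (g x) (G (phi x)) (tangent phi x) (shape phi Nf G x)
    (fun b => covJ phi G b x) (fun b => cov2N phi Nf G b x) *m (delta_mx vt ord0 : 'cV[R]_n.+2)) ord0 ord0.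
  rewrite -(theta_laplacian Vo Uo phi_img (phi_Ck 3) (N_Ck 2) (metric_Ck_cylinder 2)
    chart_metric_sym chart_metric_unit induced_metric unitgV chr0 Vx).
  rewrite /ginv (hessianE imgS prmKS) // -/x /chart_metric px; congr (\tr (_ *m _)).
  have d1 b y : V y -> pderive b (u \o prm S a) y = pderive b (fun z => Nf z ord0 vt) y.
    by move=> Vy; apply: (pderive_near_on _ Vo Vy).
  apply/matrixP => b c; rewrite [LHS]mxE [RHS]mxE; congr (_ - _).
    by apply: (pderive_near_on _ Vo Vx) => y Vy; exact: d1.
  by apply: eq_bigr => d _; rewrite d1.
have gradE : \sum_b \sum_c ginv a p b c * ptl a b (psi \o f) p * ptl a c u p =
  ((q x)^T *m (tangent phi x)^T *m invmx (g x) *m shape phi Nf G x *m (delta_mx vt ord0 : 'cV[R]_n.+2)) ord0 ord0.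
  have colE r (X : 'M[R]_(r, n.+2)) k : (X *m delta_mx vt ord0) k (ord0 : 'I_1) = X k vt.
    rewrite mxE (bigD1 vt) //= mxE !eqxx mulr1 big1 ?addr0 // => j /negbTE jk.
    by rewrite mxE jk mulr0.
  rewrite colE mxE exchange_big; apply: eq_bigr => c _.
  rewrite mxE mulr_suml; apply: eq_bigr => b _.
  rewrite /ginv /chart_metric px [_ * ptl a b _ _]mulrC; congr (_ * _ * _).
    have -> : ptl a b (psi \o f) p = pderive b (fun y => Psi (phi y)) x.
      apply: (pderive_near_on _ Vo Vx) => y /overlapP[_ _ d].
      by rewrite /comp /phi prmKW.
    have cp := comp_pd Vo Uo phi_img (phi_Ck 3) (b := b) (kPsi 1) Vx.
    rewrite (is_pd_unique (proj1 Vo _ Vx) cp) -trmx_mul mxE mxE.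
    by apply: eq_bigr => k _; congr (_ * _); rewrite mxE.
  have -> : ptl a c u p = pderive c (fun z => Nf z ord0 vt) x.
    by apply: (pderive_near_on _ Vo Vx).
  exact: (theta_pd Nf phi_img chr0 c Vx).
rewrite /laplacian_w lapE gradE.
have addE (X Y : 'M[R]_1) : (X + Y) ord0 ord0 = X ord0 ord0 + Y ord0 ord0 by rewrite mxE.
have oppE (X : 'M[R]_1) : (- X) ord0 ord0 = - X ord0 ord0 by rewrite mxE.
have t1 (X : 'M[R]_1) : X ord0 ord0 = X^T ord0 ord0 by rewrite mxE.
have /matrixP/(_ ord0 ord0) := main; rewrite addE => ->.
have dq : dom M i (f p).1 by case: dfp.
rewrite !addE !oppE -shape_norm2E // (ric_of_chart Vx) chart_metric_phi // px.
set e := delta_mx vt ord0 : 'cV[R]_n.+2; rewrite (_ : Nf x = N i p); last by rewrite /Nf px.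
(* [xi] and its dual covector have the same components, so raising the index of [e] changes
   nothing. *)
have Ge : met W i (f p) *m e = e.
  by apply/colP => k; rewrite -colE mxE met_cylinder0r mxE eqxx andbT.
rewrite -(mulmxA _ (invmx _)).
have -> : invmx (met W i (f p)) *m e = e by rewrite -{1}Ge mulKmx // met_unit_cylinder.
have eT : e^T = xi by rewrite trmx_delta.
(* Ric_psi(xi, N) = -v'' theta, by the splitting of metric and weight. *)
have e3 : (N i p *m (ricci (M := W) i (f p) - hessian (M := W) i psi (f p))^T *m e) ord0 ord0
    = - derive1n 2 v (f p).2 * N i p ord0 vt.
  rewrite t1 !trmx_mul trmxK eT mulmxA -/(ric_w psi i (f p) xi (N i p)).
  rewrite (ric_w_cylinder M_riem h_smooth v_smooth psiE) //.
  rewrite /ric_w (_ : rsubmx _ = 0) ?mul0mx ?mxE ?eqxx ?mulr1 ?addr0 //.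
  by apply/rowP => k; rewrite !mxE.
have e5 : (N i p *m (ricci (M := W) i (f p) - hessian (M := W) i psi (f p))^T *m (N i p)^T)
    ord0 ord0 = ric_w psi i (f p) (N i p) (N i p).
  by rewrite t1 !trmx_mul !trmxK mulmxA.
have e6 : (N i p *m e) ord0 ord0 = N i p ord0 vt by rewrite -colE mxE.
rewrite e3 -mulmxA mul_scalar_mx mxE e6 [X in _ - _ - X]mxE big_ord1 e5 e6.
ring.
Qed.

Hypothesis f_free : free_boundary f N.

Lemma met_posdef_cylinder q : dom M i q.1 -> posdef (met W i q).
Proof.
move=> dq w w0; have -> : (w *m met W i q *m w^T) ord0 ord0 =
    w ord0 vt * w ord0 vt + inner (M := M) i q.1 (rsubmx (w : 'rV[R]_(1 + n.+1)))
      (rsubmx (w : 'rV[R]_(1 + n.+1))) := @inner_cylinder R n M i q w w.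
set z := rsubmx _.
have [z0|z0] := eqVneq z 0; last first.
  apply: ltr_wpDl; first by rewrite -expr2 sqr_ge0.
  exact: (met_posdef M_riem dq).
have w00 : w ord0 vt != 0.
  apply: contraNneq w0 => w00; apply/eqP/rowP; elim/(@ord_split n) => [|b].
    by rewrite w00 mxE.
  have /rowP/(_ b) := z0; rewrite mxE => ->; by rewrite !mxE.
by rewrite z0 /inner !mul0mx mxE addr0 -expr2 exprn_even_gt0.
Qed.

(** [free_boundary] gives a boundary chart of unspecified index around the image point;
    [boundary_bchart] moves it to the chart [i]. There orthogonality to [eta] means that the last
    component is zero. *)
Lemma boundary_overlap y : V y -> y ord0 ord_max = 0 ->
  phi y ord0 ord_max = 0 /\ Nf y ord0 ord_max = 0.
Proof.
move=> Vy y0; have [dy cy dfy] := overlapP Vy.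
have by_ : boundary (prm S a y) by exists a; split => //; rewrite cy.
have [j bj] : boundary (M := W) (f (prm S a y)).
  by case: f_free => + _ => /seteqP[h1 _]; exact: h1.
have biM : bchart (M := M) i (f (prm S a y)).1.
  apply: (boundary_bchart M_riem); first by case: dfy.
  by exists j; apply/bchart_cylinder.
have biW : bchart (M := W) i (f (prm S a y)) by apply/bchart_cylinder.
have dq : dom M i (f (prm S a y)).1 by case: dfy.
split; first by case: biW.
have [eta heta] := inner_unit_normal_exists (met_sym_cylinder dq) (met_posdef_cylinder dq).
have [lam lam0 lamE] := inner_unit_normalP heta.
have : inner (M := W) i (f (prm S a y)) (N i (prm S a y)) eta = 0.
  by case: f_free => _; apply.
rewrite lamE => /eqP; rewrite mulf_eq0 gt_eqF //= => /eqP; exact.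
Qed.

(* [eta] is the image of [nu], and [w] below are the components of the tangent
   part of xi, which is tangent to the boundary: differentiating [N_last = 0]
   along [w] gives the formula. *)
Lemma conormal_derivative p (u : pt S -> R) (nu : 'rV[R]_n.+1) (eta : 'rV[R]_n.+2) :
  bchart a p -> dom W i (f p) ->
  (forall q, dom W i (f q) -> u q = N i q ord0 vt) ->
  inner_unit_normal a p nu -> inner_unit_normal (M := W) i (f p) eta ->
  \sum_b nu ord0 b * ptl a b u p =
  - N i p ord0 vt * second_ff_boundary (M := W) i (f p) eta (N i p) (N i p).
Proof.
move=> [dp p0] dfp uE hnu heta; have Vx := overlap_crd dp dfp.
set x := crd S a p in Vx p0; have px : prm S a x = p by exact: prmKS.
have Hx := proj1 Vo _ Vx.
have [lam lam0 lamE] := inner_unit_normalP heta.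
have [mu mu0 muE] := inner_unit_normalP hnu.
have [_ NL0] := boundary_overlap Vx p0.
have dq : dom M i (f p).1 by case: dfp.
pose J := tangent phi x; pose B := shape phi Nf G x; pose Gp := met W i (f p).
pose Np := N i p; pose gi := invmx (g x).
pose e0 := delta_mx vt ord0 : 'cV[R]_n.+2.
pose eL := delta_mx ord_max ord0 : 'cV[R]_n.+2.
pose eS := delta_mx ord_max ord0 : 'cV[R]_n.+1.
have NE : Nf x = Np by rewrite /Nf px.
have GE : G (phi x) = Gp by rewrite chart_metric_phi // px.
have gE : g x = met S a p by rewrite /chart_metric px.
have sG : Gp^T = Gp by exact: met_sym_cylinder.
have uG : Gp \in unitmx by exact: met_unit_cylinder.
have ug : g x \in unitmx by exact: posdef_unit (chart_metric_posdef Vx).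
have colE' r k (X : 'M[R]_(r, k.+1)) c j : (X *m (delta_mx c ord0 : 'cV[R]_k.+1)) j ord0 = X j c.
  by rewrite -colE mxE.
have H1 : Gp *m eta^T = lam *: eL.
  apply/colP => k; have := lamE (delta_mx ord0 k).
  rewrite /inner -mulmxA -rowE mxE => ->.
  by rewrite !mxE eqxx andbT eq_sym.
have H2 : g x *m nu^T = mu *: eS.
  apply/colP => k; have := muE (delta_mx ord0 k).
  rewrite /inner -mulmxA -rowE mxE gE => ->.
  by rewrite !mxE eqxx andbT eq_sym.
have phiL0 y : V y -> y ord0 ord_max = 0 -> phi y ord0 ord_max = 0.
  by move=> Vy y0; have [] := boundary_overlap Vy y0.
have NL y : V y -> y ord0 ord_max = 0 -> Nf y ord0 ord_max = 0.
  by move=> Vy y0; have [] := boundary_overlap Vy y0.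
(* Boundary goes to boundary, so only the last tangent vector has a last component [kappa]; it is
   nonnegative because the image stays in the half-space. *)
pose kappa := J ord_max ord_max.
have kappa0 : 0 <= kappa.
  rewrite /kappa /J mxE.
  apply: (boundary_pd_ge0 Vo Vx _ (Ck_pd (k := 0) (phi_Ck 1 ord_max) Vx)) => y Vy.
  by rewrite (phiL0 x) //; apply: (proj1 Uo); exact: phi_img.
have JL : J *m eL = kappa *: eS.
  apply/colP => b; rewrite colE' [RHS]mxE [eS _ _]mxE eqxx andbT.
  have [->|bL] := eqVneq b ord_max; first by rewrite mulr1.
  rewrite mulr0 /J mxE.
  exact: (boundary_tangent_pd Vo Vx bL p0 phiL0 (Ck_pd (k := 0) (phi_Ck 1 ord_max) Vx)).
have dNL b : b != ord_max -> pderive b (fun y => Nf y ord0 ord_max) x = 0.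
  move=> bL.
  exact: (boundary_tangent_pd Vo Vx bL p0 NL (Ck_pd (k := 0) (N_Ck 1 ord_max) Vx)).
have sGx : (G (phi x))^T = G (phi x) by rewrite GE.
have uGx : G (phi x) \in unitmx by rewrite GE.
have proj := tangent_proj sGx uGx ug (induced_metric Vx) (tangent_normal Vx) (normal_unit Vx).
have BN := shape_normal Vo Uo phi_img (phi_Ck 3) (N_Ck 2) (metric_Ck_cylinder 2)
    chart_metric_sym chart_metric_unit normal_unit Vx.
have Btan := B_tangent sGx uGx ug (induced_metric Vx) (tangent_normal Vx) (normal_unit Vx) BN.
have bsym := shape_sym Vo Uo phi_img (phi_Ck 3) (N_Ck 2) (metric_Ck_cylinder 2)
   chart_metric_sym chart_metric_unit tangent_normal Vx.
have gJ := induced_metric Vx.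
rewrite NE GE -/J -/gi in proj; rewrite GE -/J -/B -/gi in Btan.
rewrite GE -/J -/B in bsym; rewrite GE -/J in gJ.
(* [eta] is orthogonal to the normal, hence tangent to the hypersurface, where it is a nonnegative
   multiple [r] of the image of [nu]. Both are unit vectors, so [r = 1]. *)
have etaJ : eta = nu *m J.
  pose r := lam * kappa / mu.
  have e1 : eta^T = r *: (J^T *m nu^T).
    have : (J^T *m gi *m J) *m (Gp *m eta^T) = eta^T.
      rewrite proj mulmxBl mulKmx // -mulmxA H1 -scalemxAr.
      have -> : Np *m eL = 0 by apply/colP => k; rewrite ord1 colE' -NE NL0 mxE.
      by rewrite scaler0 mulmx0 subr0.
    move=> <-; rewrite -mulmxA H1 -scalemxAr JL scalerA.
    have -> : eS = mu^-1 *: (g x *m nu^T) by rewrite H2 scalerA mulVf ?gt_eqF // scale1r.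
    by rewrite scalerA -scalemxAr -mulmxA mulKmx.
  have e2 : eta = r *: (nu *m J) by rewrite -[LHS]trmxK e1 linearZ /= trmx_mul !trmxK.
  have r0 : 0 <= r by rewrite /r divr_ge0 ?mulr_ge0 // ltW.
  have : r ^+ 2 = 1.
    have [i1 _ _] := heta; have [j1 _ _] := hnu.
    rewrite -i1 /inner -/Gp {1}e2 e1 -!scalemxAl -scalemxAr scalerA [RHS]mxE.
    rewrite (_ : _ ord0 ord0 = 1) ?mulr1 //.
    by rewrite -[RHS]j1 /inner -gE gJ !mulmxA.
  move=> /eqP; rewrite -[X in _ == X](expr1n _ 2) eqrXn2 // => /eqP r1.
  by rewrite e2 r1 scale1r.
pose w := (gi *m (J *m e0))^T.
have gis : gi^T = gi by rewrite /gi trmx_inv gE; congr invmx; case: S_riem => _ [hs _ _ _]; exact: hs.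
have Ge : Gp *m e0 = e0.
  by apply/colP => k; rewrite colE' met_cylinder0r mxE eqxx andbT.
have eG : e0^T *m Gp = e0^T by rewrite -{1}sG -trmx_mul Ge.
have wJ : w *m J = e0^T - N i p ord0 vt *: Np.
  rewrite /w !trmx_mul gis -(mulmxA e0^T) -(mulmxA e0^T) proj mulmxBr.
  rewrite -{1}eG mulmxK // mulmxA -trmx_mul.
  have -> : (Np *m e0)^T = (N i p ord0 vt)%:M.
    by apply/matrixP => k l; rewrite !ord1 [LHS]mxE colE' [RHS]mxE eqxx mulr1n.
  by rewrite mul_scalar_mx.
have eta0 : eta ord0 vt = 0.
  have := lamE e0^T; rewrite /inner eG -trmx_mul [LHS]mxE colE' => ->.
  by rewrite !mxE /= mulr0.
(* [xi] is orthogonal to [eta], the image of [nu]; hence [w] is orthogonal to [nu], that is, tangent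
   to the boundary. *)
have wL : w ord0 ord_max = 0.
  have : inner a p w nu = 0.
    rewrite /inner -gE /w trmx_mul gis -(mulmxA _ gi) mulVmx // mulmx1.
    rewrite trmx_mul -mulmxA -trmx_mul -etaJ -trmx_mul [LHS]mxE colE'.
    exact: eta0.
  by rewrite muE => /eqP; rewrite mulf_eq0 gt_eqF //= => /eqP.
have chr0 y l m : U y -> chr G l y m vt = 0.
  move=> Uy; rewrite -(christoffelE prmKW) //.
  by rewrite (christoffel_vert M_riem (dom1 Uy)) ?eqxx ?orbT.
have chrE l m k : chr G l (phi x) m k = christoffel (M := W) i l m k (f p).
  rewrite -(christoffelE prmKW); last exact: phi_img.
  by rewrite /phi px prmKW.
have -> : \sum_b nu ord0 b * ptl a b u p = (nu *m (B *m e0)) ord0 ord0.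
  rewrite mxE; apply: eq_bigr => b _; congr (_ * _); rewrite colE'.
  rewrite -(theta_pd Nf phi_img chr0 b Vx).
  by apply: (pderive_near_on _ Vo Vx) => y /overlapP[_ _ d]; exact: uE.
(* Symmetry of the shape operator gives <D_nu N, xi> = <D_w N, eta>, and pairing with [eta] is [lam]
   times the last component. *)
have -> : nu *m (B *m e0) = (lam *: (w *m (B *m eL)))^T.
  rewrite !scalemxAr -H1.
  have -> : B *m (Gp *m eta^T) = B *m Gp *m J^T *m nu^T by rewrite etaJ trmx_mul !mulmxA.
  rewrite trmx_mul (trmx_mul _ nu^T) trmxK bsym /w trmxK {1}Btan.
  by rewrite !mulmxA.
rewrite [LHS]mxE [LHS]mxE [X in lam * X]mxE.
(* The last component of the normal has zero ordinary derivative along [w], so only Christoffel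
   terms remain. In [w *m J], which is xi - theta N, the vertical vector contributes nothing to
   them. *)
have -> : \sum_b w ord0 b * (B *m eL) b ord0 =
    - N i p ord0 vt * \sum_l \sum_m christoffel (M := W) i l m ord_max (f p) * Np ord0 l * Np ord0 m.
  transitivity (\sum_b w ord0 b * (Np *m Gam phi G b x) ord0 ord_max).
    apply: eq_bigr => b _; rewrite colE'.
    have [->|bL] := eqVneq b ord_max; first by rewrite wL !mul0r.
    congr (_ * _); rewrite [LHS]mxE [LHS]mxE -NE -[RHS]add0r; congr (_ + _).
    by rewrite [LHS]mxE; exact: dNL.
  transitivity ((Np *m \sum_l (w *m J) ord0 l *: chr G l (phi x)) ord0 ord_max).
    have -> : \sum_l (w *m J) ord0 l *: chr G l (phi x) = \sum_b w ord0 b *: Gam phi G b x.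
      rewrite /Gam; under [RHS]eq_bigr do rewrite scaler_sumr.
      rewrite exchange_big; apply: eq_bigr => l _.
      rewrite mxE scaler_suml; apply: eq_bigr => b _.
      by rewrite scalerA.
    rewrite mulmx_sumr summxE; apply: eq_bigr => b _.
    by rewrite -scalemxAr [RHS]mxE.
  have wJE l : (w *m J) ord0 l = (l == vt)%:R - N i p ord0 vt * Np ord0 l.
    by rewrite wJ !mxE eqxx andbT.
  rewrite [in RHS]exchange_big [LHS]mxE mulr_sumr; apply: eq_bigr => m _.
  rewrite summxE mulr_sumr mulr_sumr; apply: eq_bigr => l _.
  have -> : ((w *m J) ord0 l *: chr G l (phi x)) m ord_max =
      ((l == vt)%:R - N i p ord0 vt * Np ord0 l) * christoffel (M := W) i l m ord_max (f p).
    by rewrite -chrE -wJE mxE.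
  have [->|l0] := eqVneq l vt.
    by rewrite christoffel_vert ?eqxx // !(mulr0, mul0r).
  rewrite mulr0n; ring.
rewrite /second_ff_boundary lamE [X in _ = _ * (_ * X)]mxE; ring.
Qed.

End HypersurfaceCharts.

(** * The angle function *)

Section AngleFunction.
Context {R : realType} {n : nat} (M : rman R n) (M_riem : riemannian_manifold M).
Context (S : rman R n) (S_riem : riemannian_manifold S).
Local Notation W := (cylinder M).
Local Notation vt := (ord0 : 'I_n.+2).
Local Notation rs X := (rsubmx (X : 'rV[R]_(1 + n.+1))).
Variables (f : pt S -> pt W) (N : cidx W -> pt S -> 'rV[R]_n.+2).
Hypotheses (f_imm : isometric_immersion f) (N_gauss : gauss_map f N).
Implicit Types (a : cidx S) (i j : cidx W) (p : pt S).

Lemma angleE i p : angle f N i p = N i p ord0 vt.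
Proof.
have -> : angle f N i p = xi ord0 vt * N i p ord0 vt +
    inner (M := M) i (f p).1 (rs xi) (rs (N i p)) := @inner_cylinder R n M i _ _ _.
have -> : rs (xi : 'rV[R]_n.+2) = 0 by apply/rowP => k; rewrite !mxE.
by rewrite /inner !mul0mx !mxE eqxx mul1r addr0.
Qed.

Lemma normal_norm i p : dom W i (f p) ->
  inner (M := M) i (f p).1 (rs (N i p)) (rs (N i p)) = 1 - N i p ord0 vt ^+ 2.
Proof.
move=> d; case: N_gauss => _ _ h _; have := h i p d.
have -> : inner (M := W) i (f p) (N i p) (N i p) = N i p ord0 vt * N i p ord0 vt +
  inner (M := M) i (f p).1 (rs (N i p)) (rs (N i p)) := @inner_cylinder R n M i _ _ _.
by move=> <-; ring.
Qed.

Lemma inner_ge0 (i : cidx M) q X : dom M i q -> 0 <= inner i q X X.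
Proof.
move=> dq; have [->|X0] := eqVneq X 0; first by rewrite /inner !mul0mx mxE.
exact/ltW/(met_posdef M_riem dq).
Qed.

(** All charts of the cylinder share the height coordinate, so the vertical column of a transition
    Jacobian is a unit column. *)
Lemma angle_change i j p : dom W i (f p) -> dom W j (f p) ->
  N i p ord0 vt = N j p ord0 vt.
Proof.
move=> di dj; case: N_gauss => h _ _ _; rewrite (h i j p di dj).
have dq : dom M i (f p).1 by case: di.
have tE k : trans_jac (M := W) i j (f p) k vt = (k == vt)%:R.
  rewrite [LHS]mxE.
  have -> : (fun q => crd W j q ord0 vt) = (fun q : pt M * R => q.2).
    by apply/funext => q; exact: crd_cylinder0.
  rewrite (ptl_vert_fun M_riem (w := id) k dq); last exact: derivable_id.
  by rewrite derive1_id mulr1.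
rewrite [RHS]mxE (bigD1 vt) //= tE eqxx mulr1 big1 ?addr0 // => k /negbTE kv.
by rewrite tE kv mulr0.
Qed.

Lemma cylinder_chart (q : pt W) : exists i, dom W i q.
Proof. by case: M_riem => -[_ _ h _ _] _; have [i di] := h q.1; exists i. Qed.

(** Parabolicity concerns a function on Sigma, whereas [N] is given chart by chart. The chart is
    picked by choice, and [angle_change] makes the value independent of it. *)
Definition angle_fun p : R := N (sval (cid (cylinder_chart (f p)))) p ord0 vt.

Lemma angle_funE i p : dom W i (f p) -> angle_fun p = N i p ord0 vt.
Proof.
by move=> di; apply: angle_change => //; exact: svalP (cid (cylinder_chart (f p))).
Qed.

Lemma angle_fun_Ck k : CkM k angle_fun.
Proof.
move=> a; have S_smooth : smooth_manifold S by case: S_riem.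
apply: Ck_local; first exact: manifold_img.
move=> x [p dp <-]; have [i di] := cylinder_chart (f p).
exists (overlap f a i); split.
- exact: relopen_overlap.
- exact: overlap_crd.
apply: (Ck_eq (f := fun x => N_chart N a i x ord0 vt)).
- exact: relopen_overlap.
- by move=> y /(overlapP S_riem)[_ _ d]; rewrite /= (angle_funE d).
- exact: N_Ck.
Qed.

Lemma laplacian_cst (phi : pt S -> R) a (k : R) p : dom S a p ->
  laplacian_w phi a (fun=> k) p = 0.
Proof.
move=> dp; have S_smooth : smooth_manifold S by case: S_riem.
have imgo := manifold_img a S_smooth.
have d0 b (C : R) p' : dom S a p' -> ptl a b (fun=> C) p' = 0.
  move=> dp'; apply: is_pd_unique (is_pd_cst _ _ _).
  by apply: (proj1 imgo); exact: img_crd.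
have dd0 b c : ptl a b (ptl a c (fun=> k)) p = 0.
  rewrite (@ptl_near _ _ S a imgo (fun p => manifold_prmK S_smooth) b _ (fun=> 0)) ?d0 //.
  by move=> q dq; rewrite d0.
rewrite /laplacian_w (_ : hessian a _ p = 0); last first.
  apply/matrixP => b c; rewrite [LHS]mxE [RHS]mxE dd0 big1 ?subrr // => d _.
  by rewrite d0 // mulr0.
rewrite mulmx0 mxtrace0 add0r big1 // => b _; rewrite big1 // => c _.
by rewrite d0 // mulr0.
Qed.

Variables (h : pt M -> R) (h_smooth : CinfM h).
Variables (v : R -> R) (v_smooth : forall k t, derivable (derive1n k v) t 1).
Variables (psi : pt W -> R) (psiE : forall q : pt M * R, psi q = h q.1 + v q.2).
Variable c : R.
Hypothesis ric_v : forall t, - derive1n 2 v t <= c.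
Hypothesis ric_h : forall (i : cidx M) (q : pt M) (w : 'rV[R]_n.+1), dom M i q ->
  c * inner i q w w <= ric_w h i q w w.

(* The coefficient [v'' + Ric_psi(N, N)] is a sum of two nonnegative terms, one
   for each of the bounds [Ric_v <= c <= Ric_h]. *)
Lemma ric_split i p : dom W i (f p) ->
  derive1n 2 v (f p).2 + ric_w psi i (f p) (N i p) (N i p) =
  (derive1n 2 v (f p).2 + c) * (1 - N i p ord0 vt ^+ 2) +
  (ric_w h i (f p).1 (rs (N i p)) (rs (N i p))
    - c * inner (M := M) i (f p).1 (rs (N i p)) (rs (N i p))).
Proof.
move=> d; have dq : dom M i (f p).1 by case: d.
rewrite (ric_w_cylinder M_riem h_smooth v_smooth psiE _ _ dq) normal_norm //; ring.
Qed.

Lemma ric_terms_ge0 i p : dom W i (f p) ->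
  [/\ 0 <= derive1n 2 v (f p).2 + c, 0 <= 1 - N i p ord0 vt ^+ 2 &
      0 <= ric_w h i (f p).1 (rs (N i p)) (rs (N i p))
        - c * inner (M := M) i (f p).1 (rs (N i p)) (rs (N i p))].
Proof.
move=> d; have dq : dom M i (f p).1 by case: d.
split; last by rewrite subr_ge0; exact: ric_h.
- have := ric_v (f p).2; lra.
- by rewrite -normal_norm //; exact: inner_ge0.
Qed.

Lemma ric_coef_ge0 i p : dom W i (f p) ->
  0 <= derive1n 2 v (f p).2 + ric_w psi i (f p) (N i p) (N i p).
Proof.
move=> d; rewrite ric_split //; have [h1 h2 h3] := ric_terms_ge0 d.
by rewrite addr_ge0 // mulr_ge0.
Qed.

Lemma shape_norm2_ge0 a i p : dom S a p -> dom W i (f p) ->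
  0 <= shape_norm2 f N a i p /\
  (shape_norm2 f N a i p = 0 -> second_ff f N a i p = 0).
Proof.
move=> dp dfp; case: S_riem => _ [gs gp _ _].
apply: posdef_trace; [exact: gs|by move=> w w0; exact: gp|].
exact: (second_ff_sym M_riem S_riem f_imm N_gauss).
Qed.

Hypothesis f_free : free_boundary f N.
Hypothesis M_convex : locally_convex_boundary M.

(** [eta] is horizontal and restricts to the inner normal of the boundary of [M], and the free
    boundary condition makes the horizontal part of the normal tangent to it. Convexity of the
    boundary of [M] then applies. *)
Lemma second_ff_boundary_ge0 i p (eta : 'rV[R]_n.+2) : boundary p ->
  bchart (M := W) i (f p) -> inner_unit_normal (M := W) i (f p) eta ->
  0 <= second_ff_boundary (M := W) i (f p) eta (N i p) (N i p).
Proof.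
move=> bp bfp heta; have [di _] := bfp; have dq : dom M i (f p).1 by case: di.
have biM : bchart (M := M) i (f p).1 by apply/bchart_cylinder.
have LE (X : 'rV[R]_n.+2) : rs X ord0 ord_max = X ord0 ord_max.
  by rewrite mxE (_ : rshift 1 ord_max = ord_max) //; exact: val_inj.
have [lam lam0 lamE] := inner_unit_normalP heta.
have NL : N i p ord0 ord_max = 0.
  have : inner (M := W) i (f p) (N i p) eta = 0 by case: f_free => _; apply.
  by rewrite lamE => /eqP; rewrite mulf_eq0 gt_eqF //= => /eqP.
have innE (X Y : 'rV[R]_n.+2) : inner (M := W) i (f p) X Y =
    X ord0 vt * Y ord0 vt + inner (M := M) i (f p).1 (rs X) (rs Y).
  exact: inner_cylinder.
have eta0 : eta ord0 vt = 0.
  have := lamE xi; rewrite innE (_ : rs xi = 0).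
    rewrite /inner !mul0mx [(0 : 'M[R]_1) _ _]mxE addr0 /xi !mxE !eqxx mul1r => -> /=.
    by rewrite mulr0.
  by apply/rowP => k; rewrite !mxE.
rewrite (second_ff_cylinder M_riem _ _ _ dq).
apply: M_convex => //; last by rewrite LE.
have [e1 e2 e3] := heta; split.
- by rewrite -e1 innE eta0 mul0r add0r.
- by rewrite LE.
move=> X X0; have := e3 (row_mx (0 : 'M[R]_1) X : 'rV[R]_(1 + n.+1)).
rewrite -LE row_mxKr => /(_ X0); rewrite innE eta0 mulr0 add0r row_mxKr.
exact.
Qed.

Lemma boundary_charts p : boundary p -> exists i, bchart (M := W) i (f p).
Proof. by case: f_free => + _ => /seteqP[h1 _] /h1. Qed.

Hypothesis cmc : constant_mean_curvature_w f N psi.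
Hypothesis angle_le0 : forall i p, dom W i (f p) -> angle f N i p <= 0.

Lemma angle_laplacian_ge0 a p : dom S a p ->
  0 <= laplacian_w (psi \o f) a angle_fun p.
Proof.
move=> dp; have [i di] := cylinder_chart (f p).
rewrite (laplacian_angle M_riem S_riem f_imm N_gauss h_smooth v_smooth psiE cmc dp di)
  //; last by move=> q dq; exact: angle_funE.
rewrite -addrA mulr_ge0 //; first by rewrite oppr_ge0 -angleE angle_le0.
by rewrite addr_ge0 // ?ric_coef_ge0 //; case: (shape_norm2_ge0 dp di).
Qed.

Lemma angle_conormal a i p (nu : 'rV[R]_n.+1) (eta : 'rV[R]_n.+2) :
  bchart a p -> dom W i (f p) -> inner_unit_normal a p nu ->
  inner_unit_normal (M := W) i (f p) eta ->
  \sum_b nu ord0 b * ptl a b angle_fun p =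
  - N i p ord0 vt * second_ff_boundary (M := W) i (f p) eta (N i p) (N i p).
Proof.
move=> bp di hnu heta; apply: conormal_derivative => // q dq.
exact: angle_funE.
Qed.

Lemma angle_conormal_ge0 a p (nu : 'rV[R]_n.+1) : bchart a p ->
  inner_unit_normal a p nu -> 0 <= \sum_b nu ord0 b * ptl a b angle_fun p.
Proof.
move=> bp hnu; have bp' : boundary p by exists a.
have [i bi] := boundary_charts bp'; have [di _] := bi.
have dq : dom M i (f p).1 by case: di.
have [eta heta] := inner_unit_normal_exists (met_sym_cylinder M_riem dq)
  (met_posdef_cylinder M_riem dq).
rewrite (angle_conormal bp di hnu heta) mulr_ge0 //.
  by rewrite oppr_ge0 -angleE angle_le0.
exact: second_ff_boundary_ge0.
Qed.

(** Orthogonality to a vertical normal kills the derivatives of the height, which is therefore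
    locally constant, and constant by connectedness. *)
Lemma slice_of_vertical_normal : connected [set: pt S] ->
  (forall i p, dom W i (f p) -> rs (N i p) = 0) -> in_slice f.
Proof.
move=> S_conn hN; have S_smooth : smooth_manifold S by case: S_riem.
have hd a b x : img a x -> is_pd b (fun y => (f (prm S a y)).2) x 0.
  move=> [p dp <-]; have [i di] := cylinder_chart (f p).
  have Vo := relopen_overlap M_riem S_riem f_imm a i.
  have Vx := overlap_crd dp di.
  have px : prm S a (crd S a p) = p by exact: manifold_prmK.
  have crd0 y : phi_chart f a i y ord0 vt = (f (prm S a y)).2.
    exact: crd_cylinder0.
  have h1 : is_pd b (fun y => phi_chart f a i y ord0 vt) (crd S a p) _ :=
    Ck_pd (k := 0) (phi_Ck f_imm a i 1 vt) Vx.
  rewrite (_ : (fun y => _) = fun y => phi_chart f a i y ord0 vt); last first.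
    by apply/funext => y; rewrite crd0.
  suff <- : pderive b (fun y => phi_chart f a i y ord0 vt) (crd S a p) = 0 by [].
  case: N_gauss => _ _ hu hp; have := hp a i p b dp di.
  have -> : inner (M := W) i (f p) (row b (jac f a i p)) (N i p) =
      row b (jac f a i p) ord0 vt * N i p ord0 vt + inner (M := M) i (f p).1
        (rs (row b (jac f a i p))) (rs (N i p)) := @inner_cylinder R n M i _ _ _.
  rewrite hN // /inner trmx0 mulmx0 [X in _ + X]mxE addr0 [row _ _ _ _]mxE [jac _ _ _ _ _ _]mxE.
  move=> /eqP; rewrite mulf_eq0 => /orP[/eqP <- //|/eqP N0].
  have := normal_norm di; rewrite hN // N0 /inner !mul0mx mxE expr2 mul0r subr0.
  by move=> /eqP; rewrite eq_sym oner_eq0.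
have loc p : \forall q \near p, (f q).2 = (f p).2.
  have [a da] : exists a, dom S a p by case: S_smooth => _ _ h1 _ _; exact: h1.
  have imgo := manifold_img a S_smooth.
  have prmK q : dom S a q -> prm S a (crd S a q) = q := manifold_prmK S_smooth.
  have ia := img_crd da.
  have := locally_constant imgo ia (fun y b => @hd a b y).
  rewrite prmK // => h1.
  have h2 : \forall y \near nbhs (crd S a p), halfspace y -> (f (prm S a y)).2 = (f p).2 by exact: h1.
  have [oa cc] : open (dom S a) /\ {within dom S a, continuous (crd S a)}.
    by case: S_smooth => _ _ _ /(_ a) [].
  have h3 : \forall q \near p, dom S a q by exact: open_nbhs_nbhs.
  have h4 : \forall q \near nbhs p, dom S a q ->
      halfspace (crd S a q) -> (f (prm S a (crd S a q))).2 = (f p).2.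
    by move/subspace_continuousP: cc => /(_ p da) cc; exact: (cc _ h2).
  move: h3 h4; apply: filterS2 => q dq h4; rewrite -{1}(prmK q dq); apply: h4 => //.
  by apply: (proj1 imgo); exact: img_crd.
have [[p0 _]|S0] := pselect (exists p : pt S, True); last first.
  by exists 0 => p; case: S0; exists p.
exists (f p0).2 => p.
(* Local constancy makes every set defined by a condition on the height open; level sets are thus
   open and closed. *)
have cl (Q : R -> Prop) : open [set q : pt S | Q (f q).2].
  rewrite openE => q /= Qq; have := loc q.
  by apply: filterS => q' /= ->.
pose B := [set q : pt S | (f q).2 = (f p0).2].
have : B = [set: pt S].
  apply: S_conn; first by exists p0.
  - by exists B; [exact: (cl (fun r => r = (f p0).2))|rewrite setTI].
  - exists B; last by rewrite setTI.
    rewrite -openC; exact: (cl (fun r => r <> (f p0).2)).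
by move=> /seteqP[_ /(_ p)]; exact.
Qed.

End AngleFunction.

Theorem theorem4p2 (R : realType) (n : nat)
  (M : rman R n) (M_riem : riemannian_manifold M)
  (M_complete : complete_manifold M) (M_connected : connected [set: pt M])
  (M_oriented : orientable M) (M_convex : locally_convex_boundary M)
  (h : pt M -> R) (h_smooth : CinfM h)
  (v : R -> R) (v_smooth : forall k t, derivable (derive1n k v) t 1)
  (psi : pt (cylinder M) -> R)
  (psiE : forall q : pt M * R, expR (psi q) = expR (h q.1) * expR (v q.2))
  (c : R)
  (ric_v : forall t, - derive1n 2 v t <= c)
  (ric_h : forall (i : cidx M) p (w : 'rV[R]_n.+1), dom M i p ->
     c * inner i p w w <= ric_w h i p w w)
  (Sigma : rman R n) (f : pt Sigma -> pt (cylinder M))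
  (N : cidx (cylinder M) -> pt Sigma -> 'rV[R]_n.+2)
  (Sigma_multigraph : horizontal_multigraph f N)
  (Sigma_parabolic : parabolic (psi \o f))
  (Sigma_cmc : constant_mean_curvature_w f N psi)
  (Sigma_free : free_boundary f N) :
  constant_angle f N /\
  [\/ is_cylinder f N,
      in_slice f |
      [/\ totally_geodesic f N,
          forall i p, dom (cylinder M) i (f p) ->
            ric_w psi i (f p) (N i p) (N i p) = c /\
            ric_w psi i (f p) xi xi = c &
          forall i p (eta : 'rV[R]_n.+2), boundary p -> bchart i (f p) ->
            inner_unit_normal i (f p) eta ->
            second_ff_boundary i (f p) eta (N i p) (N i p) = 0]].
Proof.
have psiD (q : pt M * R) : psi q = h q.1 + v q.2.
  by apply: expR_inj; rewrite psiE expRD.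
have [S_conn S_riem f_imm N_gauss ang0] := Sigma_multigraph.
have S_smooth : smooth_manifold Sigma by case: S_riem.
pose u := angle_fun M_riem f N.
have uE i p : dom (cylinder M) i (f p) -> u p = N i p ord0 ord0.
  by move=> d; exact: (angle_funE M_riem N_gauss).
have u_le0 p : u p <= 0.
  have [i di] := cylinder_chart M_riem (f p).
  by rewrite (uE i) // -(angleE f N); exact: ang0.
have [k uk] : exists k, forall p, u p = k.
  apply: Sigma_parabolic.
  - exact: (angle_fun_Ck M_riem S_riem f_imm N_gauss).
  - by exists 0.
  - move=> a p dp _.
    exact: (angle_laplacian_ge0 M_riem S_riem f_imm N_gauss h_smooth v_smooth psiD
      ric_v ric_h).
  - move=> a p nu bp hnu.
    exact: (angle_conormal_ge0 M_riem S_riem f_imm N_gauss).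
have Nk i p : dom (cylinder M) i (f p) -> N i p ord0 ord0 = k.
  by move=> d; rewrite -uE.
split; first by exists k => i p d; rewrite angleE Nk.
have [k0|k0] := eqVneq k 0.
  by apply: Or31 => i p d; rewrite angleE Nk.
(* A constant has zero psi-Laplacian, so for [k != 0] the Jacobi equation says that two nonnegative
   terms sum to zero, at boundary points too. *)
have flat a i p : dom Sigma a p -> dom (cylinder M) i (f p) ->
    shape_norm2 f N a i p = 0 /\
    derive1n 2 v (f p).2 + ric_w psi i (f p) (N i p) (N i p) = 0.
  move=> dp di; have := laplacian_cst S_riem (psi \o f) k dp.
  have -> : (fun=> k) = u by apply/funext => q; rewrite uk.
  rewrite (laplacian_angle M_riem S_riem f_imm N_gauss h_smooth v_smooth psiD Sigma_cmc dp di)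
    //; last by move=> q dq; exact: uE.
  rewrite Nk // -addrA => /eqP; rewrite mulf_eq0 oppr_eq0 (negbTE k0) /=.
  have [s0 _] := shape_norm2_ge0 M_riem S_riem f_imm N_gauss dp di.
  have r0 := ric_coef_ge0 M_riem N_gauss h_smooth v_smooth psiD ric_v ric_h di.
  by rewrite paddr_eq0 // => /andP[/eqP -> /eqP ->].
have covS p : exists a, dom Sigma a p by case: S_smooth => _ _ h1 _ _; exact: h1.
(* If [k ^+ 2 = 1], the unit normal has no horizontal part left. *)
have [k1|k1] := eqVneq (k ^+ 2) 1.
  apply: Or32; apply: (slice_of_vertical_normal M_riem S_riem f_imm N_gauss S_conn).
  move=> i p di; apply/eqP; apply: contraT => N0.
  have := met_posdef M_riem (i := i) (p := (f p).1) _ N0.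
  have := normal_norm N_gauss di; rewrite Nk // k1 subrr /inner => ->.
  by rewrite ltxx; apply; case: di.
apply: Or33; split.
- move=> a i p dp di; have [s0 _] := flat a i p dp di.
  by have [_] := shape_norm2_ge0 M_riem S_riem f_imm N_gauss dp di; apply.
- move=> i p di; have [a da] := covS p; have [_ r0] := flat a i p da di.
  have dq : dom M i (f p).1 by case: di.
  have [v0 N0 h0] := ric_terms_ge0 M_riem N_gauss ric_v ric_h di.
  move: r0; rewrite (ric_split M_riem N_gauss h_smooth v_smooth psiD c di) => /eqP.
  (* Here 1 - k^2 is nonzero, so v'' = -c, and the horizontal term attains its bound. Hence
     Ric_psi(N, N) = c k^2 + c (1 - k^2) = c. *)
  rewrite paddr_eq0 ?mulr_ge0 // Nk // mulf_eq0 => /andP[/orP[/eqP vc|]]; last first.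
    by rewrite subr_eq0 eq_sym (negbTE k1).
  have vE : - derive1n 2 v (f p).2 = c by lra.
  rewrite normal_norm // Nk // subr_eq0 => /eqP hE.
  rewrite !(ric_w_cylinder M_riem h_smooth v_smooth psiD _ _ dq) Nk // hE vE.
  split; first by ring.
  rewrite !mxE !eqxx !mulr1 /ric_w (_ : rsubmx _ = 0) ?mul0mx ?mxE ?addr0 //.
  by apply/rowP => b; rewrite !mxE.
move=> i p eta bp bi heta; have [a ba] := bp; have [di _] := bi; have [da _] := ba.
have [nu hnu] : exists nu, inner_unit_normal a p nu.
  case: S_riem => _ [gs gp _ _].
  by apply: inner_unit_normal_exists; [exact: gs|move=> w w0; exact: gp].
(* The conormal derivative of a constant angle is zero, so -k II(N, N) = 0. *)
have := angle_conormal M_riem S_riem f_imm N_gauss Sigma_free ba di hnu heta.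
rewrite Nk // big1 => [|b _].
  by move=> /esym/eqP; rewrite mulf_eq0 oppr_eq0 (negbTE k0) /= => /eqP.
rewrite (_ : angle_fun M_riem f N = fun=> k); last by apply/funext => q; exact: uk.
rewrite (_ : ptl a b _ p = 0) ?mulr0 //.
apply: is_pd_unique (is_pd_cst _ _ _).
by apply: (proj1 (manifold_img a S_smooth)); exact: img_crd.
Qed.
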